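(* Let $G$ be an l.c.s.c. group, $A$ a Polish $G$-module and $p\geq 0$. Then every class in $\mathrm{H}^p_{\mathrm{m}}(G,A)$ has a representative cocycle in the homogeneous measurable bar resolution, i.e. a $G$-equivariant measurable map $\sigma:G^{p+1}\to A$ with $d\sigma=0$, for which there is a dense $G_\delta$ subset $S\subseteq G^{p+1}$ of full Haar measure, containing the identity $(e,\dots,e)$, such that $\sigma$ is continuous at every point of $S$.
   Context: Measurable cohomology: for an l.c.s.c. group $G$ and a Polish $G$-module $A$ (Polish Abelian group with continuous action of $G$ by automorphisms), cochains are Haar-a.e. classes of measurable maps $G^{p+1}\to A$ with diagonal action $(g\cdot\phi)(g_1,\dots)=g\cdot\phi(g^{-1}g_1,\dots)$; $G$-equivariant means fixed by this action. The differential is $d\sigma(g_1,\dots,g_{p+1})=\sum_{i=1}^{p+1}(-1)^{p+1-i}\sigma(g_1,\dots,\widehat{g_i},\dots,g_{p+1})$, and $\mathrm{H}^p_{\mathrm{m}}(G,A)$ is the homology in degree $p$ (cochains on $G^{p+1}$) of the complex of $G$-equivariant cochains. *)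

(* Defs.v *)
From HB Require Import structures.
From mathcomp Require Import all_boot all_order all_algebra.
From mathcomp Require Import all_classical all_reals all_analysis.
From mathcomp Require Import Rstruct Rstruct_topology.
From Stdlib Require Import Rdefinitions.

Set Implicit Arguments.
Unset Strict Implicit.
Unset Printing Implicit Defensive.

Import Order.TTheory GRing.Theory Num.Theory.
Local Open Scope classical_set_scope.
Local Open Scope ring_scope.

Definition borel_sets (T : topologicalType) : set (set T) := <<s @open T >>.

Definition borel_measurable (T U : topologicalType) (f : T -> U) : Prop :=
  forall B : set U, borel_sets B -> borel_sets (f @^-1` B).

Definition Gdelta_set (T : topologicalType) (S : set T) : Prop :=
  exists U : nat -> set T, (forall n, open (U n)) /\ S = \bigcap_n U n.

Definition separable_space (T : topologicalType) : Prop :=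
  exists D : set T, countable D /\ dense D.

Definition complete_metric_for (T : topologicalType) (d : T -> T -> R) : Prop :=
  [/\ [/\ (forall x y, 0 <= d x y),
      (forall x y, d x y = 0 <-> x = y),
      (forall x y, d x y = d y x) &
      (forall x y z, d x z <= d x y + d y z)],
      (forall U : set T, open U <->
         (forall x, U x -> (exists2 eps : R, 0 < eps & [set y | d x y < eps] `<=` U))) &
      (forall u : nat -> T,
         (forall eps : R, 0 < eps -> exists N : nat, forall m n : nat, leq N m -> leq N n ->
              d (u m) (u n) < eps) ->
         exists l : T, u @ \oo --> l)].

Definition polish_space (T : topologicalType) : Prop :=
  separable_space T /\ exists d : T -> T -> R, complete_metric_for d.

Definition is_group (G : Type) (mul : G -> G -> G) (inv : G -> G) (e : G) : Prop :=
  [/\ (forall x y z, mul x (mul y z) = mul (mul x y) z),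
      (forall x, mul e x = x),
      (forall x, mul x e = x),
      (forall x, mul (inv x) x = e) &
      (forall x, mul x (inv x) = e)].

Definition is_topological_group (G : topologicalType)
    (mul : G -> G -> G) (inv : G -> G) (e : G) : Prop :=
  is_group mul inv e /\ continuous (fun xy : G * G => mul xy.1 (inv xy.2)).

Definition is_lcsc_group (G : topologicalType)
    (mul : G -> G -> G) (inv : G -> G) (e : G) : Prop :=
  [/\ is_topological_group mul inv e, hausdorff_space G,
      locally_compact [set: G] & @second_countable G].

Definition is_borel_measure (T : topologicalType) (mu : set T -> \bar R) : Prop :=
  [/\ mu set0 = 0%E,
      (forall B, borel_sets B -> (0 <= mu B)%E) &
      (forall F : nat -> set T, (forall n, borel_sets (F n)) -> trivIset setT F ->
         (fun n => \sum_(i < n) mu (F i))%E @ \oo --> mu (\bigcup_n F n))].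

Definition is_haar_measure (T : topologicalType) (mul : T -> T -> T)
    (mu : set T -> \bar R) : Prop :=
  [/\ is_borel_measure mu /\ (exists B, borel_sets B /\ mu B <> 0%E),
      (forall g B, borel_sets B -> mu [set mul g x | x in B] = mu B),
      (forall K, compact K -> (mu K < +oo)%E),
      (forall B, borel_sets B ->
         mu B = ereal_inf [set mu U | U in [set U | open U /\ B `<=` U]]) &
      (forall U, open U ->
         mu U = ereal_sup [set mu K | K in [set K | compact K /\ K `<=` U]])].

(** Haar-null: contained in a Borel set of measure zero for a left Haar measure
   (by uniqueness of Haar measure this does not depend on the choice). *)
Definition haar_null (T : topologicalType) (mul : T -> T -> T) (N : set T) : Prop :=
  exists mu : set T -> \bar R, is_haar_measure mul mu /\
    (exists2 B, borel_sets B & N `<=` B /\ mu B = 0%E).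

Definition Gpow (G : topologicalType) (k : nat) : topologicalType := {ptws 'I_k -> G}.

Definition pow_mul (G : topologicalType) (mul : G -> G -> G) (k : nat)
    (x y : Gpow G k) : Gpow G k := fun i => mul (x i) (y i).

Definition null_in (G : topologicalType) (mul : G -> G -> G) (k : nat)
    (N : set (Gpow G k)) : Prop := haar_null (@pow_mul G mul k) N.

Definition haar_ae_eq (G : topologicalType) (mul : G -> G -> G) (A : Type) (k : nat)
    (f f' : Gpow G k -> A) : Prop :=
  null_in mul [set x | f x <> f' x].

Definition is_polish_Gmodule (G : topologicalType) (mul : G -> G -> G) (e : G)
    (A : topologicalZmodType) (act : G -> A -> A) : Prop :=
  [/\ polish_space A,
      (forall g a b, act g (a + b) = act g a + act g b),
      (forall a, act e a = a),
      (forall g h a, act (mul g h) a = act g (act h a)) &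
      continuous (fun ga : G * A => act ga.1 ga.2)].

Definition cochain_act (G : topologicalType) (mul : G -> G -> G) (inv : G -> G)
    (A : topologicalZmodType) (act : G -> A -> A) (k : nat)
    (g : G) (phi : Gpow G k -> A) : Gpow G k -> A :=
  fun x => act g (phi (fun i => mul (inv g) (x i))).

Definition equivariant_class (G : topologicalType) (mul : G -> G -> G) (inv : G -> G)
    (A : topologicalZmodType) (act : G -> A -> A) (k : nat)
    (phi : Gpow G k -> A) : Prop :=
  forall g : G, haar_ae_eq mul (cochain_act mul inv act g phi) phi.

(** Homogeneous differential: for sigma on G^n,
   d sigma(x_0,...,x_n) = sum_{j=0}^{n} (-1)^(n-j) sigma(x_0,..,^x_j,..,x_n)
   (this is the formula of the paper with i = j+1). *)
Definition dcob (G : topologicalType) (A : zmodType) (n : nat)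
    (sigma : Gpow G n -> A) : Gpow G n.+1 -> A :=
  fun x => \sum_(j < n.+1) (sigma (fun k : 'I_n => x (lift j k)) *~ ((-1) ^+ (n - j))).

(** Cohomologous cocycles in degree p (cochains on G^(p+1)):
   degree 0: equal a.e. (there are no coboundaries);
   degree n+1: differ a.e. by the differential of an equivariant measurable cochain on G^(n+1). *)
Definition cohomologous (G : topologicalType) (mul : G -> G -> G) (inv : G -> G)
    (A : topologicalZmodType) (act : G -> A -> A) (p : nat) :
    (Gpow G p.+1 -> A) -> (Gpow G p.+1 -> A) -> Prop :=
  match p return (Gpow G p.+1 -> A) -> (Gpow G p.+1 -> A) -> Prop with
  | 0%N => fun s t => haar_ae_eq mul s t
  | n.+1 => fun s t =>
      exists beta : Gpow G n.+1 -> A,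
        [/\ borel_measurable beta, equivariant_class mul inv act beta &
            haar_ae_eq mul (fun x => s x - t x) (dcob beta)]
  end.

(* Main.v *)
(** Haar null sets are handled through probability measures on the powers of [G] with the same
    null sets.  Let [D_i(a, b)] be the homogeneous differential with [a] on the faces omitting one of
    the first [i] variables and [b] on the others.  From a strictly equivariant version [U_0] of the
    cocycle one builds equivariant [U_1, ..., U_(p+1)] with [D_i(U_(i-1), U_i) = 0] a.e., such that
    [U_i], as a function of its first [i] variables with values in measurable functions of the
    others, is continuous in measure at every point of a conull [G_delta] set containing the
    identity.  Freezing the first [i+1] variables, the equation for [U_(i+1)] asks for a primitive of
    a cocycle that is continuous in these variables; inserting a generic constant is a contraction,
    so primitives exist and are small when the cocycle is.  A Michael-type selection then applies:
    primitives are chosen locally constantly off null boundaries and corrected by a rapidly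
    converging series.  For [i = p+1] no other variable is left and continuity in measure is
    continuity.  Finally, [D_(i+1)(D_i(a, b), D_(i+1)(b, c)) = 0] and the same contraction give
    equivariant [Z_i] with [U_i - U_0 = D_i(Z_(i-1), Z_i)] a.e., and for [i = p+1] the right-hand
    side is the coboundary of [Z_p]. *)

From Stdlib Require Import Rdefinitions.
Require Import Defs.
From HB Require Import structures.
From mathcomp Require Import all_boot all_order all_algebra.
From mathcomp Require Import all_classical all_reals all_analysis.
From mathcomp Require Import Rstruct Rstruct_topology.
From mathcomp Require Import lra ring zify.

Set Implicit Arguments.
Unset Strict Implicit.
Unset Printing Implicit Defensive.

Import Order.TTheory GRing.Theory Num.Theory.
Import numFieldNormedType.Exports.
Local Open Scope classical_set_scope.
Local Open Scope ring_scope.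

Bind Scope ring_scope with R.

(** * Topology and Borel sets *)

(** A statement about almost every prefix says nothing at the identity, which may be a null point.
    Hence the equations are carried at every prefix in [S], and each countable cover used in the
    selection starts with a piece around the identity. [A] has no convex combinations, so local
    primitives cannot be glued by partitions of unity; they are kept constant on disjoint open
    pieces, and the boundaries lost in this way are the reason why continuity is only reached on a
    conull G_delta set. Equivariance is obtained by solving only over prefixes whose first
    coordinate is the identity and moving the solutions by [act]; this requires the action on
    measurable functions to be continuous in measure, which rests on the continuity of translations.
    The metric [d] is not assumed translation invariant, so [small] (the difference is near 0) and
    [close] (the values are near each other) must be compared one function at a time. The Haar
    measures on G^(p+1) and G^(p+2) are the witnesses inside [haar_null] in the hypotheses. *)

Definition countable_base (T : topologicalType) (b : nat -> set T) : Prop :=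
  (forall n, open (b n)) /\
  forall x U, nbhs x U -> exists2 n, b n x & b n `<=` U.

Definition has_base (T : topologicalType) : Prop := exists b : nat -> set T, countable_base b.

Lemma second_countable_has_base (T : topologicalType) : @second_countable T -> has_base T.
Proof.
move=> [B /countable_injP[f finj] [Bop Bbase]].
exists (fun n => xget set0 [set U | B U /\ f U = n]); split=> [n|x U xU].
  case: xgetP => [V _ [BV _]|_]; [exact: Bop|exact: open0].
have [V [BV Vx] VU] := Bbase x U xU.
exists (f V); case: xgetP => [W _ [BW /finj]|/(_ V)].
- by rewrite !inE => /(_ BW BV) ->.
- by move=> /not_andP[].
- by rewrite !inE => /(_ BW BV) ->.
- by move=> /not_andP[].
Qed.

Lemma has_base_prod (T U : topologicalType) : has_base T -> has_base U -> has_base (T * U)%type.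
Proof.
move=> [b [bo bb]] [c [co cb]].
exists (fun n => if unpickle n is Some (i, j) then b i `*` c j else set0); split=> [n|[x y] V].
  case: unpickle => [[i j]|]; last exact: open0.
  rewrite openE => -[x y] [/= bx cy]; exists (b i, c j) => //=.
  by split; apply: open_nbhs_nbhs.
move=> -[[A B] /= [/bb [i bix biA] /cb [j cjy cjB]] ABV].
exists (pickle (i, j)); rewrite pickleK //=.
by move=> [x' y'] [/= ? ?]; apply: ABV; split=> /=; [exact: biA|exact: cjB].
Qed.

Lemma nbhs_pow (G : topologicalType) (k : nat) (x : Gpow G k) (U : set (Gpow G k)) :
  nbhs x U <-> exists2 V : 'I_k -> set G, forall i, nbhs (x i) (V i) &
                  forall y : Gpow G k, (forall i, V i (y i)) -> U y.
Proof.
split=> [xU|[V xV VU]].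
  pose F := filter_from [set V : 'I_k -> set G | forall i, nbhs (x i) (V i)]
    (fun V => [set y : Gpow G k | forall i, V i (y i)]).
  have FF : Filter F.
    apply: filter_from_filter; first by exists (fun=> setT) => i /=; exact: filterT.
    move=> V W Vx Wx; exists (fun i => V i `&` W i) => [i|y] /=.
      by apply: filterI.
    by move=> VW; split=> i; have [] := VW i.
  have Fx : F --> (x : Gpow G k).
    apply/cvg_sup => i W; rewrite nbhsE => -[B [[C oC <-] /= Cx] BW].
    exists (fun j => if j == i then C else setT) => /= [j|y /(_ i)].
      by have [->|_] := eqVneq j i; [exact: open_nbhs_nbhs|exact: filterT].
    by rewrite eqxx => Cy; exact: BW.
  by have [V Vx VU] := Fx _ xU; exists V.
have : \forall y \near x, forall i, V i (y i).
  apply: (@filter_forall (Gpow G k) _ (fun i y => V i (y i)) (nbhs x)) => i.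
  exact: (@proj_continuous _ (fun _ : 'I_k => G) i x _ (xV i)).
exact: filterS.
Qed.

Lemma coord_continuous (G : topologicalType) (k : nat) (i : 'I_k) :
  continuous (fun x : Gpow G k => x i).
Proof. exact: (@proj_continuous _ (fun _ : 'I_k => G) i). Qed.

Lemma pow_continuous (T G : topologicalType) (k : nat) (f : T -> Gpow G k) :
  (forall i, continuous (fun t => f t i)) -> continuous f.
Proof.
move=> fc t U /nbhs_pow [V xV VU].
have : \forall s \near t, forall i, V i (f s i).
  apply: (@filter_forall T _ (fun i s => V i (f s i)) (nbhs t)) => i.
  exact: (fc i t _ (xV i)).
by apply: filterS => s; exact: VU.
Qed.

Lemma has_base_pow (G : topologicalType) (k : nat) : has_base G -> has_base (Gpow G k).
Proof.
move=> [b [bo bb]].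
exists (fun n => if @unpickle {ffun 'I_k -> nat} n is Some h
  then [set y : Gpow G k | forall i, b (h i) (y i)] else set0); split=> [n|x U /nbhs_pow[V xV VU]].
  case: unpickle => [h|]; last exact: open0.
  rewrite openE => x /= bx; apply/nbhs_pow; exists (fun i => b (h i)) => // i.
  by apply: open_nbhs_nbhs; split.
have /choice[h hP] : forall i, exists n, b n (x i) /\ b n `<=` V i.
  by move=> i; have [n ? ?] := bb _ _ (xV i); exists n.
exists (pickle ([ffun i => h i] : {ffun 'I_k -> nat})); rewrite pickleK /=.
  by move=> i; rewrite ffunE; case: (hP i).
by move=> y yb; apply: VU => i; case: (hP i) => _; apply; move: (yb i); rewrite ffunE.
Qed.

(** Starting the subcover at [x0] is what later puts the identity into the first piece of
    [step_selection]. *)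
Lemma lindelof_seq (T : topologicalType) (S : set T) (x0 : T) (N : T -> set T) :
  has_base T -> S x0 -> (forall x, S x -> nbhs x (N x)) ->
  exists c : nat -> T, [/\ c 0 = x0, forall n, S (c n) & S `<=` \bigcup_n N (c n)].
Proof.
move=> [b [_ bb]] Sx0 NS.
exists (fun n => if n is m.+1 then xget x0 [set x | S x /\ b m `<=` N x] else x0); split=> // [[//|n]|x Sx].
  by case: xgetP => [y _ []|].
have [m bmx bmN] := bb _ _ (NS x Sx).
exists m.+1 => //; case: xgetP => [y _ [_]|/(_ x) []//]; exact.
Qed.

Lemma tube (T U : topologicalType) (K : set U) (x : T) (W : set (T * U)) :
  compact K -> (forall y, K y -> nbhs (x, y) W) -> \forall x' \near x, forall y, K y -> W (x', y).
Proof.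
move=> /compact_near_coveringP Kc KW.
apply: (Kc T (nbhs x) (fun x' y => W (x', y))) => y Ky.
have [[A B] /= [xA yB] ABW] := KW y Ky.
by exists (B, A) => //= -[y' x'] /= [By Ax]; apply: ABW.
Qed.

Lemma locally_compact_nbhs (T : topologicalType) (x : T) :
  locally_compact [set: T] -> exists2 V, nbhs x V & compact V.
Proof.
move=> /(_ x I) [V xV [cV _]]; exists V => //.
by move: xV; rewrite /within /=; apply: filterS => t; exact.
Qed.

Lemma open_sigma_compact (T : topologicalType) (O : set T) :
  has_base T -> hausdorff_space T -> locally_compact [set: T] -> open O ->
  exists2 K : nat -> set T, forall n, compact (K n) & O = \bigcup_n K n.
Proof.
move=> hb hT lT oO.
have [->|/set0P[x0 Ox0]] := eqVneq O set0.
  by exists (fun=> set0) => [n|]; [exact: compact0|rewrite bigcup0].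
have /choice[N NP] : forall x, exists N, O x -> [/\ nbhs x N, compact N & N `<=` O].
  move=> x; have [Ox|] := pselect (O x); last by exists set0.
  have [V xV cV] := locally_compact_nbhs x lT.
  have [W xW WO] := compact_regular hT cV xV (open_nbhs_nbhs (conj oO Ox)).
  exists (closure W `&` V) => _; split.
  - by apply: filterI => //; apply: filterS xW; exact: subset_closure.
  - by rewrite setIC; apply: compact_closedI => //; exact: closed_closure.
  - by move=> y [/WO].
have [c [_ cO Oc]] := lindelof_seq hb Ox0 (fun x Ox => let: And3 h _ _ := NP x Ox in h).
exists (fun n => N (c n)) => [n|]; first by have [] := NP _ (cO n).
by apply/seteqP; split=> // x [n _]; have [_ _] := NP _ (cO n); apply.
Qed.

Lemma compact_pow (G : topologicalType) (k : nat) (V : 'I_k -> set G) :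
  (forall i, compact (V i)) -> compact [set x : Gpow G k | forall i, V i (x i)].
Proof. exact: (@tychonoff _ (fun _ : 'I_k => G)). Qed.

Lemma hausdorff_pow (G : topologicalType) (k : nat) : hausdorff_space G -> hausdorff_space (Gpow G k).
Proof. by move=> h; exact: (@hausdorff_product _ (fun _ : 'I_k => G)). Qed.

Lemma locally_compact_pow (G : topologicalType) (k : nat) :
  hausdorff_space G -> locally_compact [set: G] -> locally_compact [set: Gpow G k].
Proof.
move=> hG lG x _.
have /choice[V VP] : forall i, exists V, nbhs (x i) V /\ compact V.
  by move=> i; have [V] := locally_compact_nbhs (x i) lG; exists V.
have cV : compact [set x : Gpow G k | forall i, V i (x i)].
  by apply: compact_pow => i; have [] := VP i.
exists [set x : Gpow G k | forall i, V i (x i)].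
  have : nbhs x [set x : Gpow G k | forall i, V i (x i)].
    by apply/nbhs_pow; exists V => // i; have [] := VP i.
  by rewrite /within /=; apply: filterS.
by split=> //; apply: compact_closed => //; exact: hausdorff_pow.
Qed.

(** The sets [g < t] with 0 < t < 1 are a continuum of neighbourhoods of [x] inside [U] whose
    boundaries lie in disjoint level sets, so a probability measure can charge only countably many
    of these boundaries. *)
Lemma lch_separation (K : realType) (T : topologicalType) (x : T) (U : set T) :
  hausdorff_space T -> locally_compact [set: T] -> nbhs x U ->
  exists g : T -> K, [/\ forall t, open [set y | g y < t], forall t, open [set y | t < g y],
    g x = 0 & forall y, ~ U y -> g y = 1].
Proof.
move=> hT lT; rewrite nbhsE => -[B [oB Bx] BU].
have cB : closed (~` B) by rewrite closedC.
have nBx : ~ (~` B) x by apply.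
have /(@uniform_separatorP T K)[f [/continuousP fc f01 f0 f1]] :=
  @locally_compact_completely_regular T K lT hT x (~` B) cB nBx.
exists f; split => [t|t||y nUy].
- exact: (fc [set y : K | y < t] (@open_lt K t)).
- exact: (fc [set y : K | t < y] (@open_gt K t)).
- by apply: f0; exists x.
- by apply: f1; exists y => // By; apply: nUy; exact: BU.
Qed.

Section borel.
Variable T : topologicalType.
Implicit Types B : set T.

Lemma borel_open B : open B -> borel_sets B.
Proof. by move=> oB; exact: sub_sigma_algebra. Qed.

Lemma borel0 : borel_sets (@set0 T).
Proof. exact: (borel_open (@open0 T)). Qed.

Lemma borelT : borel_sets [set: T].
Proof. exact: (borel_open (@openT T)). Qed.

Lemma borelC B : borel_sets B -> borel_sets (~` B).
Proof. by move=> bB; rewrite -setTD; exact: sigma_algebraCD. Qed.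

Lemma borel_bigcup (F : nat -> set T) : (forall n, borel_sets (F n)) -> borel_sets (\bigcup_n F n).
Proof. exact: sigma_algebra_bigcup. Qed.

Lemma borel_bigcap (F : nat -> set T) : (forall n, borel_sets (F n)) -> borel_sets (\bigcap_n F n).
Proof. by move=> bF; rewrite -[X in borel_sets X]setCK setC_bigcap; apply: borelC; apply: borel_bigcup => n; exact: borelC. Qed.

Lemma borelU B B' : borel_sets B -> borel_sets B' -> borel_sets (B `|` B').
Proof. by move=> bB bB'; rewrite -bigcup2E; apply: borel_bigcup => -[|[|n]] //=; exact: borel0. Qed.

Lemma borelI B B' : borel_sets B -> borel_sets B' -> borel_sets (B `&` B').
Proof. by move=> bB bB'; rewrite -[X in borel_sets X]setCK setCI; apply: borelC; apply: borelU; exact: borelC. Qed.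

Lemma borelD B B' : borel_sets B -> borel_sets B' -> borel_sets (B `\` B').
Proof. by move=> bB bB'; rewrite setDE; apply: borelI => //; exact: borelC. Qed.

Lemma borel_closed B : closed B -> borel_sets B.
Proof. by move=> cB; rewrite -[B]setCK; apply: borelC; apply: borel_open; rewrite openC. Qed.

Lemma borel_ind (P : set T -> Prop) :
  (forall B, open B -> P B) -> (forall B, borel_sets B -> P B -> P (~` B)) ->
  (forall F : nat -> set T, (forall n, borel_sets (F n)) -> (forall n, P (F n)) -> P (\bigcup_n F n)) ->
  forall B, borel_sets B -> P B.
Proof.
move=> Po PC PU B bB.
have : ([set B | borel_sets B /\ P B] : set (set T)) B.
  apply: bB; split; last by move=> U oU; split; [exact: borel_open|exact: Po].
  split => [|A [bA PA]|F FP]; rewrite /=.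
  - by split; [exact: borel0|exact: (Po _ (@open0 T))].
  - by rewrite setTD; split; [exact: borelC|exact: PC].
  - split; first by apply: borel_bigcup => n; case: (FP n).
    by apply: PU => n; case: (FP n).
by case.
Qed.

End borel.

Lemma borel_measurable_open (T U : topologicalType) (f : T -> U) :
  (forall V, open V -> borel_sets (f @^-1` V)) -> borel_measurable f.
Proof.
move=> fo; apply: borel_ind => // [B bB fB|F bF fF].
  by rewrite preimage_setC; exact: borelC.
by rewrite preimage_bigcup; exact: borel_bigcup.
Qed.

Lemma continuous_borel (T U : topologicalType) (f : T -> U) : continuous f -> borel_measurable f.
Proof.
by move=> /continuousP fc; apply: borel_measurable_open => V oV; apply: borel_open; exact: fc.
Qed.

Lemma borel_comp (T U V : topologicalType) (g : U -> V) (f : T -> U) :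
  borel_measurable g -> borel_measurable f -> borel_measurable (fun x => g (f x)).
Proof. by move=> bg bf B bB; exact: (bf _ (bg _ bB)). Qed.

Lemma borel_pair (T U V : topologicalType) (f : T -> U) (g : T -> V) :
  has_base U -> has_base V -> borel_measurable f -> borel_measurable g ->
  borel_measurable (fun x => (f x, g x)).
Proof.
move=> [b [bo bb]] [c [co cb]] bf bg; apply: borel_measurable_open => W oW.
have -> : (fun x => (f x, g x)) @^-1` W = \bigcup_i \bigcup_j
    (if `[< b i `*` c j `<=` W >] then f @^-1` b i `&` g @^-1` c j else set0).
  apply/seteqP; split=> [x Wx|x [i _ [j _]]].
    have : nbhs (f x, g x) W by apply: open_nbhs_nbhs.
    move=> -[[A B] /= [/bb[i bi biA] /cb[j cj cjB]] ABW].
    exists i => //; exists j => //; rewrite asboolT //.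
    by move=> [? ?] [/= ? ?]; apply: ABW; split => /=; [exact: biA|exact: cjB].
  by case: asboolP => // h [fx gx]; exact: h.
apply: borel_bigcup => i; apply: borel_bigcup => j.
case: asboolP => _; last exact: borel0.
by apply: borelI; [apply: bf|apply: bg]; exact: borel_open.
Qed.

(** * Probability measures on Borel sets *)

(* MathComp's measurable types are pointed, hence the base point. *)
Definition borel_space (T : topologicalType) (pt : T) : Type := T.

Section borel_space.
Variables (T : topologicalType) (pt : T).

HB.instance Definition _ := Choice.on (borel_space pt).
HB.instance Definition _ := isPointed.Build (borel_space pt) pt.
HB.instance Definition _ := @isMeasurable.Build (sigma_display (@open T)) (borel_space pt)
  (@borel_sets T) (@borel0 T) (@borelC T) (@borel_bigcup T).

End borel_space.

Section measure_of_borel.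
Variables (T : topologicalType) (pt : T) (mu : set T -> \bar R).
Hypothesis hmu : is_borel_measure mu.

(** [is_borel_measure] says nothing about non-Borel sets, whereas the packed structure asks for
    nonnegativity on every set; hence the value 0 there. *)
Definition borel_restr (B : set (borel_space pt)) : \bar R :=
  if `[< borel_sets (B : set T) >] then mu B else 0%E.

Let borel_restrE B : borel_sets (B : set T) -> borel_restr B = mu B.
Proof. by move=> bB; rewrite /borel_restr asboolT. Qed.

Let borel_restr0 : borel_restr set0 = 0%E.
Proof. by rewrite (borel_restrE (@borel0 T)); have [] := hmu. Qed.

Let borel_restr_ge0 B : (0 <= borel_restr B)%E.
Proof. by rewrite /borel_restr; case: asboolP => // bB; have [_ h _] := hmu; exact: h. Qed.

Let borel_restr_sigma_additive : semi_sigma_additive borel_restr.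
Proof.
move=> F mF tF mUF; have [_ _ /(_ F mF tF)] := hmu.
rewrite borel_restrE //; apply: cvg_trans; apply: near_eq_cvg; near=> n.
by rewrite big_mkord; apply: eq_bigr => i _; rewrite (borel_restrE (mF i)).
Unshelve. all: by end_near. Qed.

HB.instance Definition _ := isMeasure.Build _ _ _ borel_restr
  borel_restr0 borel_restr_ge0 borel_restr_sigma_additive.

Lemma borel_measure_lift : exists m : {measure set (borel_space pt) -> \bar R},
  forall B : set T, borel_sets B -> m B = mu B.
Proof. by exists borel_restr => B bB; rewrite /= borel_restrE. Qed.

Hypothesis mu1 : mu setT = 1%E.

Let borel_restrT : borel_restr setT = 1%E.
Proof. by rewrite (borel_restrE (@borelT T)). Qed.

HB.instance Definition _ := Measure_isProbability.Build _ _ _ borel_restr borel_restrT.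

Lemma borel_probability_lift : exists m : probability (borel_space pt) R,
  forall B : set T, borel_sets B -> m B = mu B.
Proof. by exists borel_restr => B bB; rewrite /= borel_restrE. Qed.

End measure_of_borel.

Lemma measure_is_borel (T : topologicalType) (pt : T)
  (m : {measure set (borel_space pt) -> \bar R}) : is_borel_measure (m : set T -> \bar R).
Proof.
split=> [||F bF tF]; [exact: measure0|by move=> B bB; exact: measure_ge0|].
have := @measure_semi_sigma_additive _ _ _ m F bF tF (borel_bigcup bF).
by apply: cvg_trans; apply: near_eq_cvg; near=> n; rewrite big_mkord.
Unshelve. all: by end_near. Qed.

Definition borel_prob (T : topologicalType) (P : set T -> R) : Prop :=
  is_borel_measure (fun B => (P B)%:E) /\ P setT = 1.

Section borel_prob.
Variables (T : topologicalType) (P : set T -> R).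
Hypothesis hP : borel_prob P.
Implicit Types B C : set T.

Lemma prob_lift : exists (pt : T) (m : probability (borel_space pt) R),
  forall B : set T, borel_sets B -> m B = (P B)%:E.
Proof.
have [h1 h2] := hP; have [[h0] _ _] := h1.
have [pt _] : exists pt : T, True.
  apply: contrapT => h; move/eqP: h2; rewrite (_ : setT = set0) ?h0 1?eq_sym ?oner_eq0 //.
  by rewrite -subset0 => x; case: h; exists x.
exists pt.
have [m mE] := @borel_probability_lift T pt _ h1 (congr1 EFin h2).
by exists m.
Qed.

Lemma prob_ge0 B : borel_sets B -> 0 <= P B.
Proof. by move=> bB; rewrite -lee_fin; have [[_ h _] _] := hP; exact: h. Qed.

Lemma prob0 : P set0 = 0.
Proof. by have [[[h] _ _] _] := hP. Qed.

Lemma probT : P setT = 1.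
Proof. by case: hP. Qed.

Lemma probU B C : borel_sets B -> borel_sets C -> B `&` C = set0 -> P (B `|` C) = P B + P C.
Proof.
move=> bB bC BC; have [pt [m mE]] := prob_lift.
have : m (B `|` C) = (m B + m C)%E := @measureU _ _ _ m B C bB bC BC.
by rewrite (mE _ bB) (mE _ bC) (mE _ (borelU bB bC)) => -[].
Qed.

Lemma le_prob B C : borel_sets B -> borel_sets C -> B `<=` C -> P B <= P C.
Proof.
move=> bB bC BC; rewrite -(setDUK BC) probU ?setDIK //; last exact: borelD.
by rewrite lerDl; apply: prob_ge0; exact: borelD.
Qed.

Lemma prob_le1 B : borel_sets B -> P B <= 1.
Proof. by move=> bB; rewrite -probT; apply: le_prob => //; exact: borelT. Qed.

Lemma probU_le B C : borel_sets B -> borel_sets C -> P (B `|` C) <= P B + P C.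
Proof.
move=> bB bC; have bU := borelU bB bC.
rewrite -(setDUK (@subsetUl _ B C)) probU ?setDIK //; last exact: borelD.
by rewrite lerD2l; apply: le_prob => //; [exact: borelD|move=> x [[]]].
Qed.

Lemma prob_bigcup0 (F : nat -> set T) :
  (forall n, borel_sets (F n)) -> (forall n, P (F n) = 0) -> P (\bigcup_n F n) = 0.
Proof.
move=> bF F0; have [pt [m mE]] := prob_lift.
have nF n : m.-negligible (F n).
  by exists (F n); split => //; [exact: bF|have := mE _ (bF n); rewrite F0].
have : m (\bigcup_n F n) = 0%E.
  by apply: measure_negligible; [exact: (borel_bigcup bF)|exact: negligible_bigcup].
by rewrite mE; [case|exact: borel_bigcup].
Qed.

Lemma prob_dec (F : nat -> set T) (eps : R) :
  (forall n, borel_sets (F n)) -> (forall n, F n.+1 `<=` F n) -> \bigcap_n F n = set0 ->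
  0 < eps -> exists n, P (F n) < eps.
Proof.
move=> bF Fd F0 e0; have [pt [m mE]] := prob_lift.
have Fle n k : (n <= k)%N -> F k `<=` F n.
  move=> /subnK <-; elim: (k - n)%N => // i ih x Fx; apply: ih; exact: Fd.
have : m \o F @ \oo --> m (\bigcap_n F n).
  apply: (@nonincreasing_cvg_mu _ _ _ m F) => //.
  - have := mE _ (bF 0); rewrite /= => ->; exact: ltry.
  - exact: (borel_bigcap bF).
  - by move=> n k nk; apply/subsetPset; exact: Fle.
rewrite F0 measure0 => /fine_cvgP[_ /cvgrPdist_lt /(_ _ e0)[n _ /(_ n)]] /=.
rewrite (mE _ (bF n)) /= sub0r normrN ger0_norm; last exact: prob_ge0.
by move=> h; exists n; exact: h.
Qed.

Lemma prob_inc (F : nat -> set T) (eps : R) :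
  (forall n, borel_sets (F n)) -> (forall n, F n `<=` F n.+1) -> \bigcup_n F n = setT ->
  0 < eps -> exists n, P (~` F n) < eps.
Proof.
move=> bF Fi FT e0; apply: prob_dec => //.
- by move=> n; exact: borelC.
- by move=> n; apply: subsetC.
- by rewrite -setC_bigcup FT setCT.
Qed.

Lemma prob_cover (F : nat -> set T) (eps : R) :
  (forall n, borel_sets (F n)) -> \bigcup_n F n = setT ->
  0 < eps -> exists n, P (~` \bigcup_(k in `I_n) F k) < eps.
Proof.
move=> bF FT e0; apply: (@prob_inc (fun n => \bigcup_(k in `I_n) F k)) => //.
- by move=> n; rewrite bigcup_mkcond; apply: borel_bigcup => k; case: ifP => // _; exact: borel0.
- by move=> n x [k /= kn Fx]; exists k => //=; exact: ltnW.
- apply/seteqP; split=> // x _; have [k _ Fx] : (\bigcup_n F n) x by rewrite FT.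
  by exists k.+1 => //; exists k => /=.
Qed.

Lemma prob_bigcup_geom (F : nat -> set T) (c : R) :
  (forall n, borel_sets (F n)) -> (forall n, P (F n) <= c / 2 ^+ n) -> P (\bigcup_n F n) <= 2 * c.
Proof.
move=> bF Fc; apply/ler_addgt0Pr => e e0.
pose U n := \bigcup_(k in `I_n) F k.
have bU n : borel_sets (U n).
  by rewrite /U bigcup_mkcond; apply: borel_bigcup => k; case: ifP => // _; exact: borel0.
have [n Pn] : exists n, P ((\bigcup_n F n) `\` U n) < e.
  apply: prob_dec => //.
  - by move=> n; apply: borelD => //; exact: borel_bigcup.
  - by move=> n x [Fx nU]; split=> // -[k /= kn Fkx]; apply: nU; exists k => //=; exact: ltnW.
  - rewrite -subset0 => x h; have [[k _ Fkx] _] := h 0 I.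
    by have [_] := h k.+1 I; apply; exists k => //=.
(* The factor is the partial sum of the powers of 1/2. *)
have PU k : P (U k) <= c * (2 - 2 / 2 ^+ k).
  elim: k => [|k ih].
    by rewrite /U (_ : \bigcup_(_ in _) _ = set0) ?prob0 ?expr0 ?divr1 ?subrr ?mulr0 // -subset0 => x [].
  have -> : U k.+1 = U k `|` F k.
    apply/seteqP; split=> [x [i /=]|x [[i /= ik Fx]|Fx]].
    - by rewrite ltnS leq_eqVlt => /orP[/eqP ->|ik]; [right|left; exists i].
    - by exists i => //=; exact: ltnW.
    - by exists k => /=.
  apply: le_trans (probU_le (bU k) (bF k)) _.
  apply: le_trans (lerD ih (Fc k)) _.
  rewrite exprS invfM mulrA divff // mul1r.
  by rewrite le_eqVlt; apply/orP; left; apply/eqP; move: (_^-1) => q; ring.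
apply: le_trans (_ : P (U n) + e <= _).
  have bF' := borel_bigcup bF.
  have -> : \bigcup_n F n = U n `|` ((\bigcup_n F n) `\` U n).
    by rewrite setDUK // => x [k _ Fx]; exists k.
  apply: le_trans (probU_le _ _) _ => //; first exact: borelD.
  by rewrite lerD2l ltW.
rewrite lerD2r; apply: le_trans (PU n) _.
have c0 : 0 <= c by rewrite -[c]divr1; apply: le_trans (Fc 0); exact: prob_ge0.
by rewrite mulrC; apply: ler_wpM2r => //; rewrite gerBl divr_ge0 // exprn_ge0.
Qed.

End borel_prob.

Definition pnull (T : topologicalType) (P : set T -> R) (N : set T) : Prop :=
  exists B, [/\ borel_sets B, P B = 0 & N `<=` B].

Section pnull.
Variables (T : topologicalType) (P : set T -> R).
Hypothesis hP : borel_prob P.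
Implicit Types N M : set T.

Lemma pnullS N M : N `<=` M -> pnull P M -> pnull P N.
Proof. by move=> NM [B [bB B0 MB]]; exists B; split=> // x /NM /MB. Qed.

Lemma pnull_set0 : pnull P set0.
Proof. by exists set0; split => //; [exact: borel0|exact: prob0]. Qed.

Lemma pnull_bigcup (F : nat -> set T) : (forall n, pnull P (F n)) -> pnull P (\bigcup_n F n).
Proof.
move=> /choice[B BP]; exists (\bigcup_n B n); split.
- by apply: borel_bigcup => n; case: (BP n).
- by apply: prob_bigcup0 => // n; case: (BP n).
- by move=> x [n _ Fx]; exists n => //; case: (BP n) => _ _; apply.
Qed.

Lemma pnullU N M : pnull P N -> pnull P M -> pnull P (N `|` M).
Proof.
by move=> nN nM; rewrite -bigcup2E; apply: pnull_bigcup => -[|[|n]] //=; exact: pnull_set0.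
Qed.

Lemma pnull_big (I : finType) (F : I -> set T) :
  (forall i, pnull P (F i)) -> pnull P [set x | exists i, F i x].
Proof.
move=> nF; apply: (@pnullS _ (\bigcup_n (if @unpickle I n is Some i then F i else set0))).
  by move=> x [i Fx]; exists (pickle i) => //; rewrite pickleK.
by apply: pnull_bigcup => n; case: unpickle => [i|] //; exact: pnull_set0.
Qed.

Lemma pnull_borel B : borel_sets B -> pnull P B -> P B = 0.
Proof.
move=> bB [C [bC C0 BC]]; apply/eqP; rewrite eq_le prob_ge0 // andbT -C0.
exact: le_prob.
Qed.

Lemma pnull_not_all N : pnull P N -> exists x, ~ N x.
Proof.
move=> [B [bB B0 NB]]; apply/not_existsP => h.
have := probT hP; rewrite (_ : setT = B) ?B0; first by move/eqP; rewrite eq_sym oner_eq0.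
by apply/seteqP; split=> // x _; apply: NB; apply: contrapT; exact: h.
Qed.

End pnull.

Lemma is_borel_measure_push (T U : topologicalType) (f : T -> U) (mu : set T -> \bar R) :
  borel_measurable f -> is_borel_measure mu -> is_borel_measure (fun B => mu (f @^-1` B)).
Proof.
move=> bf [mu0 mup mus]; split=> [|B bB|F bF tF].
- by rewrite preimage_set0.
- by apply: mup; exact: bf.
- rewrite preimage_bigcup; apply: mus => [n|]; first exact: bf.
  by apply/trivIsetP => i j _ _ ij; move/trivIsetP: tF => /(_ i j I I ij) h; rewrite -preimage_setI h preimage_set0.
Qed.

Lemma is_borel_measure_restr (T : topologicalType) (D : set T) (mu : set T -> \bar R) :
  borel_sets D -> is_borel_measure mu -> is_borel_measure (fun B => mu (B `&` D)).
Proof.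
move=> bD [mu0 mup mus]; split=> [|B bB|F bF tF].
- by rewrite set0I.
- by apply: mup; exact: borelI.
- rewrite setI_bigcupl; apply: mus => [n|]; first exact: borelI.
  apply/trivIsetP => i j _ _ ij; move/trivIsetP: tF => /(_ i j I I ij) h.
  by rewrite setIACA h set0I.
Qed.

Lemma borel_prob_push (T U : topologicalType) (f : T -> U) (P : set T -> R) :
  borel_measurable f -> borel_prob P -> borel_prob (fun B => P (f @^-1` B)).
Proof.
by move=> bf [h1 h2]; split; [exact: (is_borel_measure_push bf h1)|rewrite preimage_setT].
Qed.

Lemma abs_cont (T : topologicalType) (pt : T) (m1 m2 : set T -> \bar R) (eps : R) :
  is_borel_measure m1 -> is_borel_measure m2 -> (m2 setT < +oo)%E ->
  (forall B, borel_sets B -> m1 B = 0%E -> m2 B = 0%E) -> 0 < eps ->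
  exists2 delta : R, 0 < delta & forall B, borel_sets B -> (m1 B < delta%:E)%E -> (m2 B < eps%:E)%E.
Proof.
move=> h1 h2 fin ac e0; apply: contrapT => /forall2NP h.
have /choice[F FP] : forall n, exists B,
    [/\ borel_sets B, (m1 B < (1 / (2 ^ (n + 1))%:R)%:E)%E & (eps%:E <= m2 B)%E].
  move=> n; have [] := h (1 / (2 ^ (n + 1))%:R).
    by move=> []; rewrite divr_gt0 // ltr0n expn_gt0.
  move=> /existsNP[B /not_implyP[bB /not_implyP[m1B /negP]]]; rewrite -leNgt => m2B.
  by exists B.
have bF n : borel_sets (F n) by case: (FP n).
have [l1 l1E] := @borel_measure_lift T pt _ h1.
have [l2 l2E] := @borel_measure_lift T pt _ h2.
have bt n : borel_sets (\bigcup_(k in [set k | (n <= k)%N]) F k).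
  by rewrite bigcup_mkcond; apply: borel_bigcup => k; case: ifP => // _; exact: borel0.
have bls : borel_sets (lim_sup_set F) by apply: borel_bigcap.
have Fi1 : l1 (lim_sup_set F) = 0%E.
  apply: lim_sup_set_cvg0 => [k|]; first exact: bF.
  apply: (@le_lt_trans _ _ (\sum_(0 <= k <oo) (1 / (2 ^ (k + 1))%:R)%:E)%E).
    apply: lee_nneseries => k _ //.
    by rewrite (l1E _ (bF k)); have [_ /ltW] := FP k.
  have := @cvg_geometric_eseries_half R 1 0; rewrite /eseries /= => /cvg_lim -> //.
  exact: ltry.
have := ac _ bls; rewrite -(l1E _ bls) -(l2E _ bls) => /(_ Fi1) l20.
have ln n : (eps%:E <= l2 (\bigcup_(k in [set k | (n <= k)%N]) F k))%E.
  have [_ _ en] := FP n; apply: le_trans en _; rewrite -(l2E _ (bF n)).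
  by apply: le_measure; rewrite ?inE; [exact: bF|exact: bt|move=> x Fx; exists n => /=].
have : (l2 (\bigcup_(k in [set k | (n <= k)%N]) F k) @[n --> \oo] --> (0%E : \bar R)).
  rewrite -l20; apply: lim_sup_set_cvg; first exact: bF.
  apply: le_lt_trans fin; rewrite -(l2E _ (@borelT T)).
  by apply: le_measure; rewrite ?inE; [exact: bt|exact: (@borelT T)|].
move=> /fine_cvgP[[k _ hk] /cvgrPdist_lt /(_ _ e0)[n _ /(_ (maxn k n) (leq_maxr _ _))]] /=.
have := ln (maxn k n); have := hk _ (leq_maxl k n) => /=.
move: (l2 _) => [r|//|//] _ /=; rewrite lee_fin sub0r normrN => er.
by rewrite ger0_norm ?(le_trans (ltW e0) er) // ltNge er.
Qed.

Section product_slices.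
Local Open Scope ereal_scope.
Context d1 d2 (T1 : measurableType d1) (T2 : measurableType d2) (K : realType).
Variables (m1 : probability T1 K) (m2 : probability T2 K) (N : set (T1 * T2)).
Hypothesis mN : measurable N.

Lemma product_null_xsection :
  (m1 \x m2) N = 0 <-> m1.-negligible [set x | m2 (xsection N x) <> 0].
Proof.
have M := measurable_fun_xsection m2 mN.
have -> : (m1 \x m2) N = \int[m1]_x `|(m2 \o xsection N) x|.
  by apply: eq_integral => x _; rewrite gee0_abs //= measure_ge0.
split=> [/(ae_eq_integral_abs m1 measurableT M)|h].
  by apply: negligibleS => x /= h /(_ I).
apply/(ae_eq_integral_abs m1 measurableT M).
by apply: negligibleS h => x /= h q0; apply: h => _.
Qed.

Lemma product_null_ysection :
  (m1 \x m2) N = 0 <-> m2.-negligible [set y | m1 (ysection N y) <> 0].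
Proof.
have M := measurable_fun_ysection m1 mN.
have -> : (m1 \x m2) N = \int[m2]_y `|(m1 \o ysection N) y|.
  have := indic_fubini_tonelli m1 m2 mN.
  rewrite indic_fubini_tonelli_FE // indic_fubini_tonelli_GE // => h.
  transitivity (\int[m2]_y (m1 \o ysection N) y) => //.
  by apply: eq_integral => x _; rewrite gee0_abs //= measure_ge0.
split=> [/(ae_eq_integral_abs m2 measurableT M)|h].
  by apply: negligibleS => x /= h /(_ I).
apply/(ae_eq_integral_abs m2 measurableT M).
by apply: negligibleS h => x /= h q0; apply: h => _.
Qed.

(** Used contrapositively in [small_slice]: a set of small product measure has small slices outside
    any given null set. *)
Lemma product_ge (c : K) : (0 <= c)%R ->
  m1.-negligible [set x | ~ c%:E <= m2 (xsection N x)] -> c%:E <= (m1 \x m2) N.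
Proof.
move=> c0 h.
have -> : c%:E = \int[m1]_x (cst c%:E x).
  rewrite integral_cst //; have := probability_setT m1 => /= ->; by rewrite mule1.
apply: ae_ge0_le_integral => //; first exact: measurable_fun_xsection.
by apply: negligibleS h => x /= h q0; apply: h => _.
Qed.

End product_slices.

Section product.
Variables (T U : topologicalType).
Hypotheses (baseT : has_base T) (baseU : has_base U).
Variables (P : set T -> R) (Q : set U -> R).
Hypotheses (hP : borel_prob P) (hQ : borel_prob Q).

Lemma borel_slicel (x : T) (N : set (T * U)) : borel_sets N -> borel_sets [set y | N (x, y)].
Proof.
apply: (@continuous_borel _ _ (fun y => (x, y))) => y.
by apply: cvg_pair; [exact: cvg_cst|exact: cvg_id].
Qed.

Lemma borel_slicer (y : U) (N : set (T * U)) : borel_sets N -> borel_sets [set x | N (x, y)].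
Proof.
apply: (@continuous_borel _ _ (fun x => (x, y))) => x.
by apply: cvg_pair; [exact: cvg_id|exact: cvg_cst].
Qed.

(** With countable bases every open set of the product is a countable union of open boxes. *)
Lemma borel_prod_measurable (x0 : T) (y0 : U) (N : set (T * U)) : borel_sets N ->
  @measurable _ (borel_space x0 * borel_space y0)%type N.
Proof.
move: N; apply: borel_ind => [W oW|B bB mB|F bF mF]; [|exact: measurableC|exact: bigcup_measurable].
have [[b [bo bb]] [c [co cb]]] := (baseT, baseU).
have -> : W = \bigcup_i \bigcup_j (if `[< b i `*` c j `<=` W >] then b i `*` c j else set0).
  apply/seteqP; split=> [[x y] Wx|x [i _ [j _]]].
    have : nbhs (x, y) W by apply: open_nbhs_nbhs.
    move=> -[[A B] /= [/bb[i bi biA] /cb[j cj cjB]] ABW].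
    exists i => //; exists j => //; rewrite asboolT //.
    by move=> [? ?] [/= ? ?]; apply: ABW; split => /=; [exact: biA|exact: cjB].
  by case: asboolP => // h; exact: h.
apply: bigcup_measurable => i _; apply: bigcup_measurable => j _.
case: asboolP => _ //.
by apply: (@measurableX _ _ (borel_space x0) (borel_space y0)); apply: borel_open.
Qed.

Lemma borel_prob_prod : exists PQ : set (T * U) -> R,
  [/\ borel_prob PQ,
      forall N, borel_sets N -> PQ N = 0 ->
        pnull P [set x | Q [set y | N (x, y)] <> 0] /\ pnull Q [set y | P [set x | N (x, y)] <> 0],
      forall N, borel_sets N -> pnull P [set x | Q [set y | N (x, y)] <> 0] -> PQ N = 0,
      forall N, borel_sets N -> pnull Q [set y | P [set x | N (x, y)] <> 0] -> PQ N = 0 &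
      forall N c, borel_sets N -> 0 <= c -> pnull P [set x | ~ c <= Q [set y | N (x, y)]] -> c <= PQ N].
Proof.
have [x0 [m1 m1E]] := prob_lift hP.
have [y0 [m2 m2E]] := prob_lift hQ.
have mN := @borel_prod_measurable x0 y0.
have sx N x : xsection N x = [set y | N (x, y)].
  by apply/seteqP; split=> y /=; rewrite /xsection /= inE.
have sy N y : ysection N y = [set x | N (x, y)].
  by apply/seteqP; split=> x /=; rewrite /ysection /= inE.
pose PP : probability (borel_space x0 * borel_space y0)%type R := (m1 \x m2)%E.
have fE N : borel_sets N -> (m1 \x m2)%E N = (fine ((m1 \x m2)%E N))%:E.
  move=> bN; rewrite fineK //; exact: (fin_num_measure PP _ (mN _ bN)).
exists (fun N => fine ((m1 \x m2)%E N)); split.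
- split; last by rewrite (probability_setT PP).
  split=> [||F bF tF]; first by rewrite (measure0 PP).
    by move=> B bB; rewrite lee_fin fine_ge0 // (measure_ge0 PP).
  rewrite -fE; last exact: borel_bigcup.
  have := @measure_semi_sigma_additive _ _ _ PP F (fun n => mN _ (bF n)) tF (mN _ (borel_bigcup bF)).
  apply: cvg_trans; apply: near_eq_cvg; near=> n; rewrite big_mkord.
  by apply: eq_bigr => i _; rewrite -fE.
- move=> N bN PQ0; have {}PQ0 : (m1 \x m2)%E N = 0%E by rewrite fE // PQ0.
  split.
    have /product_null_xsection := PQ0 => /(_ (mN _ bN))[B [bB B0 NB]].
    exists B; split=> //; first by have := m1E _ bB; rewrite B0 => -[].
    move=> x Qx; apply: NB; rewrite /= sx => h; apply: Qx.
    by have := m2E _ (borel_slicel x bN); rewrite h => -[].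
  have /product_null_ysection := PQ0 => /(_ (mN _ bN))[B [bB B0 NB]].
  exists B; split=> //; first by have := m2E _ bB; rewrite B0 => -[].
  move=> x Qx; apply: NB; rewrite /= sy => h; apply: Qx.
  by have := m1E _ (borel_slicer x bN); rewrite h => -[].
- move=> N bN [B [bB B0 NB]]; rewrite (_ : (m1 \x m2)%E N = 0%E) //.
  apply/(product_null_xsection _ _ (mN _ bN)); exists B; split=> //.
    by have := m1E _ bB; rewrite B0.
  move=> x /= Qx; apply: NB => /= h; apply: Qx; rewrite sx.
  by have := m2E _ (borel_slicel x bN); rewrite h.
- move=> N bN [B [bB B0 NB]]; rewrite (_ : (m1 \x m2)%E N = 0%E) //.
  apply/(product_null_ysection _ _ (mN _ bN)); exists B; split=> //.
    by have := m2E _ bB; rewrite B0.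
  move=> x /= Qx; apply: NB => /= h; apply: Qx; rewrite sy.
  by have := m1E _ (borel_slicer x bN); rewrite h.
- move=> N c bN c0 [B [bB B0 NB]]; rewrite -lee_fin -fE //.
  apply: (product_ge (mN _ bN) c0); exists B; split=> //.
    by have := m1E _ bB; rewrite B0.
  move=> x /= Qx; apply: NB => /= h; apply: Qx; rewrite sx.
  by have := m2E _ (borel_slicel x bN); rewrite /= => ->; rewrite lee_fin.
Unshelve. all: by end_near. Qed.

End product.

(** * Quasi-invariant measures on topological groups *)

Section continuity.
Variables T X Y Z : topologicalType.

Lemma cont_comp (f : T -> X) (g : X -> Y) : continuous f -> continuous g -> continuous (fun t => g (f t)).
Proof. by move=> fc gc t; apply: (@continuous_comp _ _ _ f g); [exact: fc|exact: gc]. Qed.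

Lemma cont_pair (f : T -> X) (g : T -> Y) :
  continuous f -> continuous g -> continuous (fun t => (f t, g t)).
Proof. by move=> fc gc t; apply: cvg_pair; [exact: fc|exact: gc]. Qed.

Lemma cont_fst : continuous (@fst X Y). Proof. by move=> x; exact: cvg_fst. Qed.
Lemma cont_snd : continuous (@snd X Y). Proof. by move=> x; exact: cvg_snd. Qed.
Lemma cont_id : continuous (fun t : T => t). Proof. by move=> x; exact: cvg_id. Qed.
Lemma cont_cst (x : X) : continuous (fun _ : T => x). Proof. by move=> t; exact: cvg_cst. Qed.

End continuity.

Lemma cont_comp2 (T X Y Z : topologicalType) (h : X -> Y -> Z) (f : T -> X) (g : T -> Y) :
  continuous f -> continuous g -> continuous (fun xy : X * Y => h xy.1 xy.2) ->
  continuous (fun t => h (f t) (g t)).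
Proof. by move=> fc gc hc; exact: (cont_comp (cont_pair fc gc) hc). Qed.

Record tgroup := TGroup {
  tg_sort :> topologicalType;
  tmul : tg_sort -> tg_sort -> tg_sort;
  tinv : tg_sort -> tg_sort;
  tone : tg_sort;
  tg_axiom : is_topological_group tmul tinv tone;
  tg_base : has_base tg_sort }.

Section tgroup_theory.
Variable H : tgroup.
Implicit Types x y g : H.
Local Notation "x ** y" := (tmul x y) (at level 40, left associativity).

Lemma tmulA x y z : x ** (y ** z) = x ** y ** z. Proof. by have [[]] := tg_axiom H. Qed.
Lemma t1mul x : tone H ** x = x. Proof. by have [[]] := tg_axiom H. Qed.
Lemma tmul1 x : x ** tone H = x. Proof. by have [[]] := tg_axiom H. Qed.
Lemma tVmul x : tinv x ** x = tone H. Proof. by have [[]] := tg_axiom H. Qed.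
Lemma tmulV x : x ** tinv x = tone H. Proof. by have [[]] := tg_axiom H. Qed.
Lemma tmulKl g x : tinv g ** (g ** x) = x. Proof. by rewrite tmulA tVmul t1mul. Qed.
Lemma tmulVKl g x : g ** (tinv g ** x) = x. Proof. by rewrite tmulA tmulV t1mul. Qed.

Lemma tinv_uniq x y : x ** y = tone H -> y = tinv x.
Proof. by move=> xy; rewrite -[y](tmulKl x) xy tmul1. Qed.

Lemma tinvK x : tinv (tinv x) = x. Proof. by apply/esym/tinv_uniq/tVmul. Qed.
Lemma tinv1 : tinv (tone H) = tone H. Proof. by apply/esym/tinv_uniq/t1mul. Qed.
Lemma tinvM x y : tinv (x ** y) = tinv y ** tinv x.
Proof. by apply/esym/tinv_uniq; rewrite -tmulA tmulVKl tmulV. Qed.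

Lemma tinv_continuous : continuous (@tinv H).
Proof.
have [_ c] := tg_axiom H.
have -> : @tinv H = (fun x => tone H ** tinv x) by apply/funext => y; rewrite t1mul.
exact: (cont_comp (cont_pair (@cont_cst _ _ (tone H)) (@cont_id _)) c).
Qed.

Lemma tmul_continuous : continuous (fun xy : H * H => xy.1 ** xy.2).
Proof.
have [_ c] := tg_axiom H.
have -> : (fun xy : H * H => xy.1 ** xy.2) = (fun xy : H * H => xy.1 ** tinv (tinv xy.2)).
  by apply/funext => y /=; rewrite tinvK.
have c2 := cont_comp (@cont_snd H H) tinv_continuous.
exact: (cont_comp (cont_pair (@cont_fst H H) c2) c).
Qed.

Lemma tlmul_continuous g : continuous (tmul g).
Proof. exact: (cont_comp2 (@cont_cst _ _ g) (@cont_id _) tmul_continuous). Qed.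

Lemma tdivl_continuous : continuous (fun xy : H * H => tinv xy.1 ** xy.2).
Proof. exact: (cont_comp2 (cont_comp (@cont_fst H H) tinv_continuous) (@cont_snd H H) tmul_continuous). Qed.

Lemma tmul_image g (B : set H) : [set g ** x | x in B] = tmul (tinv g) @^-1` B.
Proof.
apply/seteqP; split=> [_ [x Bx <-]|x Bx] /=; first by rewrite tmulKl.
by exists (tinv g ** x) => //; rewrite tmulVKl.
Qed.

End tgroup_theory.

Lemma tprod_axiom (H K : tgroup) : @is_topological_group (H * K)%type
  (fun x y => (tmul x.1 y.1, tmul x.2 y.2)) (fun x => (tinv x.1, tinv x.2)) (tone H, tone K).
Proof.
split.
  by split=> [[? ?] [? ?] [? ?]|[? ?]|[? ?]|[? ?]|[? ?]] /=; rewrite ?tmulA ?t1mul ?tmul1 ?tVmul ?tmulV.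
have c1 := cont_comp2 (cont_comp (@cont_fst (H * K)%type (H * K)%type) (@cont_fst H K))
  (cont_comp (cont_comp (@cont_snd (H * K)%type (H * K)%type) (@cont_fst H K)) (@tinv_continuous H)) (@tmul_continuous H).
have c2 := cont_comp2 (cont_comp (@cont_fst (H * K)%type (H * K)%type) (@cont_snd H K))
  (cont_comp (cont_comp (@cont_snd (H * K)%type (H * K)%type) (@cont_snd H K)) (@tinv_continuous K)) (@tmul_continuous K).
exact: (cont_pair c1 c2).
Qed.

Definition tprod (H K : tgroup) : tgroup :=
  TGroup (tprod_axiom H K) (has_base_prod (tg_base H) (tg_base K)).

Lemma tpow_axiom (G : tgroup) k : @is_topological_group (Gpow G k)
  (pow_mul (@tmul G) (k := k)) (fun x i => tinv (x i)) (fun=> tone G).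
Proof.
split.
  by split=> *; apply/funext => i; rewrite /pow_mul ?tmulA ?t1mul ?tmul1 ?tVmul ?tmulV.
apply: pow_continuous => i.
exact: (cont_comp2 (cont_comp (@cont_fst (Gpow G k) (Gpow G k)) (@coord_continuous G k i))
  (cont_comp (cont_comp (@cont_snd (Gpow G k) (Gpow G k)) (@coord_continuous G k i)) (@tinv_continuous G))
  (@tmul_continuous G)).
Qed.

Definition tpow (G : tgroup) k : tgroup := TGroup (tpow_axiom G k) (has_base_pow k (tg_base G)).

(** Quasi-invariance alone determines the null sets ([qinv_null]), so a finite measure can stand in
    for Haar measure, and any two choices are interchangeable. *)
Definition qinv (H : tgroup) (P : set H -> R) : Prop :=
  borel_prob P /\ forall g B, borel_sets B -> P B = 0 -> P (tmul g @^-1` B) = 0.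

(** Fubini for the set of (x, y) with x^-1 y in [N]. Its slices at fixed x are translates of [N],
    hence [Q]-null; so for some y the set of x with x^-1 y in [N] is [P]-null, and translating it by
    y gives the inverse of [N]. *)
Lemma qinv_null_inv (H : tgroup) (P Q : set H -> R) N : qinv P -> qinv Q ->
  borel_sets N -> Q N = 0 -> P (@tinv H @^-1` N) = 0.
Proof.
move=> [hP iP] [hQ iQ] bN N0.
have [PQ [hPQ sl ml _ _]] := borel_prob_prod (tg_base H) (tg_base H) hP hQ.
pose E : set (H * H) := (fun xy => tmul (tinv xy.1) xy.2) @^-1` N.
have bE : borel_sets E by apply: (continuous_borel (@tdivl_continuous H)).
have E0 : PQ E = 0.
  apply: ml => //; apply: pnullS (pnull_set0 hP) => x; apply.
  exact: (iQ (tinv x) N).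
have [_ /(pnull_not_all hQ)[y /contrapT]] := sl _ bE E0.
have bV : borel_sets [set x | E (x, y)] by apply: borel_slicer.
move=> /(iP y _ bV); congr (P _ = 0).
by apply/seteqP; split=> x; rewrite /E /= tinvM -tmulA tVmul tmul1.
Qed.

(** Inverting twice returns to [N]: the first inversion passes from [Q] to [P], the second stays in
    [P]. *)
Lemma qinv_null (H : tgroup) (P Q : set H -> R) N : qinv P -> qinv Q ->
  borel_sets N -> Q N = 0 -> P N = 0.
Proof.
move=> hP hQ bN N0; have bV := continuous_borel (@tinv_continuous H) bN.
have := qinv_null_inv hP hP bV (qinv_null_inv hP hQ bN N0).
by congr (P _ = 0); apply/seteqP; split=> x /=; rewrite tinvK.
Qed.

(** Surjectivity makes the image of a quasi-invariant measure quasi-invariant: every translation of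
    [K] lifts to one of [H]. By [qinv_null], preimages of null sets are then null. *)
Definition thom (H K : tgroup) (f : H -> K) : Prop :=
  [/\ continuous f, forall x y, f (tmul x y) = tmul (f x) (f y) & forall y, exists x, f x = y].

Lemma qinv_push (H K : tgroup) (f : H -> K) (P : set H -> R) :
  thom f -> qinv P -> qinv (fun B => P (f @^-1` B)).
Proof.
move=> [fc fM fs] [hP iP]; have bf := continuous_borel fc.
split; first exact: borel_prob_push.
move=> g B bB B0; have [g' <-] := fs g.
have := iP g' _ (bf _ bB) B0; congr (P _ = 0).
by apply/seteqP; split=> x /=; rewrite fM.
Qed.

Lemma thom_null (H K : tgroup) (f : H -> K) (P : set H -> R) (Q : set K -> R) N :
  thom f -> qinv P -> qinv Q -> pnull Q N -> pnull P (f @^-1` N).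
Proof.
move=> hf hP hQ [B [bB B0 NB]]; have [fc _ _] := hf; have bf := continuous_borel fc.
exists (f @^-1` B); split; [exact: bf| |by move=> x /NB].
exact: (qinv_null (qinv_push hf hP) hQ).
Qed.

Lemma thom_null_inv (H K : tgroup) (f : H -> K) (P : set H -> R) (Q : set K -> R) N :
  thom f -> qinv P -> qinv Q -> borel_sets N -> P (f @^-1` N) = 0 -> Q N = 0.
Proof. by move=> hf hP hQ bN; exact: (qinv_null hQ (qinv_push hf hP)). Qed.

Lemma qinv_translate (H : tgroup) (P : set H -> R) g N : qinv P -> pnull P N -> pnull P (tmul g @^-1` N).
Proof.
move=> [_ iP] [B [bB B0 NB]]; exists (tmul g @^-1` B); split; [|exact: iP|by move=> x /NB].
exact: (continuous_borel (@tlmul_continuous H g)).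
Qed.

Lemma qinv_prod (H K : tgroup) (P : set H -> R) (Q : set K -> R) : qinv P -> qinv Q ->
  exists PQ : set (tprod H K) -> R,
  [/\ qinv PQ,
      forall N, pnull PQ N -> pnull P [set x | ~ pnull Q [set y | N (x, y)]],
      forall N, borel_sets N -> pnull P [set x | ~ pnull Q [set y | N (x, y)]] -> pnull PQ N,
      forall N, borel_sets N -> pnull Q [set y | ~ pnull P [set x | N (x, y)]] -> pnull PQ N &
      forall N c, borel_sets N -> 0 <= c ->
        pnull P [set x | ~ c <= Q [set y | N (x, y)]] -> c <= PQ N].
Proof.
move=> [hP iP] [hQ iQ].
have [PQ [hPQ sl ml mr ge]] := borel_prob_prod (tg_base H) (tg_base K) hP hQ.
have eqn N x : borel_sets N -> pnull Q [set y | N (x, y)] -> Q [set y | N (x, y)] = 0.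
  by move=> bN; apply: (pnull_borel hQ); exact: borel_slicel.
exists PQ; split=> //.
- split=> // g B bB B0; have [[C [bC C0 BC]] _] := sl _ bB B0.
  have bgB : borel_sets (@tmul (tprod H K) g @^-1` B).
    exact: (continuous_borel (@tlmul_continuous (tprod H K) g)).
  apply: ml => //.
  exists (tmul g.1 @^-1` C); split; [|exact: iP|].
    exact: (continuous_borel (@tlmul_continuous H g.1)).
  move=> x /= h; apply: BC => /= q0; apply: h.
  exact: (iQ g.2 _ (borel_slicel _ bB) q0).
- move=> N [B [bB B0 NB]]; have [h _] := sl _ bB B0; apply: pnullS h => x /= nn q0; apply: nn.
  by exists [set y | B (x, y)]; split=> // [|y /NB]; [exact: borel_slicel|].
- move=> N bN h; exists N; split=> //; apply: ml => //; apply: pnullS h => x /= q nn; apply: q.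
  exact: eqn.
- move=> N bN h; exists N; split=> //; apply: mr => //; apply: pnullS h => x /= q nn; apply: q.
  by apply: (pnull_borel hP); [exact: borel_slicer|].
Qed.

(** A nonempty open null set is impossible: countably many of its translates cover the group. *)
Lemma qinv_dense (H : tgroup) (P : set H -> R) S : qinv P -> pnull P (~` S) -> dense S.
Proof.
move=> [hP iP] [B [bB B0 SB]] O [x0 Ox0] oO.
apply: contrapT => /set0P/negP/negPn/eqP OS.
have O0 : P O = 0.
  apply/eqP; rewrite eq_le prob_ge0 ?andbT -?B0 //; last exact: borel_open.
  apply: le_prob => //; first exact: borel_open.
  move=> x Ox; apply: SB => Sx; suff : set0 x by []; by rewrite -OS.
pose N (y : H) := tmul (tmul x0 (tinv y)) @^-1` O.
have Nn y : setT y -> nbhs y (N y).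
  move=> _; apply: (@tlmul_continuous H); rewrite -tmulA tVmul tmul1.
  exact: open_nbhs_nbhs.
have [c [_ _ cN]] := lindelof_seq (tg_base H) (I : setT (tone H)) Nn.
have : P setT = 0.
  have -> : setT = \bigcup_n N (c n) by apply/seteqP; split.
  apply: (prob_bigcup0 hP) => n; last by apply: iP => //; exact: borel_open.
  by apply: (continuous_borel (@tlmul_continuous H _)); exact: borel_open.
by rewrite (probT hP) => /eqP; rewrite oner_eq0.
Qed.

(** * Haar measure *)

Lemma probability_borel_prob (T : topologicalType) (pt : T) (m : probability (borel_space pt) R) :
  borel_prob (fun B : set T => fine (m B)).
Proof.
split; last by rewrite (probability_setT m).
have fE (B : set T) : borel_sets B -> (fine (m B))%:E = m B.
  by move=> bB; rewrite fineK //; exact: (fin_num_measure m).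
have [h0 h1 h2] := measure_is_borel m; split=> [|B bB|F bF tF].
- by rewrite fE //; exact: borel0.
- by rewrite fE //; exact: h1.
- rewrite fE; last exact: borel_bigcup.
  have := h2 F bF tF; apply: cvg_trans; apply: near_eq_cvg; near=> n.
  by apply: eq_bigr => i _; rewrite fE.
Unshelve. all: by end_near. Qed.

(** A weighted sum of the restrictions of [mu] to the [K n] has the null sets of [mu]; the weights
    make it finite, and it is then normalized. *)
Lemma sigma_finite_prob (T : topologicalType) (pt : T) (mu : set T -> \bar R) (K : nat -> set T) :
  is_borel_measure mu -> (forall n, borel_sets (K n)) -> (forall n, (mu (K n) < +oo)%E) ->
  \bigcup_n K n = setT -> mu setT <> 0%E ->
  exists2 P, borel_prob P & forall B, borel_sets B -> P B = 0 <-> mu B = 0%E.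
Proof.
move=> hmu bK fK KT mu0.
have [l lE] := @borel_measure_lift T pt _ hmu.
have /choice[w wP] : forall n, exists r : R,
    0 < r /\ (r%:E * l (K n) <= (1 / (2 ^ (n + 1))%:R)%:E)%E.
  move=> n; have := fK n; rewrite -(lE _ (bK n)).
  have : (0 <= l (K n))%E by exact: measure_ge0.
  move: (l (K n)) => [r| |] //; rewrite lee_fin => r0 _.
  have r1 : 0 < 1 + r by rewrite ltr_wpDr.
  have : 0 < 1 / (2 ^ (n + 1))%:R :> R by rewrite divr_gt0 // ltr0n expn_gt0.
  (* Dividing by [1 + r] instead of [r] covers the case r = 0. *)
  move: (1 / _) => c c0; exists (c / (1 + r)); split; first exact: divr_gt0.
  rewrite -EFinM lee_fin -mulrA ler_piMr ?(ltW c0) // mulrC ler_pdivrMr // mul1r.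
  by rewrite lerDr.
have w0 n : 0 <= w n by case: (wP n) => /ltW.
pose nu : {measure set (borel_space pt) -> \bar R} :=
  mseries (fun n => mscale (NngNum (w0 n)) (mrestr l (bK n : measurable (K n : set (borel_space pt))))) 0.
have nuE (B : set T) : nu B = (\sum_(0 <= n <oo) (w n)%:E * l (B `&` K n))%E by [].
have lK0 (B : set T) n : (0 <= (w n)%:E * l (B `&` K n))%E.
  by rewrite mule_ge0 // lee_fin.
have nu_eq0 (B : set T) : borel_sets B -> nu B = 0%E <-> mu B = 0%E.
  move=> bB; have bBK n : borel_sets (B `&` K n) by exact: borelI.
  rewrite -(lE _ bB); split=> [nB|lB].
    have hn n : l (B `&` K n) = 0%E.
      have := @nneseries_lim_ge R (fun n => ((w n)%:E * l (B `&` K n))%E) predT 0 n.+1.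
      rewrite -nuE nB big_mkord big_ord_recr /= => /(_ (fun n _ _ => lK0 B n)) h.
      have /eqP : ((w n)%:E * l (B `&` K n) = 0)%E.
        apply/eqP; rewrite eq_le lK0 andbT; apply: le_trans h.
        by rewrite leeDr // sume_ge0.
      rewrite mule_eq0 eqe => /orP[/eqP w00|/eqP//].
      by have [] := wP n; rewrite w00 ltxx.
    have -> : B = \bigcup_n (B `&` K n) by rewrite -setI_bigcupr KT setIT.
    apply: measure_negligible; first exact: (borel_bigcup bBK).
    apply: negligible_bigcup => n; exists (B `&` K n); split=> //; exact: bBK.
  rewrite nuE eseries0 // => n _ _.
  rewrite (_ : l _ = 0%E) ?mule0 //.
  by apply: (subset_measure0 _ _ _ lB); [exact: bBK|exact: bB|move=> x []].
have nu_fin : (nu setT < +oo)%E.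
  rewrite nuE; apply: (@le_lt_trans _ _ (\sum_(0 <= k <oo) (1 / (2 ^ (k + 1))%:R)%:E)%E).
    apply: lee_nneseries => [n _ _|n _]; first exact: lK0.
    by rewrite setTI; case: (wP n).
  have := @cvg_geometric_eseries_half R 1 0; rewrite /eseries /= => /cvg_lim -> //.
  exact: ltry.
have nu0 : nu setT != 0%E.
  by apply/eqP => /nu_eq0 => /(_ (@borelT T)).
pose D : probability (borel_space pt) R := point.
pose Q : probability (borel_space pt) R := mnormalize nu D.
exists (fun B : set T => fine (Q B)); first exact: probability_borel_prob.
move=> B bB; rewrite /Q /= /mnormalize (negbTE nu0) /= lt_eqF //=.
have nf : nu setT \is a fin_num by rewrite ge0_fin_numE // measure_ge0.
have nfB : nu B \is a fin_num.
  rewrite ge0_fin_numE ?measure_ge0 //; apply: le_lt_trans nu_fin.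
  by apply: le_measure; rewrite ?inE; [exact: bB|exact: (@borelT T)|].
rewrite fineM //= -(nu_eq0 _ bB); split.
  move=> /eqP; rewrite mulf_eq0 invr_eq0 !fine_eq0 // (negbTE nu0) orbF => /eqP //.
by move=> ->; rewrite mul0r.
Qed.

Lemma prob_bigcup_ord (T : topologicalType) (P : set T -> R) (c : R) (n : nat) (D : nat -> set T) :
  borel_prob P -> 0 <= c -> (forall k, borel_sets (D k)) ->
  (forall k : 'I_n, P (D k) < c / n%:R) -> P (\bigcup_(k in `I_n) D k) <= c.
Proof.
move=> pP c0 bD Dk.
have bU k : borel_sets (\bigcup_(j in `I_k) D j).
  by rewrite bigcup_mkcond; apply: borel_bigcup => j; case: ifP => // _; exact: borel0.
have : forall k, (k <= n)%N -> P (\bigcup_(j in `I_k) D j) <= c / n%:R *+ k.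
  elim=> [_|k ihk kn].
    by rewrite (_ : \bigcup_(_ in _) _ = set0) ?(prob0 pP) ?mulr0n // -subset0 => x [].
  have -> : \bigcup_(j in `I_k.+1) D j = (\bigcup_(j in `I_k) D j) `|` D k.
    apply/seteqP; split=> [x [i /=]|x [[i /= ik Fx]|Fx]].
    + by rewrite ltnS leq_eqVlt => /orP[/eqP ->|ik]; [right|left; exists i].
    + by exists i => //=; exact: ltnW.
    + by exists k => /=.
  apply: le_trans (probU_le pP (bU _) (bD k)) _.
  by rewrite mulrSr lerD ?ihk ?(ltnW kn) //; exact: (ltW (Dk (Ordinal kn))).
move=> /(_ n (leqnn n)); case: n {Dk} => [|n]; first by move/le_trans; apply; rewrite mulr0n.
by rewrite -mulr_natr divfK.
Qed.

Section haar.
Variables (H : tgroup) (mu : set H -> \bar R).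
Hypotheses (hH : hausdorff_space H) (lH : locally_compact [set: H]).
Hypothesis hmu : is_haar_measure (@tmul H) mu.

Lemma haar_borel : is_borel_measure mu. Proof. by case: hmu => -[]. Qed.

Lemma haar_translate g B : borel_sets B -> mu (tmul g @^-1` B) = mu B.
Proof.
by move=> bB; have [_ h _ _ _] := hmu; rewrite -{1}[g]tinvK -tmul_image h.
Qed.

Lemma compact_borel (K : set H) : compact K -> borel_sets K.
Proof. by move=> cK; apply: borel_closed; exact: compact_closed. Qed.

Lemma haar_prob : exists2 P, qinv P & forall B, borel_sets B -> P B = 0 <-> mu B = 0%E.
Proof.
have [K cK TK] := open_sigma_compact (tg_base H) hH lH (@openT H).
have [[_ [B [bB B0]]] _ fin _ _] := hmu.
have [|||||P hP PE] := @sigma_finite_prob H (tone H) mu K.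
- exact: haar_borel.
- by move=> n; apply: compact_borel.
- by move=> n; exact: fin.
- by rewrite -TK.
- move=> mT; apply: B0; have [l lE] := @borel_measure_lift H (tone H) _ haar_borel.
  rewrite -(lE _ bB); apply: (@subset_measure0 _ _ _ l B setT) => //.
  by have := lE _ (@borelT H); rewrite mT.
exists P => //; split=> // g C bC C0.
apply/PE; first exact: (continuous_borel (@tlmul_continuous H g)).
by rewrite haar_translate //; apply/PE.
Qed.

Variable P : set H -> R.
Hypothesis hP : qinv P.

Lemma qinv_haar B : borel_sets B -> P B = 0 <-> mu B = 0%E.
Proof.
move=> bB; have [Q hQ <-//] := haar_prob; split; exact: qinv_null.
Qed.

(** The preimage in the statement is gB. Up to [eps / 2] only its part in a compact [K] counts, and
    by invariance mu(gB [&] K) = mu(B [&] g^-1 K), where g^-1 K stays in a fixed compact [F] for g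
    in a compact neighbourhood of [g0]. Two applications of [abs_cont], from [P] to [mu] on [F] and
    from [mu] to [P] on [K], give a [delta] that does not depend on g. *)
Lemma uniform_qinv (g0 : H) (eps : R) : 0 < eps -> exists2 delta : R, 0 < delta &
  \forall g \near g0, forall B, borel_sets B -> P B < delta -> P (tmul (tinv g) @^-1` B) < eps.
Proof.
move=> e0; have [K0 cK0 TK] := open_sigma_compact (tg_base H) hH lH (@openT H).
have [pP _] := hP; have e20 : 0 < eps / 2 by rewrite divr_gt0.
have [n nP] := prob_cover pP (fun n => compact_borel (cK0 n)) (esym TK) e20.
pose K := \bigcup_(k in `I_n) K0 k.
have cK : compact K.
  by rewrite /K bigcup_mkord; apply: bigsetU_compact => i _.
have bK := compact_borel cK.
have [V g0V cV] := locally_compact_nbhs g0 lH.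
pose F := (fun xy : H * H => tmul (tinv xy.1) xy.2) @` (V `*` K).
have cF : compact F.
  apply: continuous_compact; last exact: compact_setX.
  by apply: continuous_subspaceT; exact: tdivl_continuous.
have bF := compact_borel cF.
have [_ _ fin _ _] := hmu.
have [d1 d10 d1P] : exists2 d : R, 0 < d & forall B, borel_sets B ->
    (mu (B `&` K) < d%:E)%E -> P (B `&` K) < eps / 2.
  have [||||d d0 dP] := @abs_cont H (tone H) (fun B => mu (B `&` K)) (fun B => (P (B `&` K))%:E) (eps / 2) _ _ _ _ e20.
  - exact: is_borel_measure_restr haar_borel.
  - by apply: (@is_borel_measure_restr _ _ (fun B => (P B)%:E)) => //; case: pP.
  - exact: ltry.
  - by move=> B bB /(qinv_haar (borelI bB bK)) ->.
  by exists d => // B bB /dP; rewrite lte_fin; apply.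
have [d2 d20 d2P] : exists2 d : R, 0 < d & forall B, borel_sets B ->
    P B < d -> (mu (B `&` F) < d1%:E)%E.
  have [||||d d0 dP] := @abs_cont H (tone H) (fun B => (P B)%:E) (fun B => mu (B `&` F)) d1 _ _ _ _ d10.
  - by case: pP.
  - exact: is_borel_measure_restr haar_borel.
  - by rewrite setTI; exact: fin.
  - move=> B bB [B0]; apply/(qinv_haar (borelI bB bF)).
    apply: (pnull_borel pP); first exact: borelI.
    by exists B; split => // x [].
  by exists d => // B bB ?; apply: dP => //; rewrite lte_fin.
exists d2 => //; apply: filterS g0V => g Vg B bB PB.
have bg : borel_sets (tmul (tinv g) @^-1` B) by apply: (continuous_borel (@tlmul_continuous H _)).
apply: (@le_lt_trans _ _ (P ((tmul (tinv g) @^-1` B) `&` K) + P (~` K))).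
  apply: le_trans (probU_le pP _ _); [|exact: borelI|exact: borelC].
  apply: le_prob => //; first by apply: borelU; [exact: borelI|exact: borelC].
  by move=> x Bx; have [Kx|nKx] := pselect (K x); [left|right].
rewrite [ltRHS]splitr ltrD //; apply: d1P => //.
rewrite -(haar_translate g); last exact: borelI.
apply: le_lt_trans (d2P _ bB PB).
have [l lE] := @borel_measure_lift H (tone H) _ haar_borel.
have b1 : borel_sets (tmul g @^-1` (tmul (tinv g) @^-1` B `&` K)).
  by apply: (continuous_borel (@tlmul_continuous H _)); exact: borelI.
rewrite -(lE _ b1) -(lE _ (borelI bB bF)); apply: le_measure; rewrite ?inE; [exact: b1|exact: (borelI bB bF)|].
move=> x [/=]; rewrite tmulKl => Bx Kgx; split=> //.
by exists (g, tmul g x) => //=; rewrite tmulKl.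
Qed.

(** Induction on Borel sets. An open [C] is approximated from inside by a compact [K]; for g near
    the identity gK and g^-1 K lie in [C], so C \ gC lies in C \ K and gC \ C lies in g(C \ K),
    which [uniform_qinv] controls. A countable union is cut after finitely many terms and its tail
    is controlled in the same way. *)
Lemma translate_cont (C : set H) (eps : R) : borel_sets C -> 0 < eps ->
  \forall g \near tone H, P (C `\` (tmul (tinv g) @^-1` C)) < eps /\
                          P ((tmul (tinv g) @^-1` C) `\` C) < eps.
Proof.
move=> bC; move: C bC eps.
have [pP _] := hP.
have btr (g : H) (B : set H) : borel_sets B -> borel_sets (tmul (tinv g) @^-1` B).
  exact: (continuous_borel (@tlmul_continuous H _)).
have fC n (F : nat -> set H) : (forall n, borel_sets (F n)) -> borel_sets (\bigcup_(k in `I_n) F k).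
  by move=> bF; rewrite bigcup_mkcond; apply: borel_bigcup => k; case: ifP => // _; exact: borel0.
have tail (F : nat -> set H) eps : (forall n, borel_sets (F n)) -> 0 < eps ->
    exists n, P ((\bigcup_n F n) `\` \bigcup_(k in `I_n) F k) < eps.
  move=> bF e0; apply: (prob_dec pP) => //.
  - by move=> n; apply: borelD; [exact: borel_bigcup|exact: fC].
  - by move=> n x [Fx nU]; split=> // -[k /= kn Fkx]; apply: nU; exists k => //=; exact: ltnW.
  - rewrite -subset0 => x h; have [[k _ Fkx] _] := h 0 I.
    by have [_] := h k.+1 I; apply; exists k => //=.
apply: borel_ind => [C oC|C bC ih|F bF ih] eps e0.
- have [K0 cK0 CK] := open_sigma_compact (tg_base H) hH lH oC.
  have [d d0 dP] := uniform_qinv (tone H) e0.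
  have m0 : 0 < Num.min d eps by rewrite lt_min d0.
  have [n] := tail K0 _ (fun n => compact_borel (cK0 n)) m0.
  rewrite -CK; set K := \bigcup_(k in _) _; rewrite lt_min => /andP[Kd Ke].
  have cK : compact K.
    by rewrite /K bigcup_mkord; apply: bigsetU_compact => i _.
  have bK := compact_borel cK; have bC := borel_open oC.
  have KC : K `<=` C by rewrite CK => x [k _ Kx]; exists k.
  have t1 : \forall g \near tone H, forall y, K y -> C (tmul (tinv g) y).
    apply: (@tube _ _ K _ [set gy | C (tmul (tinv gy.1) gy.2)]) => // y Ky.
    by apply: (@tdivl_continuous H (tone H, y)); apply: open_nbhs_nbhs; split=> //=; rewrite tinv1 t1mul; exact: KC.
  have t2 : \forall g \near tone H, forall y, K y -> C (tmul g y).
    apply: (@tube _ _ K _ [set gy | C (tmul gy.1 gy.2)]) => // y Ky.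
    by apply: (@tmul_continuous H (tone H, y)); apply: open_nbhs_nbhs; split=> //=; rewrite t1mul; exact: KC.
  near=> g.
  have h1 : forall y, K y -> C (tmul (tinv g) y) by near: g.
  have h2 : forall y, K y -> C (tmul g y) by near: g.
  have h3 : forall B, borel_sets B -> P B < d -> P (tmul (tinv g) @^-1` B) < eps by near: g.
  split.
    apply: le_lt_trans Ke; apply: le_prob => //; [|exact: borelD|].
      by apply: borelD => //; exact: btr.
    by move=> y [Cy nCy]; split=> // /h1.
  apply: le_lt_trans (h3 _ (borelD bC bK) Kd); apply: le_prob => //; [|apply: btr; exact: borelD|].
    by apply: borelD => //; exact: btr.
  by move=> y [/= Cy nCy]; split=> // /h2; rewrite tmulVKl.
- have := ih _ e0; apply: filterS => g [h1 h2].
  by rewrite preimage_setC 2!setDE 2!setCK 2![~` _ `&` _]setIC -2!setDE.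
- have e20 : 0 < eps / 2 by rewrite divr_gt0.
  have [d d0 dP] := uniform_qinv (tone H) e20.
  have m0 : 0 < Num.min d (eps / 2) by rewrite lt_min d0.
  have [n] := tail F _ bF m0; rewrite lt_min => /andP[Kd Ke].
  have : \forall g \near tone H, forall k : 'I_n,
      P (F k `\` (tmul (tinv g) @^-1` F k)) < eps / 2 / n%:R /\ P ((tmul (tinv g) @^-1` F k) `\` F k) < eps / 2 / n%:R.
    apply: (@filter_forall H _ (fun (k : 'I_n) g => P (F k `\` (tmul (tinv g) @^-1` F k)) < eps / 2 / n%:R /\ P ((tmul (tinv g) @^-1` F k) `\` F k) < eps / 2 / n%:R) (nbhs (tone H))) => k.
    apply: ih; rewrite divr_gt0 // ltr0n; case: k => k /=; exact: leq_trans.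
  move=> ihn; near=> g.
  have hk : forall k : 'I_n, P (F k `\` (tmul (tinv g) @^-1` F k)) < eps / 2 / n%:R /\ P ((tmul (tinv g) @^-1` F k) `\` F k) < eps / 2 / n%:R by near: g.
  have h3 : forall B, borel_sets B -> P B < d -> P (tmul (tinv g) @^-1` B) < eps / 2 by near: g.
  have bFg k := btr g _ (bF k).
  split.
    apply: (@le_lt_trans _ _ (P (\bigcup_(k in `I_n) (F k `\` (tmul (tinv g) @^-1` F k))) +
       P ((\bigcup_n F n) `\` \bigcup_(k in `I_n) F k))).
      apply: le_trans (probU_le pP _ _); [|by apply: fC => k; exact: borelD|by apply: borelD; [exact: borel_bigcup|exact: fC]].
      apply: le_prob => //.
      + by apply: borelD; [exact: borel_bigcup|apply: btr; exact: borel_bigcup].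
      + by apply: borelU; [apply: fC => k; exact: borelD|apply: borelD; [exact: borel_bigcup|exact: fC]].
      + move=> x [Fx nFx]; have [[k kn Fkx]|] := pselect ((\bigcup_(k in `I_n) F k) x); last by right.
        by left; exists k => //; split=> // h; apply: nFx; exists k.
    rewrite [ltRHS]splitr ler_ltD //; apply: (prob_bigcup_ord pP (ltW e20)) => k; first exact: borelD.
    by case: (hk k).
  apply: (@le_lt_trans _ _ (P (\bigcup_(k in `I_n) ((tmul (tinv g) @^-1` F k) `\` F k)) +
       P (tmul (tinv g) @^-1` ((\bigcup_n F n) `\` \bigcup_(k in `I_n) F k)))).
    have bt' : borel_sets ((\bigcup_n F n) `\` \bigcup_(k in `I_n) F k) by apply: borelD; [exact: borel_bigcup|exact: fC].
    apply: le_trans (probU_le pP _ _); [|by apply: fC => k; exact: borelD|exact: btr].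
    apply: le_prob => //.
    + by apply: borelD; [apply: btr|]; exact: borel_bigcup.
    + by apply: borelU; [apply: fC => k; exact: borelD|exact: btr].
    + move=> x [/= Fx nFx]; have [[k kn Fkx]|] := pselect ((\bigcup_(k in `I_n) F k) (tmul (tinv g) x)); last by right.
      by left; exists k => //; split=> // h; apply: nFx; exists k.
  rewrite [ltRHS]splitr ler_ltD //.
    apply: (prob_bigcup_ord pP (ltW e20)) => k; first exact: borelD.
    by case: (hk k).
  apply: h3 => //; by apply: borelD; [exact: borel_bigcup|exact: fC].
Unshelve. all: by end_near. Qed.

End haar.

Lemma borel_measure_le (T : topologicalType) (pt : T) (mu : set T -> \bar R) (B C : set T) :
  is_borel_measure mu -> borel_sets B -> borel_sets C -> B `<=` C -> (mu B <= mu C)%E.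
Proof.
move=> hmu bB bC BC; have [l lE] := @borel_measure_lift T pt _ hmu.
by rewrite -(lE _ bB) -(lE _ bC); apply: le_measure; rewrite ?inE.
Qed.

(** * Haar measure on a power with one factor fewer *)

Section haar_pow_pred.
Variables (G : tgroup) (k : nat).
Hypotheses (hG : hausdorff_space G) (lG : locally_compact [set: G]).

Definition pow_cons (a : G) (y : Gpow G k) : Gpow G k.+1 := fun i => oapp y a (unlift ord0 i).
Definition pow_behead (x : Gpow G k.+1) : Gpow G k := fun i => x (lift ord0 i).

Lemma pow_cons0 a y : pow_cons a y ord0 = a.
Proof. by rewrite /pow_cons unlift_none. Qed.

Lemma pow_consK a y : pow_behead (pow_cons a y) = y.
Proof. by apply/funext => i; rewrite /pow_behead /pow_cons liftK. Qed.

Lemma pow_cons_behead x : pow_cons (x ord0) (pow_behead x) = x.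
Proof. by apply/funext => i; rewrite /pow_cons; case: unliftP => [j|] ->. Qed.

Lemma pow_behead_continuous : continuous pow_behead.
Proof. by apply: pow_continuous => i; exact: coord_continuous. Qed.

Lemma pow_cons_continuous : continuous (fun ay : G * Gpow G k => pow_cons ay.1 ay.2).
Proof.
apply: pow_continuous => i; rewrite /pow_cons; case: unliftP => [j|] _ /=.
  exact: (cont_comp (@cont_snd G (Gpow G k)) (@coord_continuous G k j)).
exact: (@cont_fst G (Gpow G k)).
Qed.

(** The coboundary witness lives on a power with one factor fewer, and its a.e. equivariance has to
    be stated with a Haar measure there. It is B |-> mu(K x B) for a compact neighbourhood [K] of
    the identity. *)
Lemma haar_pow_pred (mu : set (Gpow G k.+1) -> \bar R) :
  is_haar_measure (pow_mul (@tmul G) (k := k.+1)) mu ->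
  exists mu' : set (Gpow G k) -> \bar R, is_haar_measure (pow_mul (@tmul G) (k := k)) mu'.
Proof.
move=> hmu; pose H := tpow G k.+1; pose H' := tpow G k.
have hH : hausdorff_space H by exact: hausdorff_pow.
have lH : locally_compact [set: H] by exact: locally_compact_pow.
have hH' : hausdorff_space H' by exact: hausdorff_pow.
have lH' : locally_compact [set: H'] by exact: locally_compact_pow.
have [K eK cK] := locally_compact_nbhs (tone G) lG.
pose C : set H := (fun x : Gpow G k.+1 => x ord0) @^-1` K.
have bC : borel_sets C.
  apply: (continuous_borel (@coord_continuous G k.+1 ord0)).
  by apply: borel_closed; exact: compact_closed.
have bmu := haar_borel (hmu : is_haar_measure (@tmul H) mu).
have bcyl (B : set H') : borel_sets B -> borel_sets (pow_behead @^-1` B `&` C).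
  by move=> bB; apply: borelI => //; exact: (continuous_borel pow_behead_continuous).
pose nu (B : set H') := mu (pow_behead @^-1` B `&` C).
have bnu : is_borel_measure nu.
  exact: (is_borel_measure_push (continuous_borel pow_behead_continuous) (is_borel_measure_restr bC bmu)).
have [_ _ fin out _] := hmu.
have cb (L : set H') : compact L -> borel_sets L by exact: (compact_borel hH').
exists nu; split.
- split=> //; exists setT; split; first exact: borelT.
  rewrite /nu preimage_setT setTI => C0.
  have [P hP PE] := haar_prob hH lH (hmu : is_haar_measure (@tmul H) mu).
  (* If [C] were null its complement would be dense, but [C] contains a neighbourhood of the
     identity. *)
  have : pnull P (~` ~` C) by rewrite setCK; exists C; split => //; exact/PE.
  move=> /(qinv_dense hP) dC.
  have : nbhs (tone H) C by apply: (@coord_continuous G k.+1 ord0).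
  rewrite nbhsE => -[W [oW We] WC].
  have [|x [Wx]] := dC W _ oW; first by exists (tone H).
  by apply; exact: WC.
- move=> g B bB; rewrite /nu; have := haar_translate (hmu : is_haar_measure (@tmul H) mu) (tinv (pow_cons (tone G) g : H)) (bcyl _ bB).
  move=> <-; congr mu; rewrite (@tmul_image H' g).
  have eB (x : H) : pow_behead (@tmul H (tinv (pow_cons (tone G) g : H)) x) = @tmul H' (@tinv H' g) (pow_behead x).
    by apply/funext => i; rewrite /pow_behead /= /pow_mul /pow_cons liftK.
  have eC (x : H) : @tmul H (tinv (pow_cons (tone G) g : H)) x ord0 = x ord0.
    by rewrite /= /pow_mul pow_cons0 tinv1 t1mul.
  by apply/funext => x; rewrite /setI /C /preimage /mkset eB eC.
- move=> L cL; apply: fin.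
  have -> : pow_behead @^-1` L `&` C = (fun ay : G * Gpow G k => pow_cons ay.1 ay.2) @` (K `*` L).
    apply/seteqP; split=> [x [/= Lx Kx]|_ [[a y] [/= Ka Ly] <-]].
      by exists (x ord0, pow_behead x) => //=; exact: pow_cons_behead.
    by split; rewrite /C /= ?pow_cons0 ?pow_consK.
  apply: continuous_compact; last exact: compact_setX.
  by apply: continuous_subspaceT; exact: pow_cons_continuous.
- move=> B bB; apply/eqP; rewrite eq_le; apply/andP; split.
    apply: le_ereal_inf_tmp => _ [U [oU BU] <-].
    by apply: (borel_measure_le (tone H') bnu) => //; exact: borel_open.
  rewrite {2}/nu out; last exact: bcyl.
  apply: le_ereal_inf_tmp => _ [W [oW BW] <-].
  (* The points whose whole fibre over [K] lies in [W]; this set is open by the tube lemma and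
     transfers outer regularity from [mu] to [nu]. *)
  pose U : set H' := [set y | forall a, K a -> W (pow_cons a y)].
  have oU : open U.
    rewrite openE => y Uy.
    apply: (@tube _ _ K _ [set ya | W (pow_cons ya.2 ya.1)]) => // a Ka.
    have c : continuous (fun ya : Gpow G k * G => pow_cons ya.2 ya.1).
      exact: (cont_comp2 (h := pow_cons) (@cont_snd (Gpow G k) G) (@cont_fst (Gpow G k) G) pow_cons_continuous).
    by apply: (c (y, a)); apply: open_nbhs_nbhs; split=> //; exact: Uy.
  have BU : B `<=` U by move=> y By a Ka; apply: BW; split; rewrite /C /= ?pow_cons0 ?pow_consK.
  apply: (@le_trans _ _ (nu U)); first by apply: ereal_inf_lbound; exists U.
  apply: (borel_measure_le (tone H) bmu); [|exact: borel_open|].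
    by apply: bcyl; exact: borel_open.
  by move=> x [/= Ux Kx]; rewrite -(pow_cons_behead x); exact: Ux.
- move=> U oU; apply/eqP; rewrite eq_le; apply/andP; split; last first.
    apply: ge_ereal_sup => _ [L [cL LU] <-].
    by apply: (borel_measure_le (tone H') bnu) => //; [exact: cb|exact: borel_open].
  have [L cL UL] := open_sigma_compact (tg_base H') hH' lH' oU.
  pose F n := \big[setU/set0]_(i < n.+1) L i.
  have cF n : compact (F n) by apply: bigsetU_compact.
  have [l lE] := @borel_measure_lift H' (tone H') _ bnu.
  have FU : \bigcup_n F n = U.
    by rewrite UL /F (bigcup_bigsetU_bigcup L).
  have : l \o F @ \oo --> l (\bigcup_n F n).
    apply: nondecreasing_cvg_mu.
    + by move=> n; exact: (cb _ (cF n)).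
    + by rewrite FU; exact: (borel_open oU).
    + by move=> m n mn; apply/subsetPset; exact: subset_bigsetU.
  rewrite FU (lE _ (borel_open oU)) => lc.
  have <- : lim (l \o F @ \oo) = nu U by apply: cvg_lim.
  apply: lime_le; first by apply/cvg_ex; exists (nu U).
  apply: nearW => n /=; rewrite (lE _ (cb _ (cF n))).
  apply: ereal_sup_ubound; exists (F n) => //; split=> //.
  by rewrite -FU => x Fx; exists n.
Qed.

End haar_pow_pred.

(** * Complete metrics and measurable limits *)

Lemma half_pow_lt (K : realType) (eps : K) : 0 < eps -> exists j, 2^-1 ^+ j < eps.
Proof.
move=> e0; have : geometric (1 : K) 2^-1 @ \oo --> (0 : K).
  by apply: cvg_geometric; rewrite ger0_norm ?invf_lt1 ?invr_ge0 // ltr1n.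
move=> /cvgrPdist_lt/(_ _ e0)[j _ /(_ j (leqnn j))].
rewrite /= sub0r normrN mul1r ger0_norm ?exprn_ge0 ?invr_ge0 //.
by exists j.
Qed.

Section metric.
Variables (A : topologicalType) (d : A -> A -> R).
Hypothesis hd : complete_metric_for d.

Lemma dist_ge0 x y : 0 <= d x y. Proof. by have [[]] := hd. Qed.
Lemma dist_eq0 x y : d x y = 0 -> x = y. Proof. by have [[_ h _ _] _ _] := hd; move/h. Qed.
Lemma distxx x : d x x = 0. Proof. by have [[_ h _ _] _ _] := hd; apply/h. Qed.
Lemma distC x y : d x y = d y x. Proof. by have [[]] := hd. Qed.
Lemma dist_triangle y x z : d x z <= d x y + d y z. Proof. by have [[]] := hd. Qed.

Lemma open_dball x (eps : R) : open [set y | d x y < eps].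
Proof.
have [_ h _] := hd; apply/h => y /= xy; exists (eps - d x y); first by rewrite subr_gt0.
move=> z /= yz; apply: le_lt_trans (dist_triangle y x z) _.
by rewrite -ltrBrDl.
Qed.

Lemma nbhs_dball x (U : set A) : nbhs x U <-> exists2 eps : R, 0 < eps & [set y | d x y < eps] `<=` U.
Proof.
split=> [|[eps e0 sU]].
  rewrite nbhsE => -[V [oV Vx] VU]; have [_ /(_ V)[/(_ oV)/(_ _ Vx)[eps e0 sV] _] _] := hd.
  by exists eps => // y /sV /VU.
apply: filterS sU _; apply: open_nbhs_nbhs; split; first exact: open_dball.
by rewrite /= distxx.
Qed.

Lemma cvg_dist (u : nat -> A) l : u @ \oo --> l <->
  forall eps : R, 0 < eps -> exists N, forall n, (N <= n)%N -> d l (u n) < eps.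
Proof.
split=> [ul eps e0|h U /nbhs_dball[eps e0 sU]].
  have [|N _ hN] := ul [set y | d l y < eps].
    by apply/nbhs_dball; exists eps.
  by exists N => n Nn; exact: hN.
by have [N hN] := h _ e0; exists N => // n Nn; apply: sU; exact: hN.
Qed.

Lemma cvg_dist_unique (u : nat -> A) (l l' : A) : u @ \oo --> l -> u @ \oo --> l' -> l = l'.
Proof.
move=> /cvg_dist h /cvg_dist h'; apply: dist_eq0; apply/eqP.
rewrite eq_le dist_ge0 andbT; apply/ler_addgt0Pr => e e0; rewrite add0r.
have e20 : 0 < e / 2 by rewrite divr_gt0.
have [[N hN] [N' hN']] := (h _ e20, h' _ e20).
have := hN _ (leq_maxl N N'); have := hN' _ (leq_maxr N N'); rewrite (distC l') => h1 h2.
by apply: le_trans (dist_triangle (u (maxn N N')) _ _) _; rewrite [leRHS]splitr lerD // ltW.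
Qed.

Lemma separable_has_base : separable_space A -> has_base A.
Proof.
move=> [D [/countable_injP[f finj] dD]].
pose c n := [set x | D x /\ f x = n].
have cuniq n x y : c n x -> c n y -> x = y.
  by move=> [Dx fx] [Dy fy]; apply: finj; rewrite ?inE ?fx.
exists (fun n => if unpickle n is Some (i, j) then [set y | exists2 x, c i x & d x y < 2^-1 ^+ j] else set0).
split=> [n|x U /nbhs_dball[eps e0 sU]].
  case: unpickle => [[i j]|]; last exact: open0.
  rewrite openE => y [x cx xy]; apply: filterS (open_nbhs_nbhs (conj (open_dball x (2^-1 ^+ j)) xy)).
  by move=> z; exists x.
have [|j hj] := @half_pow_lt R (eps / 2); first by rewrite divr_gt0.
have j0 : 0 < 2^-1 ^+ j :> R by rewrite exprn_gt0 // invr_gt0.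
have [|y [/= xy Dy]] := dD [set y | d x y < 2^-1 ^+ j] _ (open_dball _ _); first by exists x; rewrite /= distxx.
exists (pickle (f y, j)); rewrite pickleK; first by exists y => //; rewrite distC.
move=> z [y' cy' y'z]; apply: sU => /=.
have yy' : y = y' by exact: (cuniq (f y)).
rewrite -yy' in y'z; apply: le_lt_trans (dist_triangle y x z) _.
by rewrite [ltRHS]splitr ltrD // (lt_trans _ hj).
Qed.

Lemma open_dist_lt (eps : R) : open [set xy : A * A | d xy.1 xy.2 < eps].
Proof.
rewrite openE => -[x y] /= xy.
have r0 : 0 < (eps - d x y) / 2 by rewrite divr_gt0 // subr_gt0.
exists ([set x' | d x x' < (eps - d x y) / 2], [set y' | d y y' < (eps - d x y) / 2]) => /=.
  by split; apply/nbhs_dball; exists ((eps - d x y) / 2).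
move=> [x' y'] /= [xx' yy'].
have h1 := dist_triangle x x' y'; have h2 := dist_triangle y x y'; rewrite distC in xx'.
by move: h1 h2 xx' yy'; lra.
Qed.

Lemma borel_dist_lt (T : topologicalType) (f g : T -> A) (eps : R) : has_base A ->
  borel_measurable f -> borel_measurable g -> borel_sets [set z | d (f z) (g z) < eps].
Proof.
move=> bA bf bg.
by apply: (borel_pair bA bA bf bg (B := [set xy | d xy.1 xy.2 < eps])); apply: borel_open; exact: open_dist_lt.
Qed.

End metric.

(** Total, with value 0 on divergent sequences, so that pointwise limits of Borel functions are
    Borel functions defined everywhere. *)
Definition seq_lim (A : topologicalZmodType) (u : nat -> A) : A := xget 0 [set l | u @ \oo --> l].

Lemma seq_limP (A : topologicalZmodType) (u : nat -> A) (l : A) : u @ \oo --> l -> u @ \oo --> seq_lim u.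
Proof. by move=> ul; rewrite /seq_lim; case: xgetP => // /(_ l). Qed.

Lemma borel_seq_lim (T : topologicalType) (A : topologicalZmodType) (d : A -> A -> R)
    (F : nat -> T -> A) : complete_metric_for d -> has_base A ->
  (forall n, borel_measurable (F n)) -> borel_measurable (fun z => seq_lim (fun n => F n z)).
Proof.
move=> hd bA bF.
pose C : set T := \bigcap_k \bigcup_N \bigcap_m \bigcap_n
  [set z | d (F (N + m)%N z) (F (N + n)%N z) < 2^-1 ^+ k].
have bC : borel_sets C.
  apply: borel_bigcap => k; apply: borel_bigcup => N; apply: borel_bigcap => m; apply: borel_bigcap => n.
  exact: (borel_dist_lt hd).
have CP z : C z <-> exists l : A, (fun n => F n z) @ \oo --> l.
  split=> [Cz|[l /(cvg_dist hd) lP] k _].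
    have [_ _ cpl] := hd; apply: cpl => eps e0.
    have [k hk] := @half_pow_lt R _ e0; have [N _ hN] := Cz k I.
    exists N => m n Nm Nn; apply: lt_trans hk.
    by have := hN (m - N)%N I (n - N)%N I; rewrite /= !subnKC.
  have e0 : 0 < 2^-1 ^+ k / 2 :> R by rewrite divr_gt0 // exprn_gt0 // invr_gt0.
  have [N hN] := lP _ e0; exists N => // m _ n _ /=.
  apply: le_lt_trans (dist_triangle hd l _ _) _; rewrite [ltRHS]splitr ltrD //.
    by rewrite (distC hd); apply: hN; exact: leq_addr.
  by apply: hN; exact: leq_addr.
apply: borel_measurable_open => V oV.
(* [Vk k] is the closed set of points whose ball of radius 2^-k lies in [V]. A limit is in [V]
   exactly when the sequence is eventually in one [Vk k]; divergent points go to [V] exactly when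
   the default value 0 does. *)
pose Vk k : set A := [set a | forall b, d a b < 2^-1 ^+ k -> V b].
have cVk k : closed (Vk k).
  rewrite -openC openE => a /existsNP[b /not_implyP[ab nVb]].
  apply/(nbhs_dball hd); exists (2^-1 ^+ k - d a b); first by rewrite subr_gt0.
  move=> a' /= aa' h; apply: nVb; apply: h; rewrite (distC hd) in aa'.
  by have := dist_triangle hd a a' b; move: aa'; lra.
have -> : (fun z => seq_lim (fun n => F n z)) @^-1` V =
   (C `&` \bigcup_k \bigcup_N \bigcap_m (F (N + m)%N @^-1` Vk k)) `|` (if `[< V 0 >] then ~` C else set0).
  apply/seteqP; split=> [z /= Vz|z [[/CP[l /seq_limP lP] [k _ [N _ h]]]|]] /=.
  - have [Cz|nCz] := pselect (C z); last first.
      right; move: Vz; rewrite /seq_lim; case: xgetP => [y _ yl|_ V0]; last by rewrite asboolT.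
      by case: nCz; apply/CP; exists y.
    left; split=> //; have /CP[l /seq_limP/(cvg_dist hd) lP] := Cz.
    have /(nbhs_dball hd)[eps e0 sV] : nbhs (seq_lim (fun n => F n z)) V by exact: open_nbhs_nbhs.
    have [|k hk] := @half_pow_lt R (eps / 2); first by rewrite divr_gt0.
    have k0 : 0 < 2^-1 ^+ k :> R by rewrite exprn_gt0 // invr_gt0.
    have [N hN] := lP _ k0; exists k => //; exists N => // m _ b /= Fb.
    apply: sV => /=; apply: le_lt_trans (dist_triangle hd (F (N + m)%N z) _ _) _.
    rewrite [ltRHS]splitr ltrD ?(lt_trans Fb) //; apply: lt_trans hk; apply: hN; exact: leq_addr.
  - have k0 : 0 < 2^-1 ^+ k :> R by rewrite exprn_gt0 // invr_gt0.
    move/(cvg_dist hd): lP => /(_ _ k0)[M hM].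
    apply: (h M I); rewrite (distC hd); apply: hM; exact: leq_addl.
  - case: asboolP => // V0 nCz; rewrite /seq_lim; case: xgetP => // y _ yl.
    by case: nCz; apply/CP; exists y.
apply: borelU.
  apply: borelI => //; apply: borel_bigcup => k; apply: borel_bigcup => N; apply: borel_bigcap => m.
  by apply: bF; exact: borel_closed.
by case: asboolP => _; [exact: borelC|exact: borel0].
Qed.

(** * Convergence in measure *)

Lemma mul_sign (A : zmodType) (a : A) k : a *~ ((-1) ^+ k) = if odd k then - a else a.
Proof. by rewrite -signr_odd; case: (odd k); rewrite ?expr1 ?expr0 ?mulrNz ?mulr1z. Qed.

Section borel_zmod.
Variables (A : topologicalZmodType) (T : topologicalType).
Hypothesis bA : has_base A.
Implicit Types f g : T -> A.

Lemma borel_add f g : borel_measurable f -> borel_measurable g -> borel_measurable (fun y => f y + g y).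
Proof.
move=> bf bg; have := borel_pair bA bA bf bg.
by apply: (borel_comp (g := fun ab : A * A => ab.1 + ab.2)); apply: continuous_borel; exact: add_continuous.
Qed.

Lemma borel_opp f : borel_measurable f -> borel_measurable (fun y => - f y).
Proof. by apply: (borel_comp (g := fun a : A => - a)); apply: continuous_borel; exact: opp_continuous. Qed.

Lemma borel_cst (a : A) : borel_measurable (fun _ : T => a).
Proof. by apply: continuous_borel; exact: cont_cst. Qed.

Lemma borel_sub f g : borel_measurable f -> borel_measurable g -> borel_measurable (fun y => f y - g y).
Proof. by move=> bf bg; apply: borel_add => //; exact: borel_opp. Qed.

Lemma borel_sign f k : borel_measurable f -> borel_measurable (fun y => f y *~ ((-1) ^+ k)).
Proof.
move=> bf; have -> : (fun y => f y *~ (-1) ^+ k) = (if odd k then (fun y => - f y) else f).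
  by apply/funext => y; rewrite mul_sign; case: ifP.
by case: ifP => // _; exact: borel_opp.
Qed.

Lemma borel_sum n (f : 'I_n -> T -> A) : (forall i, borel_measurable (f i)) ->
  borel_measurable (fun y => \sum_i f i y).
Proof.
elim: n f => [|n ih] f bf.
  have -> : (fun y => \sum_i f i y) = (fun=> 0) by apply/funext => y; rewrite big_ord0.
  exact: borel_cst.
have -> : (fun y => \sum_i f i y) = (fun y => f ord0 y + \sum_i f (lift ord0 i) y).
  by apply/funext => y; rewrite big_ord_recl.
by apply: borel_add => //; apply: ih.
Qed.

Lemma borel_eq f g : (forall a b : A, a <> b -> exists U, [/\ open U, U a & ~ U b]) ->
  borel_measurable f -> borel_measurable g -> borel_sets [set y | f y <> g y].
Proof.
move=> sep bf bg; have [b [bo bb]] := bA.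
have -> : [set y | f y <> g y] = \bigcup_n ((f @^-1` b n) `\` (g @^-1` b n)).
  apply/seteqP; split=> [y /sep[U [oU Uf nUg]]|y [n _ [fy ngy]] /= e]; last by apply: ngy; rewrite /= -e.
  have [n bn bU] := bb _ _ (open_nbhs_nbhs (conj oU Uf)).
  by exists n => //; split=> // /bU.
by apply: borel_bigcup => n; apply: borelD; [apply: bf|apply: bg]; exact: borel_open.
Qed.

End borel_zmod.

Section L0.
Variables (A : topologicalZmodType) (d : A -> A -> R).
Hypotheses (hd : complete_metric_for d) (bA : has_base A).

Lemma metric_sep (a b : A) : a <> b -> exists U, [/\ open U, U a & ~ U b].
Proof.
move=> ab; exists [set y | d a y < d a b]; split; [exact: (open_dball hd)| |by rewrite /= ltxx].
rewrite /= (distxx hd) lt_neqAle (dist_ge0 hd) andbT eq_sym.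
by apply/eqP => /(dist_eq0 hd).
Qed.

(* [small] is a neighbourhood of 0 and [close] an entourage for convergence in measure. *)
Definition small (T : topologicalType) (P : set T -> R) (eps : R) (c : T -> A) : Prop :=
  exists B, [/\ borel_sets B, P B < eps & forall y, ~ B y -> d 0 (c y) < eps].

Definition close (T : topologicalType) (P : set T -> R) (eps : R) (f g : T -> A) : Prop :=
  exists B, [/\ borel_sets B, P B < eps & forall y, ~ B y -> d (f y) (g y) < eps].

Lemma dist0_add (eps : R) : 0 < eps -> exists2 delta : R, 0 < delta &
  forall a b, d 0 a < delta -> d 0 b < delta -> d 0 (a + b) < eps.
Proof.
move=> e0; have : nbhs ((0 : A) + 0) [set y | d 0 y < eps].
  by rewrite addr0; apply/(nbhs_dball hd); exists eps.
move=> /(@add_continuous A (0, 0))[[U V] /= [/(nbhs_dball hd)[e1 e10 U1] /(nbhs_dball hd)[e2 e20 V2]] UV].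
exists (Num.min e1 e2); first by rewrite lt_min e10.
move=> a b; rewrite !lt_min => /andP[a1 _] /andP[_ b2].
by apply: (UV (a, b)); split; [exact: U1|exact: V2].
Qed.

Lemma dist0_opp (eps : R) : 0 < eps -> exists2 delta : R, 0 < delta &
  forall a, d 0 a < delta -> d 0 (- a) < eps.
Proof.
move=> e0; have : nbhs (- (0 : A)) [set y | d 0 y < eps].
  by rewrite oppr0; apply/(nbhs_dball hd); exists eps.
move=> /(@opp_continuous A 0)/(nbhs_dball hd)[e1 e10 U1].
by exists e1 => // a; exact: U1.
Qed.

Section small.
Variables (T : topologicalType) (P : set T -> R).
Hypothesis hP : borel_prob P.

Lemma small_le (e1 e2 : R) (c : T -> A) : e1 <= e2 -> small P e1 c -> small P e2 c.
Proof.
move=> e12 [B [bB PB cB]]; exists B; split=> //; first exact: lt_le_trans e12.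
by move=> y /cB h; exact: lt_le_trans e12.
Qed.

Lemma close_le (e1 e2 : R) (f g : T -> A) : e1 <= e2 -> close P e1 f g -> close P e2 f g.
Proof.
move=> e12 [B [bB PB cB]]; exists B; split=> //; first exact: lt_le_trans e12.
by move=> y /cB h; exact: lt_le_trans e12.
Qed.

Lemma small_zero (eps : R) (c : T -> A) : 0 < eps -> (forall y, c y = 0) -> small P eps c.
Proof.
move=> e0 c0; exists set0; split; [exact: borel0|by rewrite (prob0 hP)|].
by move=> y _; rewrite c0 (distxx hd).
Qed.

Lemma small_ext (eps : R) (c c' : T -> A) : (forall y, c y = c' y) -> small P eps c -> small P eps c'.
Proof. by move=> cc' [B [bB PB h]]; exists B; split=> // y /h; rewrite cc'. Qed.

Lemma close_trans (e1 e2 : R) (f g h : T -> A) :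
  close P e1 f g -> close P e2 g h -> close P (e1 + e2) f h.
Proof.
move=> [B [bB PB hB]] [C [bC PC hC]]; exists (B `|` C); split; first exact: borelU.
  by apply: le_lt_trans (probU_le hP bB bC) _; rewrite ltrD.
move=> y /not_orP[nB nC]; apply: le_lt_trans (dist_triangle hd (g y) _ _) _.
by rewrite ltrD ?hB ?hC.
Qed.

Lemma close_sym (e : R) (f g : T -> A) : close P e f g -> close P e g f.
Proof. by move=> [B [bB PB hB]]; exists B; split=> // y /hB; rewrite (distC hd). Qed.

Lemma close_refl (e : R) (f : T -> A) : 0 < e -> close P e f f.
Proof.
move=> e0; exists set0; split; [exact: borel0|by rewrite (prob0 hP)|].
by move=> y _; rewrite (distxx hd).
Qed.

End small.

Lemma smallD (eps : R) : 0 < eps -> exists2 delta : R, 0 < delta &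
  forall (T : topologicalType) (P : set T -> R) (c c' : T -> A), borel_prob P ->
    small P delta c -> small P delta c' -> small P eps (fun y => c y + c' y).
Proof.
move=> e0; have [d1 d10 h1] := dist0_add e0.
exists (Num.min d1 (eps / 2)); first by rewrite lt_min d10 divr_gt0.
move=> T P c c' hP [B [bB PB cB]] [B' [bB' PB' cB']]; exists (B `|` B'); split; first exact: borelU.
  apply: le_lt_trans (probU_le hP bB bB') _; rewrite [ltRHS]splitr.
  by move: PB PB'; rewrite !lt_min => /andP[_ ?] /andP[_ ?]; rewrite ltrD.
move=> y /not_orP[/cB + /cB']; rewrite !lt_min => /andP[? _] /andP[? _].
exact: h1.
Qed.

Lemma small_sign (eps : R) : 0 < eps -> exists2 delta : R, 0 < delta &
  forall (T : topologicalType) (P : set T -> R) (c : T -> A) (k : nat),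
    small P delta c -> small P eps (fun y => c y *~ ((-1) ^+ k)).
Proof.
move=> e0; have [d1 d10 h1] := dist0_opp e0.
exists (Num.min d1 eps); first by rewrite lt_min d10.
move=> T P c k [B [bB]]; rewrite lt_min => /andP[_ PB] cB; exists B; split=> // y /cB.
by rewrite lt_min mul_sign => /andP[y1 ye]; case: ifP => // _; exact: h1.
Qed.

Lemma small_sum (n : nat) (eps : R) : 0 < eps -> exists2 delta : R, 0 < delta &
  forall (T : topologicalType) (P : set T -> R) (c : 'I_n -> T -> A), borel_prob P ->
    (forall i, small P delta (c i)) -> small P eps (fun y => \sum_i c i y).
Proof.
elim: n eps => [|n ih] eps e0.
  by exists 1 => // T P c hP _; apply: small_zero => // y; rewrite big_ord0.
have [d1 d10 h1] := smallD e0; have [d2 d20 h2] := ih _ d10.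
exists (Num.min d1 d2); first by rewrite lt_min d10.
move=> T P c hP hc; apply: (@small_ext _ _ _ (fun y => c ord0 y + \sum_i c (lift ord0 i) y)).
  by move=> y; rewrite big_ord_recl.
apply: h1 => //; first by apply: small_le (hc ord0); rewrite ge_min lexx.
by apply: h2 => // i; apply: small_le (hc _); rewrite ge_min lexx orbT.
Qed.

(** The sets [Q k] will be those of the points where a uniform estimate with radius 2^-k fails.
    Since they decrease to the empty set, the estimate holds for one k off a set of small
    measure. *)
Lemma shrinking_preimage (T : topologicalType) (P : set T -> R) (F : T -> A) (Q : nat -> set A) (eps : R) :
  borel_prob P -> borel_measurable F -> (forall k, open (Q k)) -> (forall k, Q k.+1 `<=` Q k) ->
  (forall a, exists k, ~ Q k a) -> 0 < eps -> exists k, P (F @^-1` Q k) < eps.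
Proof.
move=> hP bF oQ Qd Q0 e0; apply: (prob_dec hP) => //.
- by move=> k; apply: bF; exact: borel_open.
- by move=> k x; exact: Qd.
- by rewrite -subset0 => x h; have [k nk] := Q0 (F x); apply: nk; exact: (h k I).
Qed.

Lemma open_dist_gt (X : topologicalType) (f g : X -> A) (eps : R) :
  continuous f -> continuous g -> open [set x | eps < d (f x) (g x)].
Proof.
move=> fc gc; rewrite openE => x /= xe.
have r0 : 0 < (d (f x) (g x) - eps) / 2 by rewrite divr_gt0 // subr_gt0.
have h1 : nbhs x (f @^-1` [set b | d (f x) b < (d (f x) (g x) - eps) / 2]).
  by apply: fc; apply/(nbhs_dball hd); exists ((d (f x) (g x) - eps) / 2).
have h2 : nbhs x (g @^-1` [set b | d (g x) b < (d (f x) (g x) - eps) / 2]).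
  by apply: gc; apply/(nbhs_dball hd); exists ((d (f x) (g x) - eps) / 2).
apply: filterS2 h1 h2 => z /= fz gz.
have t1 := dist_triangle hd (f z) (f x) (g x); have t2 := dist_triangle hd (g z) (f z) (g x).
by rewrite (distC hd (g x)) in gz; move: t1 t2 fz gz; lra.
Qed.

Lemma half_pow_gt0 (k : nat) : 0 < 2^-1 ^+ k :> R.
Proof. by rewrite exprn_gt0 // invr_gt0. Qed.

Lemma half_powS_lt (k : nat) : 2^-1 ^+ k.+1 < 2^-1 ^+ k :> R.
Proof. by rewrite exprS gtr_pMl ?half_pow_gt0 // invf_lt1 // ltr1n. Qed.

(** As [d] need not be invariant, a small [r] may move some values of [F] far. The points moved by
    more than [eps / 2] by some r within 2^-k of 0 form the open set [Q k], and continuity of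
    addition at each point makes these sets shrink to nothing. *)
Lemma close_add (T : topologicalType) (P : set T -> R) (F : T -> A) (eps : R) :
  borel_prob P -> borel_measurable F -> 0 < eps -> exists2 delta : R, 0 < delta &
  forall r, small P delta r -> close P eps F (fun y => F y + r y).
Proof.
move=> hP bF e0; have e20 : 0 < eps / 2 by rewrite divr_gt0.
pose Q k : set A := \bigcup_(r in [set r | d 0 r < 2^-1 ^+ k]) [set a | eps / 2 < d a (a + r)].
have [|||k PQ] := @shrinking_preimage T P F Q (eps / 2) hP bF _ _ _ e20.
- move=> k; apply: bigcup_open => r _; apply: open_dist_gt; first exact: cont_id.
  exact: (cont_comp2 (h := +%R) (@cont_id A) (@cont_cst A A r) (@add_continuous A)).
- by move=> k a [r /= r1 r2]; exists r => //=; exact: lt_trans (half_powS_lt k).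
- move=> a.
  have : nbhs (0 : A) ((fun r => a + r) @^-1` [set b | d a b < eps / 2]).
    apply: (cont_comp2 (h := +%R) (@cont_cst A A a) (@cont_id A) (@add_continuous A)).
    by apply/(nbhs_dball hd); exists (eps / 2) => //; rewrite addr0.
  move=> /(nbhs_dball hd)[e1 e10 h1]; have [k hk] := @half_pow_lt R _ e10.
  exists k => -[r /= r1]; rewrite ltNge => /negP; apply; apply: ltW.
  by apply: h1; exact: lt_trans hk.
exists (Num.min (2^-1 ^+ k) (eps / 2)); first by rewrite lt_min half_pow_gt0.
move=> r [B [bB PB rB]]; have bQ : borel_sets (F @^-1` Q k).
  apply: bF; apply: borel_open; apply: bigcup_open => a _; apply: open_dist_gt; first exact: cont_id.
  exact: (cont_comp2 (h := +%R) (@cont_id A) (@cont_cst A A a) (@add_continuous A)).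
exists (B `|` F @^-1` Q k); split; first exact: borelU.
  apply: le_lt_trans (probU_le hP bB bQ) _; rewrite [ltRHS]splitr.
  by rewrite ltrD //; move: PB; rewrite lt_min => /andP[].
move=> y /not_orP[/rB]; rewrite lt_min => /andP[r1 _] nQ.
rewrite ltNge; apply/negP => h; apply: nQ; exists (r y) => //=.
by apply: lt_le_trans h; rewrite ltr_pdivrMr // ltr_pMr // ltr1n.
Qed.

(** Converse comparison of [close] and [small]; here [Q k] collects the points a having some b
    within 2^-k for which b - a is far from 0. *)
Lemma small_of_close (T : topologicalType) (P : set T -> R) (F : T -> A) (eps : R) :
  borel_prob P -> borel_measurable F -> 0 < eps -> exists2 delta : R, 0 < delta &
  forall g, close P delta F g -> small P eps (fun y => g y - F y).
Proof.
move=> hP bF e0; have e20 : 0 < eps / 2 by rewrite divr_gt0.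
pose Q k : set A := \bigcup_b ([set a | d b a < 2^-1 ^+ k] `&` [set a | eps / 2 < d 0 (b - a)]).
have oQ k : open (Q k).
  apply: bigcup_open => b _; apply: openI; first exact: (open_dball hd).
  apply: open_dist_gt; first exact: cont_cst.
  exact: (cont_comp2 (h := fun x y : A => x - y) (@cont_cst A A b) (@cont_id A) (@sub_continuous A)).
have [||k PQ] := @shrinking_preimage T P F Q (eps / 2) hP bF oQ _ _ e20.
- by move=> k a [b _ [/= b1 b2]]; exists b => //; split=> //=; exact: lt_trans (half_powS_lt k).
- move=> a.
  have : nbhs a ((fun b => b - a) @^-1` [set b | d 0 b < eps / 2]).
    apply: (cont_comp2 (h := fun x y : A => x - y) (@cont_id A) (@cont_cst A A a) (@sub_continuous A)).
    by apply/(nbhs_dball hd); exists (eps / 2) => //; rewrite subrr.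
  move=> /(nbhs_dball hd)[e1 e10 h1]; have [k hk] := @half_pow_lt R _ e10.
  exists k => -[b _ [/= b1]]; rewrite ltNge => /negP; apply; apply: ltW.
  by apply: h1; rewrite /= (distC hd); exact: lt_trans hk.
exists (Num.min (2^-1 ^+ k) (eps / 2)); first by rewrite lt_min half_pow_gt0.
move=> g [B [bB PB rB]]; have bQ : borel_sets (F @^-1` Q k) by apply: bF; exact: borel_open.
exists (B `|` F @^-1` Q k); split; first exact: borelU.
  apply: le_lt_trans (probU_le hP bB bQ) _; rewrite [ltRHS]splitr.
  by rewrite ltrD //; move: PB; rewrite lt_min => /andP[].
move=> y /not_orP[/rB]; rewrite lt_min => /andP[r1 _] nQ.
rewrite ltNge; apply/negP => h; apply: nQ; exists (g y) => //=; split; first by rewrite /= (distC hd).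
by apply: lt_le_trans h; rewrite ltr_pdivrMr // ltr_pMr // ltr1n.
Qed.

Lemma thom_prob_small (H K : tgroup) (f : H -> K) (P : set H -> R) (Q : set K -> R) (eps : R) :
  thom f -> qinv P -> qinv Q -> 0 < eps -> exists2 delta : R, 0 < delta &
  forall B, borel_sets B -> Q B < delta -> P (f @^-1` B) < eps.
Proof.
move=> hf hP hQ e0; have [fc _ _] := hf; have bf := continuous_borel fc.
have [[p1 p2] _] := hP; have [[q1 q2] _] := hQ.
have [||||delta d0 h] := @abs_cont K (tone K) (fun B => (Q B)%:E) (fun B => (P (f @^-1` B))%:E) eps _ _ _ _ e0.
- exact: q1.
- exact: (is_borel_measure_push bf p1).
- exact: ltry.
- move=> B bB [QB]; congr EFin; exact: (qinv_null (qinv_push hf hP) hQ).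
by exists delta => // B bB QB; have := h B bB; rewrite !lte_fin; apply.
Qed.

Lemma small_pull (H K : tgroup) (f : H -> K) (P : set H -> R) (Q : set K -> R) (eps : R) :
  thom f -> qinv P -> qinv Q -> 0 < eps -> exists2 delta : R, 0 < delta &
  forall c, small Q delta c -> small P eps (fun x => c (f x)).
Proof.
move=> hf hP hQ e0; have [fc _ _] := hf; have [d1 d10 h1] := thom_prob_small hf hP hQ e0.
exists (Num.min d1 eps); first by rewrite lt_min d10.
move=> c [B [bB]]; rewrite lt_min => /andP[B1 _] cB; exists (f @^-1` B); split.
- exact: (continuous_borel fc).
- exact: h1.
- by move=> y /cB; rewrite lt_min => /andP[].
Qed.

(** This supplies the generic constant to be inserted: it can avoid a given null set and at the same
    time have a small slice. If all slices off [N] were bad, [product_ge] would bound the measure of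
    the exceptional set from below. *)
Lemma small_slice (H K L : tgroup) (f : tprod H K -> L) (P : set H -> R) (Q : set K -> R)
    (S : set L -> R) (eps : R) :
  thom f -> qinv P -> qinv Q -> qinv S -> 0 < eps -> exists2 delta : R, 0 < delta &
  forall c N, small S delta c -> pnull P N -> exists2 x, ~ N x & small Q eps (fun y => c (f (x, y))).
Proof.
move=> hf hP hQ hS e0; have [PQ [hPQ _ _ _ ge]] := qinv_prod hP hQ.
have [fc _ _] := hf; have [d1 d10 h1] := thom_prob_small hf hPQ hS e0.
exists (Num.min d1 eps); first by rewrite lt_min d10.
move=> c N [B [bB]]; rewrite lt_min => /andP[B1 _] cB nN.
have bfB : borel_sets (f @^-1` B) by exact: (continuous_borel fc).
apply: contrapT => /forall2NP h.
have : eps <= PQ (f @^-1` B).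
  apply: ge => //; first exact: ltW.
  apply: pnullS nN => x /= /negP; rewrite -ltNge => hx.
  have [/contrapT//|] := h x; case; exists [set y | B (f (x, y))]; split=> //.
    exact: (@borel_slicel H K x (f @^-1` B)).
  by move=> y /cB; rewrite lt_min => /andP[].
by rewrite leNgt h1.
Qed.

(** Borel-Cantelli. Off a set of measure at most 2 * 2^-n all later steps are geometrically small
    and the limit is within 3 * 2^-n of [F n]; the factor 4 makes both bounds strict. *)
Lemma rapid_limit (T : topologicalType) (P : set T -> R) (F : nat -> T -> A) : borel_prob P ->
  (forall n, close P (2^-1 ^+ n) (F n) (F n.+1)) ->
  pnull P [set y | ~ ((fun n => F n y) @ \oo --> seq_lim (fun n => F n y))] /\
  forall n, close P (4 * 2^-1 ^+ n) (F n) (fun y => seq_lim (fun n => F n y)).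
Proof.
move=> hP /choice[B BP].
have bB n : borel_sets (B n) by case: (BP n).
pose U n := \bigcup_k B (n + k)%N.
have bU n : borel_sets (U n) by apply: borel_bigcup.
have PU n : P (U n) <= 2 * 2^-1 ^+ n.
  apply: (prob_bigcup_geom hP) => // k; have [_ /ltW h _] := BP (n + k)%N.
  by apply: le_trans h _; rewrite exprD exprVn [X in _ * X]exprVn.
(* Keeping the remaining tail as a subtracted term lets the induction on k close. *)
have dist n y : ~ U n y -> forall k, d (F n y) (F (n + k)%N y) <= 2 * 2^-1 ^+ n - 2 * 2^-1 ^+ (n + k).
  move=> nU; elim=> [|k ih]; first by rewrite addn0 subrr (distxx hd).
  have [_ _ /(_ y) h] := BP (n + k)%N.
  have {h} : d (F (n + k)%N y) (F (n + k).+1 y) < 2^-1 ^+ (n + k) by apply: h => By; apply: nU; exists k.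
  have := dist_triangle hd (F (n + k)%N y) (F n y) (F (n + k.+1)%N y).
  by rewrite addnS exprS; move: ih; move: (_ ^+ (n + k)) => q; lra.
have cvgU n y : ~ U n y -> (fun n => F n y) @ \oo --> seq_lim (fun n => F n y).
  move=> nU; have [_ _ cpl] := hd.
  have [|l lP] := cpl (fun n => F n y); last exact: seq_limP lP.
  move=> eps e0; have [|k hk] := @half_pow_lt R (eps / 4); first by rewrite divr_gt0.
  exists (n + k)%N => m m' hm hm'.
  have nU' : ~ U (n + k)%N y by move=> [j _ Bj]; apply: nU; exists (k + j)%N => //; rewrite addnA.
  have := dist _ _ nU' (m - (n + k))%N; have := dist _ _ nU' (m' - (n + k))%N.
  rewrite !subnKC // => h1 h2.
  have h3 := dist_triangle hd (F (n + k)%N y) (F m y) (F m' y); rewrite (distC hd (F m y) (F (n + k)%N y)) in h3.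
  have h4 : 2^-1 ^+ (n + k) <= 2^-1 ^+ k :> R.
    by rewrite exprD ler_piMl ?exprn_ge0 ?invr_ge0 // exprn_ile1 ?invr_ge0 // invf_le1 // ler1n.
  have h5 := half_pow_gt0 m; have h6 := half_pow_gt0 m'.
  by move: h1 h2 h3 h4 h5 h6 hk; move: (2^-1 ^+ (n + k)) (2^-1 ^+ k) (2^-1 ^+ m) (2^-1 ^+ m') => q1 q2 q3 q4; lra.
split.
  exists (\bigcap_n U n); split; first exact: borel_bigcap.
    apply/eqP; rewrite eq_le (prob_ge0 hP) ?andbT; last exact: borel_bigcap.
    apply/ler_addgt0Pr => e e0; rewrite add0r.
    have [|k hk] := @half_pow_lt R (e / 2); first by rewrite divr_gt0.
    apply: (@le_trans _ _ (P (U k))).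
      by apply: (le_prob hP) => //; [exact: borel_bigcap|move=> x; apply].
    by have := PU k; move: hk; lra.
  move=> y /= nc n _; apply: contrapT => nU; apply: nc; exact: (cvgU n).
move=> n; exists (U n); split=> //.
  by have := PU n; have := half_pow_gt0 n; lra.
move=> y nU; have /(cvg_dist hd) /(_ (2^-1 ^+ n) (half_pow_gt0 n)) [N hN] := cvgU _ _ nU.
have := hN (n + N)%N (leq_addl _ _); have := dist _ _ nU N.
have h := dist_triangle hd (F (n + N)%N y) (F n y) (seq_lim (fun n => F n y)).
rewrite (distC hd (F (n + N)%N y) (seq_lim _)) in h.
have h5 := half_pow_gt0 (n + N); have h6 := half_pow_gt0 n.
by move: h h5 h6; lra.
Qed.

End L0.

(** * Continuity in measure of the action on measurable functions *)

Section action.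
Variables (G : tgroup) (A : topologicalZmodType) (d : A -> A -> R) (act : G -> A -> A) (n : nat).
Hypotheses (hd : complete_metric_for d) (bA : has_base A).
Hypotheses (hG : hausdorff_space G) (lG : locally_compact [set: G]).
Hypothesis actD : forall g a b, act g (a + b) = act g a + act g b.
Hypothesis act1 : forall a, act (tone G) a = a.
Hypothesis actM : forall g h a, act (tmul g h) a = act g (act h a).
Hypothesis act_cont : continuous (fun ga : G * A => act ga.1 ga.2).
Let H := tpow G n.
Variables (mu : set H -> \bar R) (P : set H -> R).
Hypotheses (hmu : is_haar_measure (@tmul H) mu) (hP : qinv P).

Local Notation gact := (@cochain_act G (@tmul G) (@tinv G) A act n).

Lemma act0 g : act g 0 = 0.
Proof. by apply: (addrI (act g 0)); rewrite -actD !addr0. Qed.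

Lemma actN g a : act g (- a) = - act g a.
Proof. by apply: (addrI (act g a)); rewrite -actD !subrr act0. Qed.

Lemma actB g a b : act g (a - b) = act g a - act g b.
Proof. by rewrite actD actN. Qed.

Definition pow_diag (g : G) : H := fun=> g.

Lemma pow_diag_continuous : continuous pow_diag.
Proof. by apply: pow_continuous => i; exact: cont_id. Qed.

Lemma gactE g F y : gact g F y = act g (F (@tmul H (tinv (pow_diag g)) y)).
Proof. by []. Qed.

Lemma gactM g h F y : gact (tmul g h) F y = gact g (gact h F) y.
Proof.
rewrite /cochain_act actM; congr (act _ (act _ (F _))).
by apply/funext => i; rewrite tinvM tmulA.
Qed.

(** Continuity of [act] at (g0, 0) bounds the values and [uniform_qinv] the exceptional set; neither
    bound depends on the function. *)
Lemma gact_small (g0 : G) (eps : R) : 0 < eps -> exists2 delta : R, 0 < delta &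
  \forall g \near g0, forall c, small d P delta c -> small d P eps (gact g c).
Proof.
move=> e0.
have : nbhs (act g0 0) [set y | d 0 y < eps].
  by rewrite act0; apply/(nbhs_dball hd); exists eps.
move=> /(@act_cont (g0, 0)) [[U V] /= [g0U /(nbhs_dball hd)[e1 e10 V1]] UV].
have hH : hausdorff_space H by exact: hausdorff_pow.
have lH : locally_compact [set: H] by exact: locally_compact_pow.
have [d2 d20 h2] := uniform_qinv hH lH hmu hP (pow_diag g0) e0.
exists (Num.min e1 d2); first by rewrite lt_min e10.
have h3 := @pow_diag_continuous g0 _ h2.
apply: filterS2 g0U h3 => g Ug h c [B [bB]]; rewrite lt_min => /andP[_ B2] cB.
exists (tmul (tinv (pow_diag g)) @^-1` B); split.
- exact: (continuous_borel (@tlmul_continuous H (tinv (pow_diag g)))).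
- exact: h.
- move=> y /cB; rewrite lt_min => /andP[c1 _]; rewrite gactE.
  by apply: (UV (g, _)); split=> //=; exact: V1.
Qed.

(** [A] is covered by countably many open sets on which g a' - a'' is near 0 for g near the
    identity. Finitely many of their preimages [C k] cover most of the space, and by
    [translate_cont] most y in [C k] have g^-1 y in [C k] as well, so F y and F (g^-1 y) lie in the
    same open set. *)
Lemma gact_cont1 F (eps : R) : borel_measurable F -> 0 < eps ->
  \forall g \near tone G, small d P eps (fun y => gact g F y - F y).
Proof.
move=> bF e0; have [pP _] := hP; have e20 : 0 < eps / 2 by rewrite divr_gt0.
have /choice[OV OVP] : forall a : A, exists OV : set G * set A, [/\ nbhs (tone G) OV.1, open OV.2, OV.2 a &
    forall g a' a'', OV.1 g -> OV.2 a' -> OV.2 a'' -> d 0 (act g a' - a'') < eps].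
  move=> a.
  have c3 : continuous (fun x : G * A * A => act x.1.1 x.1.2 - x.2).
    apply: (cont_comp2 (h := fun x y : A => x - y) _ (@cont_snd (G * A)%type A) (@sub_continuous A)).
    exact: (cont_comp (@cont_fst (G * A)%type A) act_cont).
  have : nbhs (act (tone G) a - a) [set y | d 0 y < eps].
    by rewrite act1 subrr; apply/(nbhs_dball hd); exists eps.
  move=> /(c3 (tone G, a, a))[[W V1] /= [[[U V2] /= [Ue V2a] UVW] V1a] WV].
  have : nbhs a (V1 `&` V2) by exact: filterI.
  move=> /(nbhs_dball hd)[e1 e10 VV].
  exists (U, [set y | d a y < e1]); split=> //=; [exact: (open_dball hd)|by rewrite (distxx hd)|].
  move=> g a' a'' /= Ug Va' Va''.
  apply: (WV (g, a', a'')); split=> /=; last by case: (VV _ Va'').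
  by apply: UVW; split=> //=; case: (VV _ Va').
pose V a := (OV a).2; pose U a := (OV a).1.
have Vn a : setT a -> nbhs a (V a) by move=> _; have [_ oV Va _] := OVP a; exact: open_nbhs_nbhs.
have [c [_ _ cV]] := lindelof_seq bA (I : setT (0 : A)) Vn.
pose C k : set H := F @^-1` V (c k).
have bC k : borel_sets (C k) by apply: bF; apply: borel_open; have [] := OVP (c k).
have CT : \bigcup_k C k = setT.
  by apply/seteqP; split=> // y _; have [k _ Vk] := cV (F y) I; exists k.
have [m Pm] := prob_cover pP bC CT e20.
have hH : hausdorff_space H by exact: hausdorff_pow.
have lH : locally_compact [set: H] by exact: locally_compact_pow.
have near1 : \forall g \near tone G, forall k : 'I_m, U (c k) g.
  apply: (@filter_forall G _ (fun (k : 'I_m) g => U (c k) g) (nbhs (tone G))) => k.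
  by have [] := OVP (c k).
have near2 : \forall g \near tone G, forall k : 'I_m,
    P (C k `\` tmul (tinv (pow_diag g)) @^-1` C k) < eps / 2 / m%:R.
  apply: (@filter_forall G _ (fun (k : 'I_m) g => P (C k `\` tmul (tinv (pow_diag g)) @^-1` C k) < eps / 2 / m%:R) (nbhs (tone G))) => k.
  have m0 : 0 < eps / 2 / m%:R by rewrite divr_gt0 // ltr0n; case: k => k /=; exact: leq_trans.
  have := @pow_diag_continuous (tone G) _ (translate_cont hH lH hmu hP (bC k) m0).
  rewrite /nbhs /= /fmap /=; apply: filterS => g [] //.
apply: filterS2 near1 near2 => g Ug Pg.
have btr k : borel_sets (C k `\` tmul (tinv (pow_diag g)) @^-1` C k).
  by apply: borelD => //; exact: (continuous_borel (@tlmul_continuous H (tinv (pow_diag g)))).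
have bU1 : borel_sets (~` \bigcup_(k in `I_m) C k).
  by apply: borelC; rewrite bigcup_mkcond; apply: borel_bigcup => k; case: ifP => // _; exact: borel0.
have bU2 : borel_sets (\bigcup_(k in `I_m) (C k `\` tmul (tinv (pow_diag g)) @^-1` C k)).
  by rewrite bigcup_mkcond; apply: borel_bigcup => k; case: ifP => // _; exact: borel0.
exists ((~` \bigcup_(k in `I_m) C k) `|` \bigcup_(k in `I_m) (C k `\` tmul (tinv (pow_diag g)) @^-1` C k)); split.
- exact: borelU.
- apply: le_lt_trans (probU_le pP bU1 bU2) _; rewrite [ltRHS]splitr ltr_leD //.
  exact: (prob_bigcup_ord pP (ltW e20)).
- move=> y /not_orP[/contrapT[k /= km Cky] nD]; rewrite gactE.
  have [_ _ _] := OVP (c k); apply; [exact: (Ug (Ordinal km))| |exact: Cky].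
  by apply: contrapT => h; apply: nD; exists k.
Qed.

Lemma gact_cont (g0 : G) F (eps : R) : borel_measurable F -> 0 < eps -> exists2 delta : R, 0 < delta &
  \forall g \near g0, forall F', small d P delta (fun y => F' y - F y) ->
    small d P eps (fun y => gact g F' y - gact g0 F y).
Proof.
move=> bF e0; have [pP _] := hP; have [d1 d10 h1] := smallD hd e0.
have [d2 d20 h2] := gact_small g0 d10.
have h3 := gact_cont1 bF d20.
have h4 : \forall g \near g0, small d P d2 (fun y => gact (tmul (tinv g0) g) F y - F y).
  have := @tlmul_continuous G (tinv g0) g0; rewrite /continuous_at tVmul => /(_ _ h3); exact.
have h20 := nbhs_singleton h2.
exists d2 => //; apply: filterS2 h2 h4 => g hg2 hg4 F' hF'.
(* g F' - g0 F = g (F' - F) + g0 ((g0^-1 g) F - F): the first term is small uniformly in g, the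
   second by continuity at the identity. *)
apply: (@small_ext _ _ _ _ _ (fun y => gact g (fun y => F' y - F y) y +
   gact g0 (fun y => gact (tmul (tinv g0) g) F y - F y) y)).
  move=> y; rewrite {1 2}/cochain_act !actB -[X in _ + (X - _)]gactM tmulVKl.
  by rewrite addrA subrK.
apply: h1 => //; first exact: hg2.
exact: h20.
Qed.

End action.

(** * Selections *)

Lemma unit_interval_uncountable (K : realType) : ~ countable [set t : K | 0 < t < 1].
Proof.
move=> /countable_lebesgue_measure0 h.
have : lebesgue_measure (`]0, 1[ : set K) = 0%E.
  by rewrite -h; congr lebesgue_measure; apply/seteqP; split=> t /=; rewrite in_itv.
by rewrite lebesgue_measure_itv /= lte_fin ltr01 sube0 => /eqP; rewrite eqe oner_eq0.
Qed.

(** At most k + 1 level sets have measure above 1 / (k + 1), so only countably many are charged. *)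
Lemma level_null (T : topologicalType) (P : set T -> R) (g : T -> R) : borel_prob P ->
  (forall t, borel_sets [set w | g w = t]) -> exists2 t, 0 < t < 1 & P [set w | g w = t] = 0.
Proof.
move=> hP bg; apply: contrapT => /forall2NP h.
pose E (t : R) : set T := [set w | g w = t].
pose N k := [set t : R | 0 < t < 1 /\ k.+1%:R^-1 < P (E t)].
have fin k : finite_set (N k).
  apply: contrapT => /(infinite_set_fset k.+2)[B BN sB].
  have : forall s : seq R, uniq s -> (forall t, t \in s -> N k t) ->
     borel_sets [set w | g w \in s] /\ (size s)%:R * k.+1%:R^-1 <= P [set w | g w \in s].
    elim=> [_ _|t s ih /= /andP[ts us] hs].
      have -> : [set w | g w \in [::]] = set0 by rewrite -subset0.
      by split; [exact: borel0|rewrite mul0r (prob0 hP)].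
    have [|bs Ps] := ih us; first by move=> t' t's; apply: hs; rewrite inE t's orbT.
    have -> : [set w | g w \in t :: s] = E t `|` [set w | g w \in s].
      apply/seteqP; split=> w /=; rewrite inE; first by move=> /orP[/eqP|]; [left|right].
      by move=> [/= ->|->]; rewrite ?eqxx ?orbT.
    split; first by apply: borelU => //; exact: bg.
    rewrite (probU hP (bg t) bs); last by rewrite -subset0 => w [/= -> st]; move: ts; rewrite st.
    have [_ /ltW ht] := hs t (mem_head _ _).
    by rewrite -natr1 mulrDl mul1r addrC lerD.
  move=> /(_ (finmap.enum_fset B) (finmap.fset_uniq B)) [|bs Ps]; first by move=> t tB; apply: BN.
  have := le_trans Ps (prob_le1 hP bs).
  rewrite ler_pdivrMr ?ltr0n // mul1r ler_nat => sB'.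
  by have := leq_trans sB sB'; rewrite ltnn.
apply: (@unit_interval_uncountable R).
have : countable (\bigcup_k N k).
  apply: bigcup_countable => // k _; exact: finite_set_countable.
apply: sub_countable; apply: subset_card_le => t /= t01.
have [//|P0] := h t.
have Pt : 0 < P (E t).
  by rewrite lt_neqAle (prob_ge0 hP (bg t)) andbT eq_sym; apply/eqP.
exists (Num.truncn (P (E t))^-1) => //; split=> //.
rewrite -[ltRHS]invrK ltf_pV2 ?posrE ?invr_gt0 ?ltr0n //.
exact: truncnS_gt.
Qed.

Section step_selection.
Variables (X Om : topologicalType) (P : set Om -> R) (psi : Om -> X).
Hypotheses (bX : has_base X) (hX : hausdorff_space X) (lX : locally_compact [set: X]).
Hypotheses (hP : borel_prob P) (psi_cont : continuous psi).

Lemma null_boundary_nbhs (x : X) (U : set X) : nbhs x U ->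
  exists W, [/\ open W, W x, W `<=` U & P (psi @^-1` (closure W `\` W)) = 0].
Proof.
move=> xU; have [g [lo hi gx g1]] := @lch_separation R _ _ _ hX lX xU.
have cg t : closed [set y | g y <= t].
  have -> : [set y | g y <= t] = ~` [set y | t < g y].
    by apply/seteqP; split=> y /=; [move=> h; apply/negP; rewrite -leNgt|move/negP; rewrite -leNgt].
  by rewrite closedC.
have bpsi := continuous_borel psi_cont.
have bl t : borel_sets [set w | g (psi w) = t].
  have -> : [set w | g (psi w) = t] = psi @^-1` ([set y | g y <= t] `\` [set y | g y < t]).
    apply/seteqP; split=> w /=; first by move=> ->; rewrite lexx ltxx.
    by move=> [h1 /negP]; rewrite -leNgt => h2; apply/eqP; rewrite eq_le h1.
  by apply: bpsi; apply: borelD; [exact: borel_closed|exact: borel_open].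
have [t /andP[t0 t1] Pt] := level_null hP bl.
have cW : closure [set y | g y < t] `<=` [set y | g y <= t].
  by rewrite closureE => y; apply; split=> // z /= /ltW.
exists [set y | g y < t]; split => //=.
- by rewrite gx.
- by move=> y /= yt; apply: contrapT => /g1 gy; move: yt; rewrite gy ltNge ltW.
- apply: (pnull_borel hP).
    by apply: bpsi; apply: borelD; [apply: borel_closed; exact: closed_closure|exact: borel_open].
  exists [set w | g (psi w) = t]; split=> // w [/= /cW h1 /negP]; rewrite -leNgt => h2.
  by apply/eqP; rewrite eq_le h1.
Qed.

(** Each open piece is a neighbourhood with null boundary minus the closures of the earlier ones;
    the pieces are disjoint and only boundaries are lost. The first piece is untouched and contains
    [x0]. Conull is understood through [psi]: in the application this is [normalize], whose image
    may itself be a null set of [X]. *)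
Lemma step_selection (T : set X) (x0 : X) (N : X -> set X) : T x0 ->
  (forall x, T x -> nbhs x (N x)) -> pnull P (psi @^-1` (~` T)) ->
  exists (D : set X) (c : X -> X), [/\ open D, D x0, pnull P (psi @^-1` (~` D)),
    forall x, D x -> T (c x) /\ N (c x) x & forall x, D x -> \forall x' \near x, c x' = c x].
Proof.
move=> Tx0 TN Tnull.
have /choice[W WP] : forall x, exists W, T x ->
    [/\ open W, W x, W `<=` N x & P (psi @^-1` (closure W `\` W)) = 0].
  move=> x; have [Tx|nTx] := pselect (T x); last by exists set0 => /nTx.
  by have [W ?] := null_boundary_nbhs (TN _ Tx); exists W.
have Wn x : T x -> nbhs x (W x) by move=> /WP[? ? _ _]; exact: open_nbhs_nbhs.
have [s [s0 sT sW]] := lindelof_seq bX Tx0 Wn.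
pose E n : set X := W (s n) `\` \big[setU/set0]_(k < n) closure (W (s k)).
have oE n : open (E n).
  rewrite /E setDE; apply: openI; first by have [] := WP _ (sT n).
  rewrite openC; elim/big_ind: _ => [|A B|i _]; [exact: closed0|exact: closedU|exact: closed_closure].
have nclW k n x : (k < n)%N -> E n x -> ~ closure (W (s k)) x.
  move=> kn [_ nU] cx; apply: nU; rewrite -(bigcup_mkord n (fun k => closure (W (s k)))); by exists k.
have disj n m x : E n x -> E m x -> n = m.
  move=> En Em; have [nm|mn|//] := ltngtP n m.
    by case: (nclW _ _ _ nm Em); apply: subset_closure; case: En.
  by case: (nclW _ _ _ mn En); apply: subset_closure; case: Em.
pose c x := s (xget 0%N [set n | E n x]).
have cE n x : E n x -> c x = s n.
  by move=> En; rewrite /c; case: xgetP => [m _ Em|/(_ n)//]; rewrite (disj _ _ _ En Em).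
exists (\bigcup_n E n), c; split.
- by apply: bigcup_open.
- exists 0%N => //; rewrite /E big_ord0 setD0 s0; by have [] := WP _ Tx0.
- apply: (@pnullS _ _ _ (psi @^-1` (~` T) `|` \bigcup_n psi @^-1` (closure (W (s n)) `\` W (s n)))).
    move=> w /= nD; have [Tw|] := pselect (T (psi w)); last by left.
    right; have exW : exists n, `[< W (s n) (psi w) >] by have [n _ ?] := sW _ Tw; exists n; exact/asboolP.
    have [n /asboolP Wn' minn] := ex_minnP exW.
    have : ~ E n (psi w) by move=> En; apply: nD; exists n.
    move=> /not_andP[//|/contrapT]; rewrite -(bigcup_mkord n (fun k => closure (W (s k)))) => -[k /= kn ck].
    exists k => //; split=> // Wk; have := minn k; rewrite leqNgt kn => h.
    by have := h (asboolT Wk).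
  apply: (pnullU hP) => //; apply: (pnull_bigcup hP) => n.
  have [oW _ _ W0] := WP _ (sT n).
  exists (psi @^-1` (closure (W (s n)) `\` W (s n))); split=> //.
  apply: (continuous_borel psi_cont); apply: borelD; last exact: borel_open.
  by apply: borel_closed; exact: closed_closure.
- move=> x [n _ En]; rewrite (cE _ _ En); split=> //.
  by have [_ _ WN _] := WP _ (sT n); apply: WN; case: En.
- move=> x [n _ En]; rewrite (cE _ _ En).
  by apply: filterS (open_nbhs_nbhs (conj (oE n) En)) => x' /cE.
Qed.

End step_selection.

(** Joint measurability follows from measurability of each [F x] because [D] is a countable union of
    basic open sets on which [F] is a single function. *)
Lemma borel_patch (X H A : topologicalType) (D : set X) (F K : X -> H -> A) : has_base X -> open D ->
  (forall x, D x -> borel_measurable (F x)) -> (forall x, D x -> \forall x' \near x, F x' = F x) ->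
  borel_measurable (fun xy : X * H => K xy.1 xy.2) ->
  borel_measurable (fun xy : X * H => if `[< D xy.1 >] then F xy.1 xy.2 else K xy.1 xy.2).
Proof.
move=> [b [bo bb]] oD bF Fc bK; apply: borel_measurable_open => V oV.
have bfst := continuous_borel (@cont_fst X H); have bsnd := continuous_borel (@cont_snd X H).
pose good n x := [/\ D x, b n x & forall x', b n x' -> D x' /\ F x' = F x].
pose E n : set (X * H) := [set xy | exists x, [/\ good n x, b n xy.1 & V (F x xy.2)]].
have -> : (fun xy : X * H => if `[< D xy.1 >] then F xy.1 xy.2 else K xy.1 xy.2) @^-1` V =
  (\bigcup_n E n) `|` ((fst @^-1` (~` D)) `&` (fun xy : X * H => K xy.1 xy.2) @^-1` V).
  apply/seteqP; split=> [[x y] /=|[x y] [[n _ [x' [[/= Dx' bx' h] bx Vy]]]|[/= nD Vy]]].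
  - case: asboolP => [Dx Vy|nD Vy]; last by right.
    left; have [n bn bnD] := bb x _ (filterI (open_nbhs_nbhs (conj oD Dx)) (Fc _ Dx)).
    by exists n => //; exists x; split.
  - by have [Dx Fx] := h _ bx; rewrite /= asboolT // Fx.
  - by rewrite /= asboolF.
apply: borelU; last by apply: borelI; [apply: bfst; apply: borelC; exact: borel_open|apply: bK; exact: borel_open].
apply: borel_bigcup => n.
have [[x [Dx bx hx]]|no] := pselect (exists x, good n x); last first.
  rewrite (_ : E n = set0); first exact: borel0.
  by rewrite -subset0 => -[x y] [x' [gx _ _]]; apply: no; exists x'.
have -> : E n = (fst @^-1` b n) `&` (snd @^-1` (F x @^-1` V)).
  apply/seteqP; split=> [[x1 y] [x2 [[/= D2 b2 h2] bx1 Vy]]|[x1 y] [/= bx1 Vy]].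
    by split=> //=; have [_ ->] := h2 _ bx.
  by exists x; split.
apply: borelI; [apply: bfst; exact: borel_open|apply: bsnd; apply: bF => //; exact: borel_open].
Qed.

(** * Michael-type selection, continuous on a conull G_delta set *)

Section selection.
Variables (X Om H : topologicalType) (P : set Om -> R) (psi : Om -> X) (Q : set H -> R).
Variables (A : topologicalZmodType) (d : A -> A -> R).
Hypotheses (hd : complete_metric_for d) (bA : has_base A).
Hypotheses (bX : has_base X) (hX : hausdorff_space X) (lX : locally_compact [set: X]).
Hypotheses (hP : borel_prob P) (hQ : borel_prob Q) (psi_cont : continuous psi).
Variables (L : X -> (H -> A) -> Prop) (Cl : (H -> A) -> Prop) (T : set X) (x0 : X).
Hypotheses (Tx0 : T x0) (Tnull : pnull P (psi @^-1` (~` T))).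
Hypotheses (LCl : forall x F, L x F -> Cl F) (ClB : forall F, Cl F -> borel_measurable F).
Hypotheses (Cl0 : Cl (fun=> 0)).
Hypothesis Cllim : forall F : nat -> H -> A, (forall n, Cl (F n)) -> Cl (fun y => seq_lim (fun n => F n y)).
Hypothesis Lex : forall x, T x -> exists F, L x F.
Hypothesis Llsc : forall x F (eps : R), T x -> L x F -> 0 < eps ->
  \forall x' \near x, T x' -> exists2 F', L x' F' & close d Q eps F F'.
Variable V : nat -> X -> set X.
Hypothesis Vn : forall n x, T x -> nbhs x (V n x).
Hypothesis Lcl : forall x (c : nat -> X) (F : nat -> H -> A),
  (forall n, [/\ T (c n), V n (c n) x & L (c n) (F n)]) ->
  pnull Q [set y | ~ ((fun n => F n y) @ \oo --> seq_lim (fun n => F n y))] ->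
  L x (fun y => seq_lim (fun n => F n y)).

(** Room for the next correction: near [x] the function [F] can be made admissible at a cost below
    2^-n. This is only asked at points of [T], where admissible functions exist. *)
Let good n F x := T x -> exists2 F', L x F' & close d Q (2^-1 ^+ n) F F'.

(** A state consists of an open conull domain, a locally constant map to centres, and a function
    attached to each centre; the selected function at x is the one attached to the centre of x. *)
Let inv n (s : set X * (X -> X) * (X -> H -> A)) := [/\ [/\ open s.1.1, s.1.1 x0 & pnull P (psi @^-1` (~` s.1.1))],
  forall x, s.1.1 x -> [/\ T (s.1.2 x), L (s.1.2 x) (s.2 (s.1.2 x)), V n (s.1.2 x) x &
                          good n (s.2 (s.1.2 x)) x] &
  forall x, s.1.1 x -> \forall x' \near x, s.1.2 x' = s.1.2 x].

Let inv0 : exists s, inv 0 s.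
Proof.
have /choice[Phi PhiP] : forall x, exists F, T x -> L x F.
  move=> x; have [Tx|nT] := pselect (T x); last by exists (fun=> 0) => /nT.
  by have [F LF] := Lex Tx; exists F.
pose N x := V 0 x `&` good 0 (Phi x).
have NT x : T x -> nbhs x (N x).
  move=> Tx; apply: filterI; first exact: Vn.
  exact: (Llsc Tx (PhiP _ Tx) (half_pow_gt0 0)).
have [D [c [oD Dx0 Dn Dc cl]]] := step_selection bX hX lX hP psi_cont Tx0 NT Tnull.
exists (D, c, Phi); split=> // x /Dc[Tc [Vc gc]]; split=> //; exact: PhiP.
Qed.

Let invS n s : inv n s -> exists s', [/\ inv n.+1 s', s'.1.1 `<=` s.1.1 &
  forall x, s'.1.1 x -> close d Q (2^-1 ^+ n) (s.2 (s.1.2 x)) (s'.2 (s'.1.2 x))].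
Proof.
case: s => -[D c] Phi [[/= oD Dx0 Dn] Dc cl].
have /choice[Phi' PhiP] : forall x, exists F, T x -> D x -> L x F /\ close d Q (2^-1 ^+ n) (Phi (c x)) F.
  move=> x; have [[Tx Dx]|nT] := pselect (T x /\ D x); last by exists (fun=> 0) => Tx Dx; case: nT.
  by have [_ _ _ /(_ Tx)[F LF cF]] := Dc _ Dx; exists F.
(* The clause [c x' = c x] keeps each new piece inside an old one, so that the new function is
   compared with the old function of the same piece. *)
pose N x := [set x' | [/\ D x', V n.+1 x x', good n.+1 (Phi' x) x' & c x' = c x]].
have NT x : (T `&` D) x -> nbhs x (N x).
  move=> [Tx Dx]; have [L' _] := PhiP _ Tx Dx.
  have h1 : nbhs x D by exact: open_nbhs_nbhs.
  have h2 := Vn n.+1 Tx; have h3 := Llsc Tx L' (half_pow_gt0 n.+1); have h4 := cl _ Dx.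
  by apply: filterS2 (filterI h1 h2) (filterI h3 h4) => x' [? ?] [? ?].
have TDn : pnull P (psi @^-1` (~` (T `&` D))).
  by rewrite setCI preimage_setU; apply: (pnullU hP).
have [D' [c' [oD' Dx0' Dn' Dc' cl']]] := step_selection bX hX lX hP psi_cont (conj Tx0 Dx0) NT TDn.
exists (D', c', Phi'); split=> //=; last 2 first.
- by move=> x /Dc'[_ []].
- by move=> x /Dc'[[Tc Dcx] [_ _ _ ->]]; have [] := PhiP _ Tc Dcx.
split=> // x /Dc'[[Tc Dcx] [_ ? ? _]]; split=> //.
by have [] := PhiP _ Tc Dcx.
Qed.

(** [L x] is the set of functions admissible at x, [Llsc] its lower semicontinuity and [Lcl] its
    closedness: a limit of functions admissible at centres [c n] with x in [V n (c n)] is admissible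
    at x. [Cl] is the part of admissibility that does not depend on x; it also survives where the
    construction stops. *)
Lemma selection : exists (D : nat -> set X) (F : X -> H -> A),
  [/\ forall n, [/\ open (D n), D n x0 & pnull P (psi @^-1` (~` D n))],
      borel_measurable (fun xy : X * H => F xy.1 xy.2), forall x, Cl (F x),
      forall x, (\bigcap_n D n) x -> L x (F x) &
      forall x (eps : R), (\bigcap_n D n) x -> 0 < eps -> \forall x' \near x, close d Q eps (F x) (F x')].
Proof.
have [s0 is0] := inv0.
have /choice[nx nxP] : forall ns : nat * (set X * (X -> X) * (X -> H -> A)), exists s',
   inv ns.1 ns.2 -> [/\ inv ns.1.+1 s', s'.1.1 `<=` ns.2.1.1 &
     forall x, s'.1.1 x -> close d Q (2^-1 ^+ ns.1) (ns.2.2 (ns.2.1.2 x)) (s'.2 (s'.1.2 x))].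
  move=> [n s]; have [i|ni] := pselect (inv n s); last by exists s => /ni.
  by have [s' ?] := invS i; exists s'.
pose st := fix st n := if n is m.+1 then nx (m, st m) else s0.
have ist n : inv n (st n) by elim: n => //= n ih; case: (nxP (n, st n) ih).
pose D n := (st n).1.1; pose c n := (st n).1.2; pose Phi n := (st n).2.
have DS n : D n.+1 `<=` D n by case: (nxP (n, st n) (ist n)).
have cls n x : D n.+1 x -> close d Q (2^-1 ^+ n) (Phi n (c n x)) (Phi n.+1 (c n.+1 x)).
  by case: (nxP (n, st n) (ist n)) => _ _; exact.
(* Outside [D n] the previous stage is kept. Thus [Gcl] and [rapid_limit] hold at every point,
   including neighbours of a point of the G_delta set that leave some later [D m]. *)
pose G := fix G n x : H -> A := if `[< D n x >] then Phi n (c n x) else if n is m.+1 then G m x else fun=> 0.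
have GD n x : D n x -> G n x = Phi n (c n x) by case: n => [|n] Dx /=; rewrite asboolT.
have GN n x : ~ D n.+1 x -> G n.+1 x = G n x by move=> nD /=; rewrite asboolF.
have LPhi n x : D n x -> [/\ T (c n x), L (c n x) (Phi n (c n x)) & V n (c n x) x].
  by move=> Dx; have [_ /(_ _ Dx)[]] := ist n.
have ClG n x : Cl (G n x).
  elim: n => [|n ih] /=; case: asboolP => // Dx; by have [_ /LCl] := LPhi _ _ Dx.
have Gcl n x : close d Q (2^-1 ^+ n) (G n x) (G n.+1 x).
  have [Dx|nD] := pselect (D n.+1 x); last by rewrite GN //; apply: close_refl => //; exact: half_pow_gt0.
  by rewrite !GD //; [exact: cls|exact: DS].
have bG n : borel_measurable (fun xy : X * H => G n xy.1 xy.2).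
  elim: n => [|n ih].
    have -> : (fun xy : X * H => G 0%N xy.1 xy.2) =
       (fun xy : X * H => if `[< D 0%N xy.1 >] then Phi 0%N (c 0%N xy.1) xy.2 else (fun x _ => 0) xy.1 xy.2).
      by apply/funext => -[x y] /=; case: asboolP.
    apply: (@borel_patch X H A (D 0%N) (fun x => Phi 0%N (c 0%N x)) (fun _ _ => 0)) => //; last exact: borel_cst.
    - by case: (ist 0%N) => -[].
    - by move=> x Dx; apply: ClB; rewrite -GD.
    - by move=> x Dx; have [_ _ /(_ x Dx)] := ist 0%N; apply: filterS => x' h; rewrite /c h.
  have -> : (fun xy : X * H => G n.+1 xy.1 xy.2) =
       (fun xy : X * H => if `[< D n.+1 xy.1 >] then Phi n.+1 (c n.+1 xy.1) xy.2 else G n xy.1 xy.2).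
    by apply/funext => -[x y] /=; case: asboolP.
  apply: (@borel_patch X H A (D n.+1) (fun x => Phi n.+1 (c n.+1 x)) (G n)) => //.
  - by case: (ist n.+1) => -[].
  - by move=> x Dx; apply: ClB; rewrite -GD.
  - by move=> x Dx; have [_ _ /(_ x Dx)] := ist n.+1; apply: filterS => x' h; rewrite /c h.
exists D, (fun x y => seq_lim (fun n => G n x y)); split.
- by move=> n; have [[]] := ist n.
- exact: (borel_seq_lim hd).
- by move=> x; exact: Cllim.
- move=> x Dx; have GE n : G n x = Phi n (c n x) by apply: GD; exact: Dx.
  apply: (@Lcl x (fun n => c n x) (fun n => G n x)).
    by move=> n; have [] := LPhi n x (Dx n I); rewrite GE.
  by have [] := rapid_limit hd hQ (Gcl^~ x).
(* Near x stage n is constant and both limits are within 4 * 2^-n of it, whence [eps / 8]. *)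
- move=> x eps Dx e0; have [|n hn] := @half_pow_lt R (eps / 8); first by rewrite divr_gt0.
  have [[oD _ _] _ /(_ x (Dx n I)) cn] := ist n.
  have Dn : nbhs x (D n) by apply: open_nbhs_nbhs; split=> //; exact: Dx.
  apply: filterS2 Dn cn => x' Dx' cx'.
  have [_ /(_ n) l1] := rapid_limit hd hQ (Gcl^~ x).
  have [_ /(_ n) l2] := rapid_limit hd hQ (Gcl^~ x').
  have GG : G n x' = G n x by rewrite !GD //; [rewrite /c cx'|exact: Dx].
  rewrite GG in l2; apply: close_le (close_trans hd hQ (close_sym hd l1) l2).
  by move: hn; lra.
Qed.

End selection.

(** * Cochains mixed from two functions *)

Section coords.
Variable G : tgroup.

(** Indexing by [nat], with the identity out of range, lets prefixes of powers of different lengths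
    be compared without casts. *)
Definition coord (k : nat) (x : Gpow G k) (l : nat) : G := if insub l is Some i then x i else tone G.

Definition face (m : nat) (j : 'I_m.+1) (X : Gpow G m.+1) : Gpow G m := fun k => X (lift j k).

Definition merge (m : nat) (i : nat) (p : nat -> G) (y : Gpow G m) : Gpow G m :=
  fun l => if (l < i)%N then p l else y l.

Definition ins (m : nat) (i : nat) (a : G) (y : Gpow G m) : Gpow G m.+1 :=
  fun l => if (l < i)%N then coord y l else if (l == i :> nat) then a else coord y l.-1.

Lemma coord_ord k (x : Gpow G k) (l : 'I_k) : coord x l = x l.
Proof. by rewrite /coord valK. Qed.

Lemma coordE k (x : Gpow G k) (l : nat) (lk : (l < k)%N) : coord x l = x (Ordinal lk).
Proof. by rewrite -coord_ord. Qed.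

Lemma coord_face m (j : 'I_m.+1) (X : Gpow G m.+1) (l : nat) : (l < m)%N ->
  coord (face j X) l = coord X (bump j l).
Proof. by move=> lm; rewrite (coordE _ lm) /face -coord_ord. Qed.

Lemma coord_continuous_nat k l : continuous (fun x : Gpow G k => coord x l).
Proof.
rewrite /coord; case: insubP => [i _ _|_]; [exact: coord_continuous|exact: cont_cst].
Qed.

Lemma coord_mul k (x y : Gpow G k) l :
  coord (pow_mul (@tmul G) x y) l = tmul (coord x l) (coord y l).
Proof. by rewrite /coord; case: insubP => [i _ _|_] //; rewrite tmul1. Qed.

(** Omitting one of i+1 frozen variables leaves i frozen ones; so the known function enters the next
    equation only through its slices at prefixes of length i. *)
Lemma face_merge_lt m (j : 'I_m.+1) i (p p' : nat -> G) (y : Gpow G m.+1) : (j < i.+1)%N ->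
  (forall l, (l < i)%N -> (l < m)%N -> p (bump j l) = p' l) ->
  face j (merge i.+1 p y) = merge i p' (face j y).
Proof.
move=> ji pp'; apply/funext => l; rewrite /face /merge /=.
have -> : (bump j l < i.+1)%N = (l < i)%N by rewrite /bump; case: leqP; lia.
by case: ifP => // li; rewrite pp'.
Qed.

Lemma face_merge_ge m (j : 'I_m.+1) i (p : nat -> G) (y : Gpow G m.+1) : (i <= j)%N ->
  face j (merge i p y) = merge i p (face j y).
Proof.
move=> ij; apply/funext => l; rewrite /face /merge /=.
have -> : (bump j l < i)%N = (l < i)%N by rewrite /bump; case: leqP; lia.
by case: ifP => // li; rewrite /bump leqNgt (leq_trans li ij) /= add0n.
Qed.

Lemma face_face m (j : 'I_m.+2) (l : 'I_m.+1) (j' : 'I_m.+1) (l' : 'I_m.+2) (X : Gpow G m.+2) :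
  (l < j)%N -> j' = j.-1 :> nat -> l' = l :> nat -> face l (face j X) = face j' (face l' X).
Proof.
move=> lj j'E l'E; apply/funext => k; rewrite /face; congr X; apply: val_inj => /=.
by rewrite j'E l'E /bump; lia.
Qed.

Lemma face_ins_eq m (j : 'I_m.+1) a (y : Gpow G m) : face j (ins j a y) = y.
Proof.
apply/funext => l; rewrite /face /ins /= -[RHS]coord_ord /bump.
by case: (leqP j l) => jl /=; rewrite ?add1n ?add0n ?jl // ltnNge leqW //= gtn_eqF ?ltnS.
Qed.

Lemma face_ins_gt m (j : 'I_m.+2) (j' : 'I_m.+1) i a (y : Gpow G m.+1) :
  (i < j)%N -> j' = j.-1 :> nat -> face j (ins i a y) = ins i a (face j' y).
Proof.
move=> ij j'E; apply/funext => l; rewrite /face /ins /=.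
have lm := ltn_ord l.
have -> : (bump j l < i)%N = (l < i)%N by rewrite /bump; case: leqP; lia.
have -> : (bump j l == i) = (l == i :> nat) by rewrite /bump; case: leqP; lia.
case: ifP => [li|/negbT li].
  rewrite coord_face; last by have := ltn_ord j; lia.
  by congr (coord y _); rewrite /bump j'E; lia.
case: ifP => // /negbT li'.
rewrite coord_face; last by lia.
by congr (coord y _); rewrite /bump j'E; lia.
Qed.

End coords.

(** * The mixed differential *)

Section differential.
Variables (G : tgroup) (A : zmodType).

(* The homogeneous differential with [a] on the faces omitting one of the first [i] variables
   and [b] on the others. *)
Definition mixd (m i : nat) (a b : Gpow G m -> A) (X : Gpow G m.+1) : A :=
  \sum_(j < m.+1) ((if (j < i)%N then a (face j X) else b (face j X)) *~ ((-1) ^+ (m - j))).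

Lemma dcobE m i (a : Gpow G m -> A) X : dcob a X = mixd i a a X.
Proof. by apply: eq_bigr => j _; case: ifP. Qed.

Lemma mixd_dcobT m (a b : Gpow G m -> A) X : mixd m.+1 a b X = dcob a X.
Proof. by apply: eq_bigr => j _; rewrite ltn_ord. Qed.

Lemma mulrz_sum (I : finType) (F : I -> A) (k : int) : (\sum_l F l) *~ k = \sum_l (F l *~ k).
Proof. by apply: (big_morph (fun z : A => z *~ k)) => [x y|]; rewrite ?mulrzDl ?mul0rz. Qed.

(** A term with two variables omitted carries [a], [b] or [c] according to whether two, one or none
    of them are among the first i+1. This does not depend on the order of omission, so the terms
    cancel in pairs as in the usual proof that d d = 0. *)
Lemma mixd_mixd m i (a b c : Gpow G m -> A) X : mixd i.+1 (mixd i a b) (mixd i.+1 b c) X = 0.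
Proof.
pose t (jl : 'I_m.+2 * 'I_m.+1) : A :=
  (if (jl.1 < i.+1)%N then (if (jl.2 < i)%N then a else b) else (if (jl.2 < i.+1)%N then b else c))
    (face jl.2 (face jl.1 X)) *~ ((-1) ^+ (m - jl.2)) *~ ((-1) ^+ (m.+1 - jl.1)).
have -> : mixd i.+1 (mixd i a b) (mixd i.+1 b c) X = \sum_jl t jl.
  transitivity (\sum_(j < m.+2) \sum_(l < m.+1) t (j, l)); last by rewrite pair_bigA; apply: eq_bigr => -[].
  apply: eq_bigr => j _; rewrite /mixd /t /=; case: ifP => _; rewrite mulrz_sum; apply: eq_bigr => l _;
    by case: ifP.
rewrite (bigID (fun jl : 'I_m.+2 * 'I_m.+1 => (jl.2 < jl.1)%N)) /=.
(* Omitting j and then l < j is omitting l and then j - 1; [h] is this exchange and [h'] its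
   inverse. *)
pose h (jl : 'I_m.+2 * 'I_m.+1) : 'I_m.+2 * 'I_m.+1 := (widen_ord (leqnSn _) jl.2, inord jl.1.-1).
pose h' (jl : 'I_m.+2 * 'I_m.+1) : 'I_m.+2 * 'I_m.+1 := (inord jl.2.+1, inord jl.1).
have hh' (jl : 'I_m.+2 * 'I_m.+1) : ~~ (jl.2 < jl.1)%N -> h (h' jl) = jl.
  case: jl => j l /=; rewrite -leqNgt => jl; have lm := ltn_ord l.
  congr pair; apply: val_inj; rewrite /= !inordK //; by lia.
rewrite [X in _ + X](reindex_onto h h') //=.
rewrite [X in _ + X](eq_bigl (fun jl : 'I_m.+2 * 'I_m.+1 => (jl.2 < jl.1)%N)); last first.
  move=> [j l] /=; have [lm jm] := (ltn_ord l, ltn_ord j).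
  have j1 : (j.-1 < m.+1)%N by lia.
  have j2 : (j.-1.+1 < m.+2)%N by lia.
  have l2 : (l < m.+1)%N by lia.
  rewrite /h' /h /= inordK //; apply/idP/idP => [/andP[jl /eqP[]]|jl].
    by move=> /(congr1 val) /=; rewrite inordK // => ? _; lia.
  apply/andP; split; first by lia.
  apply/eqP; congr pair; apply: val_inj; rewrite /= inordK //; lia.
rewrite -big_split /= big1 // => -[j l] /= lj.
have [lm jm] := (ltn_ord l, ltn_ord j).
have j1 : (j.-1 < m.+1)%N by lia.
rewrite /t /= inordK //.
rewrite (@face_face _ _ j l (inord j.-1) (widen_ord (leqnSn _) l)) //; last by rewrite inordK.
have -> : (if (l < i.+1)%N then if (j.-1 < i)%N then a else b else if (j.-1 < i.+1)%N then b else c) =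
          (if (j < i.+1)%N then if (l < i)%N then a else b else if (l < i.+1)%N then b else c).
  by do 4?case: ifP => //; lia.
set z := (X in X *~ _ *~ _ + _).
rewrite -!mulrzA -mulrzDr -!exprD.
have -> : (m.+1 - l = (m - l).+1)%N by lia.
have -> : (m - j.-1 = m.+1 - j)%N by lia.
by rewrite addnC addnS exprS mulN1r addrN mulr0z.
Qed.

(* Inserting a constant at place [i] is a contraction of the part of the differential
   that moves the variables of index at least [i]. *)
Lemma mixd_ins m i (c : Gpow G m.+1 -> A) (k : G) (Y : Gpow G m.+1) : (i <= m.+1)%N ->
  mixd i (fun=> 0) c (ins i k Y) =
  c Y *~ ((-1) ^+ (m.+1 - i)) + mixd i (fun=> 0) (fun y => c (ins i k y)) Y.
Proof.
move=> im; rewrite /mixd; have im' : (i < m.+2)%N by [].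
rewrite (bigD1_ord (Ordinal im')) //= ltnn (@face_ins_eq G m.+1 (Ordinal im')); congr (_ + _).
apply: eq_bigr => l _; have [il|li] := leqP i l.
  rewrite ifF; last by rewrite /= /bump il; lia.
  rewrite (@face_ins_gt G m _ l) /=; [|by rewrite /bump il; lia|by rewrite /bump il; lia].
  by congr (_ *~ (_ ^+ _)); rewrite /bump il; lia.
by rewrite mul0rz ifT ?mul0rz // /bump; lia.
Qed.

Lemma mixdB m i (a b a' b' : Gpow G m -> A) X :
  mixd i a b X - mixd i a' b' X = mixd i (fun y => a y - a' y) (fun y => b y - b' y) X.
Proof.
by rewrite /mixd -sumrB; apply: eq_bigr => j _; case: ifP => _; rewrite mulrzBl.
Qed.

Lemma mixdZ m i (b : Gpow G m -> A) k X :
  mixd i (fun=> 0) (fun y => b y *~ k) X = mixd i (fun=> 0) b X *~ k.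
Proof.
rewrite /mixd mulrz_sum; apply: eq_bigr => j _.
by case: ifP => _; rewrite ?mul0rz // -!mulrzA mulrC.
Qed.

Lemma eq_mixd m i (a b a' b' : Gpow G m -> A) X X' :
  (forall j : 'I_m.+1, (j < i)%N -> a (face j X) = a' (face j X')) ->
  (forall j : 'I_m.+1, (i <= j)%N -> b (face j X) = b' (face j X')) -> mixd i a b X = mixd i a' b' X'.
Proof.
by move=> ha hb; apply: eq_bigr => j _; case: ltnP => ji; rewrite ?ha ?hb.
Qed.

Lemma mixdD m i (a b a' b' : Gpow G m -> A) X :
  mixd i a b X + mixd i a' b' X = mixd i (fun y => a y + a' y) (fun y => b y + b' y) X.
Proof.
by rewrite /mixd -big_split; apply: eq_bigr => j _; case: ifP => _; rewrite mulrzDl.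
Qed.

End differential.

(** * Surjective homomorphisms between powers *)

Section thoms.
Variable G : tgroup.

Lemma thom_reindex k m (s : 'I_m -> 'I_k) : injective s ->
  @thom (tpow G k) (tpow G m) (fun x i => x (s i)).
Proof.
move=> si; split=> //.
  by apply: pow_continuous => i; exact: coord_continuous.
move=> y; exists (fun i => if [pick j | s j == i] is Some j then y j else tone G).
apply/funext => j; case: pickP => [j' /eqP/si -> //|/(_ j)]; by rewrite eqxx.
Qed.

Lemma thom_face m (j : 'I_m.+1) : @thom (tpow G m.+1) (tpow G m) (face j).
Proof. exact: (thom_reindex (@lift_inj _ j)). Qed.

Lemma thom_coord0 m : @thom (tpow G m.+1) G (fun x => x ord0).
Proof.
by split=> // [|y]; [exact: coord_continuous|exists (fun=> y)].
Qed.

Lemma ins_continuous m i : continuous (fun ay : G * Gpow G m => ins i ay.1 ay.2).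
Proof.
apply: pow_continuous => l; rewrite /ins.
case: (l < i)%N; first exact: (cont_comp (@cont_snd G (Gpow G m)) (@coord_continuous_nat G m _)).
case: (nat_of_ord l == i); first exact: (@cont_fst G (Gpow G m)).
exact: (cont_comp (@cont_snd G (Gpow G m)) (@coord_continuous_nat G m _)).
Qed.

Lemma ins_mul m i a b (y z : Gpow G m) :
  ins i (tmul a b) (pow_mul (@tmul G) y z) = pow_mul (@tmul G) (ins i a y) (ins i b z).
Proof.
by apply/funext => l; rewrite /ins /pow_mul -!/(pow_mul _ _ _) !coord_mul; do 2!case: ifP => //.
Qed.

Lemma thom_ins m i : (i <= m)%N ->
  @thom (tprod G (tpow G m)) (tpow G m.+1) (fun ay => ins i ay.1 ay.2).
Proof.
move=> im; split; [exact: ins_continuous|by move=> [a x] [b y]; exact: ins_mul|].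
move=> X; exists (X (Ordinal (im : (i < m.+1)%N)), face (Ordinal (im : (i < m.+1)%N)) X).
apply/funext => l; have lm := ltn_ord l; rewrite /ins /=; case: ltnP => li.
  rewrite coord_face; last by lia.
  by rewrite -coord_ord; congr (coord X _); rewrite /bump /=; lia.
case: eqP => [e|ne]; first by congr X; apply: val_inj.
rewrite coord_face; last by lia.
by rewrite -coord_ord; congr (coord X _); rewrite /bump /=; lia.
Qed.

Lemma merge_continuous k m i : continuous (fun xy : Gpow G k * Gpow G m => merge i (coord xy.1) xy.2).
Proof.
apply: pow_continuous => l; rewrite /merge.
case: (l < i)%N; first exact: (cont_comp (@cont_fst (Gpow G k) (Gpow G m)) (@coord_continuous_nat G k _)).
exact: (cont_comp (@cont_snd (Gpow G k) (Gpow G m)) (@coord_continuous G m _)).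
Qed.

Lemma thom_merge k m i : (i <= k)%N ->
  @thom (tprod (tpow G k) (tpow G m)) (tpow G m) (fun xy => merge i (coord xy.1) xy.2).
Proof.
move=> ik; split; first exact: merge_continuous.
  move=> [x x'] [y y']; apply/funext => l /=; rewrite /merge /= /pow_mul -/(pow_mul _ _ _) coord_mul.
  by case: ifP.
move=> X; exists (fun l : 'I_k => coord X l, X); apply/funext => l; rewrite /merge /=.
case: ifP => // li; have lk : (l < k)%N by exact: leq_trans li ik.
by rewrite (coordE _ lk) -coord_ord.
Qed.

Lemma qinv_pow (P1 : set G -> R) : qinv P1 -> forall m, exists P : set (tpow G m) -> R, qinv P.
Proof.
move=> hP1; elim=> [|m [P hP]].
  exists (fun B => P1 ((fun=> tone (tpow G 0)) @^-1` B)); apply: qinv_push => //; split.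
  - exact: cont_cst.
  - by move=> x y; apply/funext => -[].
  - by move=> y; exists (tone G); apply/funext => -[].
have [PQ [hPQ _ _ _ _]] := qinv_prod hP1 hP.
by eexists; exact: (qinv_push (@thom_ins m 0 isT) hPQ).
Qed.

Lemma pnull_swap (H K : tgroup) (P : set H -> R) (Q : set K -> R) (N : set (H * K)) :
  qinv P -> qinv Q -> borel_sets N -> pnull P [set x | ~ pnull Q [set y | N (x, y)]] ->
  pnull Q [set y | ~ pnull P [set x | N (x, y)]].
Proof.
move=> hP hQ bN h; have [PQ [hPQ _ nPQ _ _]] := qinv_prod hP hQ.
have [QP [hQP nQP _ _ _]] := qinv_prod hQ hP.
have sw : @thom (tprod K H) (tprod H K) (fun yx => (yx.2, yx.1)).
  split=> // [|[x y]]; last by exists (y, x).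
  exact: (cont_pair (@cont_snd K H) (@cont_fst K H)).
exact: (nQP _ (thom_null sw hQP hPQ (nPQ N bN h))).
Qed.

(** For fixed x the set of bad [a] is a translate of a null set, so Fubini gives an [a] that is good
    for almost every x. Unlike a constant, x_0 a moves with x under the diagonal action, which
    preserves strict equivariance. *)
Lemma twist_null m (P1 : set G -> R) (P : set (tpow G m.+1) -> R) (N : set (G * tpow G m.+1)) :
  qinv P1 -> qinv P -> borel_sets N -> pnull P1 [set a | ~ pnull P [set x | N (a, x)]] ->
  exists a, pnull P [set x | N (tmul (x ord0) a, x)].
Proof.
move=> hP1 hP bN h.
have f_cont : continuous (fun ax : G * tpow G m.+1 => (tmul (ax.2 ord0) ax.1, ax.2)).
  apply: cont_pair; last exact: cont_snd.
  apply: (cont_comp2 (h := @tmul G) _ (@cont_fst G (tpow G m.+1)) (@tmul_continuous G)).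
  exact: (cont_comp (@cont_snd G (tpow G m.+1)) (@coord_continuous G m.+1 ord0)).
pose N' : set (G * tpow G m.+1) := (fun ax : G * tpow G m.+1 => (tmul (ax.2 ord0) ax.1, ax.2)) @^-1` N.
have bN' : borel_sets N' by exact: (continuous_borel f_cont).
have h' : pnull P [set x | ~ pnull P1 [set a | N' (a, x)]].
  apply: pnullS (pnull_swap hP1 hP bN h) => x /= nx nn; apply: nx.
  exact: (qinv_translate (x ord0) hP1 nn).
pose N2 : set (tpow G m.+1 * G) := (fun xa => (xa.2, xa.1)) @^-1` N'.
have bN2 : borel_sets N2.
  by apply: (continuous_borel (f := fun xa : tpow G m.+1 * G => (xa.2, xa.1))) bN'; exact: (cont_pair (@cont_snd _ _) (@cont_fst _ _)).
have [p1 _] := hP1.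
have [a /contrapT ha] := pnull_not_all p1 (pnull_swap hP hP1 bN2 h').
by exists a.
Qed.

End thoms.

(** * Gaining continuity in one more variable *)

Section merge_lemmas.
Variable G : tgroup.

Lemma coord_merge m i (p : nat -> G) (y : Gpow G m) l : (l < m)%N ->
  coord (merge i p y) l = if (l < i)%N then p l else coord y l.
Proof. by move=> lm; rewrite !(coordE _ lm) /merge /=. Qed.

Lemma merge_merge m i (p q : nat -> G) (y : Gpow G m) : merge i p (merge i q y) = merge i p y.
Proof. by apply/funext => l; rewrite /merge; case: ifP => // ->. Qed.

Lemma ins_merge m i k (p : nat -> G) (y : Gpow G m) : (i <= m)%N ->
  ins i k (merge i p y) = merge i p (ins i k y).
Proof.
move=> im; apply/funext => l; have lm := ltn_ord l; rewrite /ins /merge.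
case: ifP => [li|/negbT li]; first by rewrite coord_merge ?li //; lia.
case: ifP => // /negbT li'; rewrite coord_merge; last by lia.
by rewrite ifF //; lia.
Qed.

Lemma merge_slice_continuous m i (p : nat -> G) : continuous (fun y : Gpow G m => merge i p y).
Proof.
apply: pow_continuous => l; rewrite /merge; case: (l < i)%N; first exact: cont_cst.
exact: coord_continuous.
Qed.

Lemma face_continuous m (j : 'I_m.+1) : continuous (@face G m j).
Proof. by have [] := thom_face G j. Qed.

End merge_lemmas.

Lemma mulrz_signK (A : zmodType) (a : A) k : a *~ (-1) ^+ k *~ (-1) ^+ k = a.
Proof. by rewrite -mulrzA -exprMn mulrNN mulr1 expr1n mulr1z. Qed.

Lemma borel_mixd (G : tgroup) (A : topologicalZmodType) m i (a b : Gpow G m -> A) : has_base A ->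
  borel_measurable a -> borel_measurable b -> borel_measurable (mixd i a b).
Proof.
move=> bA ba bb; apply: borel_sum => // j; apply: borel_sign.
have bf := continuous_borel (@face_continuous G m j).
by case: (j < i)%N; [exact: (borel_comp ba bf)|exact: (borel_comp bb bf)].
Qed.

(** * Primitives obtained by inserting a generic constant *)

Section lift.
Variables (G : tgroup) (A : topologicalZmodType) (d : A -> A -> R).
Hypotheses (hd : complete_metric_for d) (bA : has_base A).
Variables (P1 : set G -> R) (P : forall m, set (tpow G m) -> R).
Hypotheses (hP1 : qinv P1) (hP : forall m, qinv (@P m)).

(** A function of the variables of index at least i, kept on the full power so that all levels share
    one type. *)
Definition indep m i (c : Gpow G m -> A) : Prop := forall p y, c (merge i p y) = c y.

Lemma ins_null m i (N : set (Gpow G m.+1)) : (i <= m)%N -> pnull (@P m.+1) N ->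
  pnull P1 [set k | ~ pnull (@P m) [set Y | N (ins i k Y)]].
Proof.
move=> im nN; have [PQ [hPQ h _ _ _]] := qinv_prod hP1 (hP m).
exact: (h _ (thom_null (thom_ins G im) hPQ (hP m.+1) nN)).
Qed.

(** [mixd_ins] expresses [c] through the differential of its slice; the extra 1 in the exponent is
    the minus sign from moving that term to the other side. *)
Lemma lift_eq m i (c : Gpow G m.+1 -> A) k Y : (i <= m.+1)%N -> mixd i (fun=> 0) c (ins i k Y) = 0 ->
  mixd i (fun=> 0) (fun y => c (ins i k y) *~ (-1) ^+ (m.+1 - i).+1) Y = c Y.
Proof.
move=> im; rewrite mixd_ins // mixdZ => /eqP; rewrite addrC addr_eq0 => /eqP ->.
by rewrite exprS mulN1r mulrNz mulNrz opprK mulrz_signK.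
Qed.

Lemma lift_cocycle m i (c : Gpow G m.+1 -> A) : (i <= m)%N -> borel_measurable c -> indep i c ->
  pnull (@P m.+2) [set V | mixd i (fun=> 0) c V <> 0] ->
  exists2 F : Gpow G m -> A, borel_measurable F /\ indep i F &
    pnull (@P m.+1) [set Y | mixd i (fun=> 0) F Y <> c Y].
Proof.
move=> im bc ic nc; have [p1 _] := hP1.
have [k /contrapT kP] := pnull_not_all p1 (ins_null (leqW im) nc).
exists (fun y => c (ins i k y) *~ (-1) ^+ (m.+1 - i).+1).
  split=> [|p y]; last by rewrite ins_merge // ic.
  apply: borel_sign => //; apply: (borel_comp bc); apply: continuous_borel.
  exact: (cont_comp2 (h := @ins G m i) (@cont_cst _ _ k) (@cont_id _) (@ins_continuous G m i)).
apply: pnullS kP => Y /= h; apply: contra_not h; exact: lift_eq (leqW im).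
Qed.

(** The inserted constant is now also chosen where the slice of [c] is small. This quantitative form
    yields the lower semicontinuity required by [selection]. *)
Lemma lift_cocycle_small m i (eps : R) : (i <= m)%N -> 0 < eps -> exists2 delta : R, 0 < delta &
  forall c : Gpow G m.+1 -> A, borel_measurable c -> indep i c ->
  pnull (@P m.+2) [set V | mixd i (fun=> 0) c V <> 0] -> small d (@P m.+1) delta c ->
  exists F : Gpow G m -> A, [/\ borel_measurable F, indep i F, small d (@P m) eps F &
    pnull (@P m.+1) [set Y | mixd i (fun=> 0) F Y <> c Y]].
Proof.
move=> im e0; have [d1 d10 h1] := small_sign hd e0.
have [d2 d20 h2] := small_slice d (thom_ins G im) hP1 (hP m) (hP m.+1) d10.
exists d2 => // c bc ic nc sc.
have [k /contrapT kP sk] := h2 _ _ sc (ins_null (leqW im) nc).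
exists (fun y => c (ins i k y) *~ (-1) ^+ (m.+1 - i).+1); split.
- apply: borel_sign => //; apply: (borel_comp bc); apply: continuous_borel.
  exact: (cont_comp2 (h := @ins G m i) (@cont_cst _ _ k) (@cont_id _) (@ins_continuous G m i)).
- by move=> p y; rewrite ins_merge // ic.
- exact: h1.
- apply: pnullS kP => Y /= h; apply: contra_not h; exact: lift_eq (leqW im).
Qed.

Section prefix.
Variables (n i : nat) (U' U : Gpow G n -> A) (S : set (Gpow G n)).
Hypotheses (lt_in : (i < n)%N) (bU : borel_measurable U).
Hypothesis Scont : forall x, S x -> forall eps : R, 0 < eps -> \forall x' \near x,
  small d (@P n) eps (fun y => U (merge i (coord x') y) - U (merge i (coord x) y)).
Hypothesis Scoc : forall x, S x -> pnull (@P n.+1) [set Y | mixd i U' U (merge i (coord x) Y) <> 0].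

(* The right-hand side of the equation [mixd i.+1 (fun=> 0) F = defect x] to be solved
   for the next function [F], with the prefix [x] frozen. *)
Definition defect (x Y : Gpow G n.+1) : A := - mixd i.+1 U (fun=> 0) (merge i.+1 (coord x) Y).

(** [defect] evaluates [U] at the prefixes obtained from x by omitting one of its first i+1
    coordinates; all of them have to be good. *)
Definition prefix_ok (x : Gpow G n.+1) : Prop := forall j : 'I_n.+1, (j < i.+1)%N -> S (face j x).

(** [mixd_mixd] with third function 0: the faces of index at most i contribute D_i(U', U) on good
    slices, which vanishes a.e., and what remains is the differential of [defect x] up to sign. *)
Lemma defect_cocycle x : prefix_ok x -> pnull (@P n.+2) [set V | mixd i.+1 (fun=> 0) (defect x) V <> 0].
Proof.
move=> Tx; have [p2 _] := hP n.+2.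
apply: (@pnullS _ _ _ [set V | exists j : 'I_n.+2, (j < i.+1)%N /\
    mixd i U' U (face j (merge i.+1 (coord x) V)) <> 0]); last first.
  apply: (pnull_big p2) => j; have [ji|ji] := ltnP j i.+1; last first.
    by apply: pnullS (pnull_set0 p2) => V [].
  have jn : (j < n.+1)%N by lia.
  have := thom_null (thom_face G j) (hP n.+2) (hP n.+1) (Scoc (Tx (Ordinal jn) ji)).
  apply: pnullS => V [_] /=; rewrite (@face_merge_lt _ _ _ _ _ (coord (face (Ordinal jn) x))) //.
  by move=> l li _; rewrite coord_face //; lia.
move=> V /= h; apply: contrapT => /forallNP nj; apply: h.
have := mixd_mixd i U' U (fun=> 0) (merge i.+1 (coord x) V).
rewrite (@eq_mixd _ _ _ _ _ _ (fun=> 0) (fun Y => defect x Y *~ (-1)) _ V).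
- by rewrite mixdZ mulrN1z => /eqP; rewrite oppr_eq0 => /eqP.
- by move=> j ji; apply: contrapT => h; apply: (nj j).
- by move=> j ij; rewrite face_merge_ge // /defect mulrN1z opprK.
Qed.

Lemma defect_indep x : indep i.+1 (defect x).
Proof. by move=> p Y; rewrite /defect merge_merge. Qed.

Lemma borel_defect x : borel_measurable (defect x).
Proof.
apply: borel_opp => //; apply: (borel_comp (g := mixd i.+1 U (fun=> 0))).
  by apply: borel_mixd => //; exact: borel_cst.
exact: (continuous_borel (@merge_slice_continuous G n.+1 i.+1 (coord x))).
Qed.

Lemma defectB x x' Y : defect x' Y - defect x Y = \sum_(j < n.+1)
  (if (j < i.+1)%N then U (merge i (coord (face j x')) (face j Y)) - U (merge i (coord (face j x)) (face j Y))
   else 0) *~ (-1) ^+ (n - j).+1.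
Proof.
rewrite /defect opprK addrC /mixd -sumrB; apply: eq_bigr => j _.
rewrite -mulrzBl exprS mulN1r mulrNz -mulNrz; congr (_ *~ _); case: ifP => ji; last by rewrite subrr oppr0.
have e z : face j (merge i.+1 (coord z) Y) = merge i (coord (face j z)) (face j Y).
  by apply: face_merge_lt => // l li ln; rewrite coord_face.
by rewrite !e opprB.
Qed.

Lemma defect_cont x (eps : R) : prefix_ok x -> 0 < eps ->
  \forall x' \near x, small d (@P n.+1) eps (fun Y => defect x' Y - defect x Y).
Proof.
move=> Tx e0; have [p2 _] := hP n.+1.
have [d1 d10 h1] := small_sum hd n.+1 e0; have [d2 d20 h2] := small_sign hd d10.
have : \forall x' \near x, forall j : 'I_n.+1, small d (@P n.+1) d2 (fun Y =>
  if (j < i.+1)%N then U (merge i (coord (face j x')) (face j Y)) - U (merge i (coord (face j x)) (face j Y))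
   else 0).
  apply: (@filter_forall _ _ (fun (j : 'I_n.+1) x' => small d (@P n.+1) d2 (fun Y =>
  if (j < i.+1)%N then U (merge i (coord (face j x')) (face j Y)) - U (merge i (coord (face j x)) (face j Y))
   else 0)) (nbhs x)) => j.
  have [ji|ji] := ltnP j i.+1; last by apply: nearW => x'; exact: small_zero.
  have [d3 d30 h3] := small_pull d (thom_face G j) (hP n.+1) (hP n) d20.
  have h4 : nbhs x (face j @^-1` [set x' | small d (@P n) d3
      (fun y => U (merge i (coord x') y) - U (merge i (coord (face j x)) y))]).
    exact: (@face_continuous G n j x _ (Scont (Tx _ ji) d30)).
  by apply: filterS h4 => x' /h3.
apply: filterS => x' h.
apply: small_ext (fun Y => esym (defectB x x' Y)) _.
by apply: h1 => // j; apply: h2.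
Qed.

End prefix.
End lift.

Lemma mixd0B (G : tgroup) (A : zmodType) m i (b b' : Gpow G m -> A) X :
  mixd i (fun=> 0) b X - mixd i (fun=> 0) b' X = mixd i (fun=> 0) (fun y => b y - b' y) X.
Proof. by rewrite mixdB; apply: eq_mixd => // j _; rewrite subr0. Qed.

Lemma mixd0D (G : tgroup) (A : zmodType) m i (b b' : Gpow G m -> A) X :
  mixd i (fun=> 0) b X + mixd i (fun=> 0) b' X = mixd i (fun=> 0) (fun y => b y + b' y) X.
Proof. by rewrite mixdD; apply: eq_mixd => // j _; rewrite addr0. Qed.

(** * Passing to the limit in the equation for a primitive *)

Section limits.
Variable A : topologicalZmodType.

Lemma cvg_addz (u v : nat -> A) (a b : A) : u @ \oo --> a -> v @ \oo --> b ->
  (fun k => u k + v k) @ \oo --> (a + b : A).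
Proof.
move=> ua vb; apply: (@cvg_comp _ _ _ (fun k => (u k, v k)) (fun ab : A * A => ab.1 + ab.2) _ _ _ _
  (@add_continuous A (a, b))).
exact: cvg_pair.
Qed.

Lemma cvg_signz (u : nat -> A) (a : A) k : u @ \oo --> a ->
  (fun j => u j *~ (-1) ^+ k) @ \oo --> (a *~ (-1) ^+ k : A).
Proof.
move=> ua; have -> : (fun j => u j *~ (-1) ^+ k) = (if odd k then (fun j => - u j) else u).
  by apply/funext => j; rewrite mul_sign; case: ifP.
rewrite mul_sign; case: ifP => // _.
exact: (@cvg_comp _ _ _ u (fun a : A => - a) _ _ _ ua (@opp_continuous A a)).
Qed.

Lemma cvg_sumz n (u : 'I_n -> nat -> A) (a : 'I_n -> A) : (forall j, u j @ \oo --> a j) ->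
  (fun k => \sum_j u j k) @ \oo --> (\sum_j a j : A).
Proof.
elim: n u a => [|n ih] u a ua.
  have -> : (fun k => \sum_j u j k) = (fun=> 0) by apply/funext => k; rewrite big_ord0.
  by rewrite big_ord0; exact: cvg_cst.
have -> : (fun k => \sum_j u j k) = (fun k => u ord0 k + \sum_j u (lift ord0 j) k).
  by apply/funext => k; rewrite big_ord_recl.
by rewrite big_ord_recl; apply: cvg_addz => //; apply: ih.
Qed.

Lemma small_cvg0 (d : A -> A -> R) (T : topologicalType) (P : set T -> R) (c : nat -> T -> A) :
  complete_metric_for d -> borel_prob P -> (forall k, small d P (2^-1 ^+ k) (c k)) ->
  pnull P [set y | ~ ((fun k => c k y) @ \oo --> (0 : A))].
Proof.
move=> hd hP /choice[B BP].
have bB n : borel_sets (B n) by case: (BP n).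
pose U n := \bigcup_k B (n + k)%N.
have bU n : borel_sets (U n) by apply: borel_bigcup.
have PU n : P (U n) <= 2 * 2^-1 ^+ n.
  apply: (prob_bigcup_geom hP) => // k; have [_ /ltW h _] := BP (n + k)%N.
  by apply: le_trans h _; rewrite exprD exprVn [X in _ * X]exprVn.
exists (\bigcap_n U n); split; first exact: borel_bigcap.
  apply/eqP; rewrite eq_le (prob_ge0 hP) ?andbT; last exact: borel_bigcap.
  apply/ler_addgt0Pr => e e0; rewrite add0r.
  have [|k hk] := @half_pow_lt R (e / 2); first by rewrite divr_gt0.
  apply: (@le_trans _ _ (P (U k))).
    by apply: (le_prob hP) => //; [exact: borel_bigcap|move=> x; apply].
  by have := PU k; move: hk; lra.
move=> y /= nc n _; apply: contrapT => nU; apply: nc.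
apply/(cvg_dist hd) => eps e0; have [k hk] := @half_pow_lt R eps e0.
exists (n + k)%N => m hm; have [_ _ /(_ y) h] := BP m.
have {h} : d 0 (c m y) < 2^-1 ^+ m.
  by apply: h => Bm; apply: nU; exists (m - n)%N => //; rewrite subnKC //; lia.
move=> h; apply: lt_le_trans h _; apply: le_trans (ltW hk).
have -> : m = (k + (m - k))%N by lia.
by rewrite exprD ler_piMr ?exprn_ge0 ?invr_ge0 // exprn_ile1 ?invr_ge0 // invf_le1 // ler1n.
Qed.

End limits.

Section lift_limit.
Variables (G : tgroup) (A : topologicalZmodType) (d : A -> A -> R).
Hypotheses (hd : complete_metric_for d) (bA : has_base A).
Variable P : forall m, set (tpow G m) -> R.
Hypothesis hP : forall m, qinv (@P m).

(** The closedness needed by [selection]: summable errors make the right-hand sides converge a.e.,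
    and the differential is a finite signed sum of values at faces. *)
Lemma lift_limit m i (F : nat -> Gpow G m -> A) (c : nat -> Gpow G m.+1 -> A) (c0 : Gpow G m.+1 -> A) :
  pnull (@P m) [set y | ~ ((fun k => F k y) @ \oo --> seq_lim (fun k => F k y))] ->
  (forall k, pnull (@P m.+1) [set Y | mixd i (fun=> 0) (F k) Y <> c k Y]) ->
  (forall k, small d (@P m.+1) (2^-1 ^+ k) (fun Y => c0 Y - c k Y)) ->
  pnull (@P m.+1) [set Y | mixd i (fun=> 0) (fun y => seq_lim (fun k => F k y)) Y <> c0 Y].
Proof.
move=> nF nc sc; have [p1 _] := hP m.+1.
have n1 := pnull_big p1 (fun j : 'I_m.+1 => thom_null (thom_face G j) (hP m.+1) (hP m) nF).
have n2 := pnull_bigcup p1 nc.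
have n3 := small_cvg0 hd p1 sc.
apply: pnullS (pnullU p1 n1 (pnullU p1 n2 n3)) => Y /= h.
apply: contrapT => /not_orP[/forallNP h1 /not_orP[h2 /contrapT h3]]; apply: h.
apply: (@cvg_dist_unique A d hd (fun k => mixd i (fun=> 0) (F k) Y)).
  apply: (@cvg_sumz A m.+1 (fun j k => (if (j < i)%N then 0 else F k (face j Y)) *~ (-1) ^+ (m - j))) => j.
  apply: cvg_signz; case: (j < i)%N; first exact: cvg_cst.
  exact: contrapT (h1 j).
have e k : mixd i (fun=> 0) (F k) Y = c0 Y - (c0 Y - c k Y).
  by rewrite subKr; apply: contrapT => hk; apply: h2; exists k.
have -> : (fun k => mixd i (fun=> 0) (F k) Y) = (fun k => c0 Y + (c0 Y - c k Y) *~ (-1) ^+ 1).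
  by apply/funext => k; rewrite e mul_sign.
suff : (fun k => c0 Y + (c0 Y - c k Y) *~ (-1) ^+ 1) @ \oo --> (c0 Y + 0 *~ (-1) ^+ 1 : A).
  by rewrite mul0rz addr0.
by apply: cvg_addz; [exact: cvg_cst|exact: cvg_signz].
Qed.

End lift_limit.

(** * From level i to level i+1 *)

Section step.
Variables (G : tgroup) (A : topologicalZmodType) (d : A -> A -> R) (act : G -> A -> A).
Hypotheses (hd : complete_metric_for d) (bA : has_base A).
Hypotheses (hG : hausdorff_space G) (lG : locally_compact [set: G]).
Hypothesis actD : forall g a b, act g (a + b) = act g a + act g b.
Hypothesis act1 : forall a, act (tone G) a = a.
Hypothesis actM : forall g h a, act (tmul g h) a = act g (act h a).
Hypothesis act_cont : continuous (fun ga : G * A => act ga.1 ga.2).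
Variables (P1 : set G -> R) (P : forall m, set (tpow G m) -> R).
Hypotheses (hP1 : qinv P1) (hP : forall m, qinv (@P m)).

Definition diag_mul m (g : G) (x : Gpow G m) : Gpow G m := fun l => tmul g (x l).

Definition equivariant m (U : Gpow G m -> A) : Prop := forall g x, U (diag_mul g x) = act g (U x).

Lemma act_sign g a k : act g (a *~ (-1) ^+ k) = act g a *~ (-1) ^+ k.
Proof. by rewrite !mul_sign; case: ifP => // _; exact: (actN actD). Qed.

Lemma act_sum g m (a : 'I_m -> A) : act g (\sum_j a j) = \sum_j act g (a j).
Proof. by apply: (big_morph (act g)) => //; exact: (act0 actD). Qed.

Lemma equivariant0 m : equivariant (fun _ : Gpow G m => 0).
Proof. by move=> g x; rewrite (act0 actD). Qed.

Lemma equivariant_mixd m i (a b : Gpow G m -> A) : equivariant a -> equivariant b -> equivariant (mixd i a b).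
Proof.
move=> ea eb g X; rewrite /mixd act_sum; apply: eq_bigr => j _; rewrite act_sign.
by case: ifP => _; rewrite -?ea -?eb.
Qed.

Lemma coord_diag_mul m g (x : Gpow G m) l : (l < m)%N -> coord (diag_mul g x) l = tmul g (coord x l).
Proof. by move=> lm; rewrite !(coordE _ lm). Qed.

Lemma diag_mul_merge m i g (p q : nat -> G) (y : Gpow G m) :
  (forall l, (l < i)%N -> (l < m)%N -> q l = tmul g (p l)) ->
  diag_mul g (merge i p y) = merge i q (diag_mul g y).
Proof. by move=> pq; apply/funext => l; rewrite /diag_mul /merge; case: ifP => // li; rewrite pq. Qed.

(* [U] is continuous in measure as a function of its first [i] variables at the points of [S], and
   [mixd i U' U] vanishes almost everywhere on every slice with prefix in [S], not just on almost
   every one: the next step freezes prefixes at such points, in particular at the identity. *)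
Definition level n i (U' U : Gpow G n -> A) (S : set (Gpow G n)) : Prop :=
  [/\ borel_measurable U, equivariant U,
      [/\ Gdelta_set S, S (tone (tpow G n)), pnull (@P n) (~` S) &
          forall x x' g, (forall l, (l < i)%N -> coord x' l = tmul g (coord x l)) -> S x -> S x'],
      forall x, S x -> forall eps : R, 0 < eps -> \forall x' \near x,
        small d (@P n) eps (fun y => U (merge i (coord x') y) - U (merge i (coord x) y)) &
      forall x, S x -> pnull (@P n.+1) [set Y | mixd i U' U (merge i (coord x) Y) <> 0]].

Section one_step.
Variables (p i : nat) (U' U : Gpow G p.+1 -> A) (S : set (Gpow G p.+1)).
Hypotheses (le_ip : (i <= p)%N) (lev : level i U' U S).

Let Cl (F : Gpow G p.+1 -> A) := borel_measurable F /\ indep i.+1 F.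
Let L x F := Cl F /\ pnull (@P p.+2) [set Y | mixd i.+1 (fun=> 0) F Y <> defect i U x Y].

(** The representative, with first coordinate the identity, of the diagonal orbit of the prefix of
    length i+1. The other coordinates are erased, so the result depends on the prefix only; the
    length p+2 is that of the arguments of [defect]. *)
Definition normalize (z : Gpow G p.+1) : Gpow G p.+2 :=
  fun l => if (l < i.+1)%N then tmul (tinv (coord z 0)) (coord z l) else tone G.

Lemma normalize_continuous : continuous normalize.
Proof.
apply: pow_continuous => l; rewrite /normalize; case: (l < i.+1)%N; last exact: cont_cst.
exact: (cont_comp2 (h := fun a b : G => tmul (tinv a) b) (@coord_continuous_nat G p.+1 0)
  (@coord_continuous_nat G p.+1 l) (@tdivl_continuous G)).
Qed.

Lemma coord_normalize z l : (l < i.+1)%N -> coord (normalize z) l = tmul (tinv (coord z 0)) (coord z l).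
Proof.
move=> li; have lp : (l < p.+2)%N by lia.
by rewrite (coordE _ lp) /normalize /= li.
Qed.

Lemma normalize_eq z z' g : (forall l, (l < i.+1)%N -> coord z' l = tmul g (coord z l)) ->
  normalize z' = normalize z.
Proof.
move=> h; apply/funext => l; rewrite /normalize; case: ifP => // li.
by rewrite !h // tinvM -tmulA tmulKl.
Qed.

Let Tnull : pnull (@P p.+1) (normalize @^-1` (~` [set x | prefix_ok i S x])).
Proof.
have [_ _ [_ _ nS clS] _ _] := lev; have [p0 _] := hP p.+1.
(* [s j] lists the indices other than j and puts j last. Being injective it preserves null sets, and
   it agrees with [face j] on the first i coordinates, on which alone membership in [S] depends, up
   to translation. *)
pose s (j : 'I_p.+2) (k : 'I_p.+1) : 'I_p.+1 := inord (if (k < p)%N then bump j k else j).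
have si (j : 'I_p.+2) : (j < i.+1)%N -> injective (s j).
  move=> ji k k' /(congr1 val) /=; have [km km'] := (ltn_ord k, ltn_ord k').
  rewrite !inordK; first last.
  - by case: ifP; rewrite /bump; lia.
  - by case: ifP; rewrite /bump; lia.
  by move=> e; apply: val_inj => /=; move: e; case: ifP; case: ifP; rewrite /bump; lia.
apply: (@pnullS _ _ _ [set z : Gpow G p.+1 | exists j : 'I_p.+2, (j < i.+1)%N /\ ~ S (fun k => z (s j k))]); last first.
  apply: (pnull_big p0) => j; have [ji|ji] := ltnP j i.+1; last first.
    by apply: pnullS (pnull_set0 p0) => V [].
  by apply: pnullS (thom_null (thom_reindex G (si j ji)) (hP _) (hP _) nS) => z [].
move=> z /= nz; apply: contrapT => /forallNP h; apply: nz => j ji.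
have := h j; rewrite not_andE => -[//|/contrapT]; apply: (clS _ _ (tinv (coord z 0))) => l li.
have lp : (l < p.+1)%N by lia.
rewrite coord_face // coord_normalize; last by rewrite /bump; lia.
congr tmul; rewrite [RHS](coordE _ lp) /s /= ifT; last by lia.
by rewrite -[RHS]coord_ord inordK // /bump; lia.
Qed.

Lemma step_selection_exists : exists (D : nat -> set (Gpow G p.+2)) (F : Gpow G p.+2 -> Gpow G p.+1 -> A),
  [/\ forall n, [/\ open (D n), D n (tone (tpow G p.+2)) & pnull (@P p.+1) (normalize @^-1` (~` D n))],
      borel_measurable (fun xy : Gpow G p.+2 * Gpow G p.+1 => F xy.1 xy.2), forall x, Cl (F x),
      forall x, (\bigcap_n D n) x -> L x (F x) &
      forall x (eps : R), (\bigcap_n D n) x -> 0 < eps -> \forall x' \near x, close d (@P p.+1) eps (F x) (F x')].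
Proof.
have [bU _ [_ S1 nS clS] ScS Sco] := lev.
have [p0 _] := hP p.+1; have [p1 _] := hP p.+2; have [p2 _] := hP p.+3.
have le_ip1 : (i.+1 <= p.+1)%N by [].
apply: (@selection (Gpow G p.+2) (Gpow G p.+1) (Gpow G p.+1) (@P p.+1) normalize (@P p.+1) A d hd bA
  (tg_base (tpow G p.+2)) (hausdorff_pow (k:=p.+2) hG) (locally_compact_pow (k:=p.+2) hG lG) p0 p0 normalize_continuous L Cl
  [set x | prefix_ok i S x] (tone (tpow G p.+2)) _ Tnull _ _ _ _ _ _
  (* The centre used at stage k has a defect within 2^-k of that of x, which is the summability
     needed by [lift_limit]. *)
  (fun k x => [set x' | small d (@P p.+2) (2^-1 ^+ k) (fun Y => defect i U x' Y - defect i U x Y)])).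
- by move=> j _; exact: S1.
- by move=> x F [].
- by move=> F [].
- by split=> //; exact: borel_cst.
- move=> F hF; split; first by apply: (borel_seq_lim hd) => // k; case: (hF k).
  by move=> q y; congr seq_lim; apply/funext => k; case: (hF k) => _ ->.
- move=> x Tx.
  have [F clF nF] := lift_cocycle hP1 hP le_ip1 (borel_defect bA i bU x) (@defect_indep _ _ _ _ U x)
    (defect_cocycle hP le_ip1 Sco Tx).
  by exists F.
- move=> x F eps Tx [[bF iF] nF] e0.
  have [d1 d10 h1] := close_add hd p0 bF e0.
  have [d2 d20 h2] := lift_cocycle_small hd hP1 hP le_ip1 d10.
  apply: filterS (defect_cont hd hP ScS Tx d20) => x' sx Tx'.
  (* A solution at x' is [F] plus a small primitive of the difference of the two defects. *)
  have [|||r [br ir sr nr]] := h2 (fun Y => defect i U x' Y - defect i U x Y) _ _ _ sx.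
  + by apply: borel_sub => //; exact: borel_defect.
  + by move=> q Y; rewrite !defect_indep.
  + have n1 := defect_cocycle hP le_ip1 Sco Tx; have n2 := defect_cocycle hP le_ip1 Sco Tx'.
    apply: pnullS (pnullU p2 n1 n2) => V /= h; apply: contrapT => /not_orP[/contrapT e1 /contrapT e2].
    by apply: h; rewrite -mixd0B e1 e2 subr0.
  + exists (fun y => F y + r y); last exact: h1.
    split; first by split; [exact: borel_add|move=> q y; rewrite iF ir].
    apply: pnullS (pnullU p1 nF nr) => Y /= h; apply: contrapT => /not_orP[/contrapT e1 /contrapT e2].
    by apply: h; rewrite -mixd0D e1 e2 addrC subrK.
- move=> k x Tx; exact: (defect_cont hd hP ScS Tx (half_pow_gt0 k)).
- move=> x c F hc nF; split.
    split; first by apply: (borel_seq_lim hd) => // k; have [_ _ [[]]] := hc k.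
    by move=> q y; congr seq_lim; apply/funext => k; have [_ _ [[_ ->]]] := hc k.
  apply: (lift_limit hd hP nF (c := fun k => defect i U (c k))) => k; first by have [_ _ []] := hc k.
  by have [_ + _] := hc k.
Qed.

Lemma next_level (mu : set (tpow G p.+1) -> \bar R) : is_haar_measure (@tmul (tpow G p.+1)) mu ->
  exists U2 S2, level i.+1 U U2 S2.
Proof.
move=> hmu; have [bU eU _ _ _] := lev.
have [p0 _] := hP p.+1.
have [D [F [hD bF ClF LF cF]]] := step_selection_exists.
(* The solution over the normalized prefix, transported back by X_0; strict equivariance is built
   in. *)
pose U2 (X : Gpow G p.+1) : A := act (coord X 0) (F (normalize X) (diag_mul (tinv (coord X 0)) X)).
have U2merge x y q g : (forall l, (l < i.+1)%N -> q l = tmul g (coord x l)) ->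
    U2 (merge i.+1 q y) = act (q 0%N) (F (normalize x) (diag_mul (tinv (q 0%N)) y)).
  move=> hq; rewrite /U2 coord_merge //=; congr (act _ _).
  rewrite (@normalize_eq x _ g); last by move=> l li; rewrite coord_merge ?li ?hq //; lia.
  rewrite (@diag_mul_merge _ _ _ _ (fun l => tmul (tinv (q 0%N)) (q l))) //.
  by have [_ ->] := ClF (normalize x).
have eU2 : equivariant U2.
  move=> g x; rewrite /U2 (@normalize_eq x _ g); last by move=> l li; rewrite coord_diag_mul //; lia.
  rewrite coord_diag_mul // actM; congr (act _ (act _ (F _ _))).
  by apply/funext => l; rewrite /diag_mul tinvM -tmulA tmulKl.
have S2D z : (\bigcap_k (normalize @^-1` D k)) z -> (\bigcap_k D k) (normalize z).
  by move=> h k _; exact: h.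
exists U2, (\bigcap_k (normalize @^-1` D k)); split=> //.
- apply: (borel_comp (f := fun X : Gpow G p.+1 => (coord X 0, F (normalize X) (diag_mul (tinv (coord X 0)) X)))
     (g := fun ga : G * A => act ga.1 ga.2)).
    exact: continuous_borel.
  apply: (borel_pair (tg_base G) bA); first exact: (continuous_borel (@coord_continuous_nat G p.+1 0)).
  apply: (borel_comp (f := fun X : Gpow G p.+1 => (normalize X, diag_mul (tinv (coord X 0)) X)) bF).
  apply: continuous_borel; apply: cont_pair; first exact: normalize_continuous.
  apply: pow_continuous => l.
  exact: (cont_comp2 (h := fun a b : G => tmul (tinv a) b) (@coord_continuous_nat G p.+1 0)
    (@coord_continuous G p.+1 l) (@tdivl_continuous G)).
- split.
  + exists (fun k => normalize @^-1` D k); split=> // k; have [oD _ _] := hD k.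
    by move/continuousP: normalize_continuous; apply.
  + move=> k _ /=; have [_ h _] := hD k.
    rewrite (_ : normalize _ = tone (tpow G p.+2)) //; apply/funext => l; rewrite /normalize.
    by case: ifP => // li; rewrite /coord; do 2!case: insubP => *; rewrite ?tVmul ?tinv1 ?t1mul.
  + rewrite setC_bigcap; apply: (pnull_bigcup p0) => k; by have [] := hD k.
  + by move=> x x' g h Sx k _ /=; rewrite (normalize_eq h); exact: Sx.
(* Slices of [U2] are translates by x_0 of the selected functions: [F] varies continuously with the
   normalized prefix, and [gact_cont] takes care of the translation. *)
- move=> x /S2D Dx eps e0; have [bF0 _] := ClF (normalize x).
  have [d1 d10 h1] := gact_cont hd bA hG lG actD act1 actM act_cont hmu (hP p.+1) (coord x 0) bF0 e0.
  have [d2 d20 h2] := small_of_close hd p0 bF0 d10.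
  have n1 : nbhs x (normalize @^-1` [set z | close d (@P p.+1) d2 (F (normalize x)) (F z)]).
    exact: (normalize_continuous (cF _ _ Dx d20)).
  have n2 := @coord_continuous_nat G p.+1 0 x _ h1.
  apply: filterS2 n1 n2 => x' /= /h2 c1 c2.
  apply: (@small_ext _ _ _ _ _ (fun y => cochain_act (@tmul G) (@tinv G) act (coord x' 0) (F (normalize x')) y -
    cochain_act (@tmul G) (@tinv G) act (coord x 0) (F (normalize x)) y)); last exact: c2.
  move=> y; rewrite (@U2merge x y (coord x) (tone G)); last by move=> l _; rewrite t1mul.
  by rewrite (@U2merge x' y (coord x') (tone G)) // => l _; rewrite t1mul.
- move=> x /S2D Dx; have [_ nL] := LF _ Dx.
  pose g0 := coord x 0.
  have nT := @qinv_translate (tpow G p.+2) _ (@tinv (tpow G p.+2) (fun=> g0)) _ (hP p.+2) nL.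
  apply: pnullS nT => Y /= h.
  apply: contra_not h => e.
  (* Both functions are equivariant, so translating by x_0^-1 reduces the equation to the normalized
     prefix, where [F] was chosen to solve it. *)
  have -> : merge i.+1 (coord x) Y = diag_mul g0 (merge i.+1 (coord (normalize x)) (diag_mul (tinv g0) Y)).
    rewrite (@diag_mul_merge _ _ _ _ (coord x)).
      by congr merge; apply/funext => l; rewrite /diag_mul tmulVKl.
    by move=> l li _; rewrite coord_normalize // tmulVKl.
  rewrite equivariant_mixd // -[RHS](act0 actD g0); congr act.
  set M := merge _ _ _.
  have -> : mixd i.+1 U U2 M = mixd i.+1 U (fun=> 0) M + mixd i.+1 (fun=> 0) U2 M.
    by rewrite mixdD; apply: eq_mixd => j _; rewrite ?addr0 ?add0r.
  have -> : mixd i.+1 (fun=> 0) U2 M = mixd i.+1 (fun=> 0) (F (normalize x)) (diag_mul (tinv g0) Y).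
    apply: eq_mixd => // j ij; rewrite /M face_merge_ge //.
    rewrite (@U2merge x _ _ (tinv g0)); last by move=> l li; rewrite coord_normalize.
    rewrite coord_normalize // tVmul act1 tinv1; congr (F _ _).
    by apply/funext => l; rewrite /diag_mul t1mul.
  by rewrite [X in _ + X]e /defect addrN.
Qed.

End one_step.
End step.

(** * The homotopy *)

Section homotopy.
Variables (G : tgroup) (A : topologicalZmodType) (d : A -> A -> R) (act : G -> A -> A).
Hypotheses (hd : complete_metric_for d) (bA : has_base A).
Hypotheses (hG : hausdorff_space G) (lG : locally_compact [set: G]).
Hypothesis actD : forall g a b, act g (a + b) = act g a + act g b.
Hypothesis act1 : forall a, act (tone G) a = a.
Hypothesis actM : forall g h a, act (tmul g h) a = act g (act h a).
Hypothesis act_cont : continuous (fun ga : G * A => act ga.1 ga.2).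
Variables (P1 : set G -> R) (P : forall m, set (tpow G m) -> R).
Hypotheses (hP1 : qinv P1) (hP : forall m, qinv (@P m)).

Lemma borel_neq (T : topologicalType) (f g : T -> A) :
  borel_measurable f -> borel_measurable g -> borel_sets [set y | f y <> g y].
Proof. by move=> bf bg; apply: borel_eq => //; exact: (metric_sep hd). Qed.

(** Fubini over an independent prefix: [merge] is a surjective homomorphism, so a set null on almost
    every slice is null. *)
Lemma level_ae n i (U' U : Gpow G n -> A) S : (i <= n)%N -> borel_measurable U' ->
  level d act P i U' U S -> pnull (@P n.+1) [set X | mixd i U' U X <> 0].
Proof.
move=> le_in bU' [bU _ [_ _ nS _] _ hS].
have [PQ [hPQ _ mk _ _]] := qinv_prod (hP n) (hP n.+1).
have bN : borel_sets [set X | mixd i U' U X <> 0].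
  by apply: borel_neq; [exact: borel_mixd|exact: borel_cst].
have th := thom_merge G n.+1 le_in; have [mc _ _] := th.
have bN' := continuous_borel mc bN.
exists [set X | mixd i U' U X <> 0]; split=> //.
apply: (thom_null_inv th hPQ (hP n.+1) bN).
have [pPQ _] := hPQ; apply: (pnull_borel pPQ bN'); apply: mk => //.
apply: pnullS nS => x /= h Sx; apply: h; exact: hS.
Qed.

Lemma ins_diag_mul m i g k (y : Gpow G m) : (i <= m)%N ->
  ins i (tmul g k) (diag_mul g y) = diag_mul g (ins i k y).
Proof.
move=> im; apply/funext => l; have lm := ltn_ord l; rewrite /ins /diag_mul -/(diag_mul _ _).
case: ifP => li; first by rewrite coord_diag_mul //; lia.
by case: ifP => li' //; rewrite coord_diag_mul //; lia.
Qed.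

Variables (p : nat) (tau : Gpow G p.+1 -> A).
Hypotheses (btau : borel_measurable tau) (etau : equivariant act tau).
Hypothesis dtau : pnull (@P p.+2) [set X | dcob tau X <> 0].

(** The clause for p = 0 is there because degree 0 has no coboundaries: a constant on the one-point
    power must not count. *)
Definition homotopic i (U : Gpow G p.+1 -> A) (Z' Z : Gpow G p -> A) : Prop :=
  [/\ borel_measurable Z, equivariant act Z, p = 0%N -> forall y, Z y = 0 &
      pnull (@P p.+1) [set x | U x - tau x <> mixd i Z' Z x]].

(* Inserting [y_0 a] rather than a constant keeps the primitive strictly equivariant. *)
Lemma next_homotopic i U Z' Z U2 : (i <= p)%N -> homotopic i U Z' Z ->
  borel_measurable U2 -> equivariant act U2 ->
  pnull (@P p.+2) [set X | mixd i.+1 U U2 X <> 0] -> exists Z2, homotopic i.+1 U2 Z Z2.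
Proof.
move=> ip [bZ eZ Z0 hZ] bU2 eU2 nU.
have [p1 _] := hP p.+1; have [p2 _] := hP p.+2.
(* The new primitive has to satisfy D_(i+1)(0, Z2) = C. *)
pose C x := U2 x - tau x - mixd i.+1 Z (fun=> 0) x.
have bC : borel_measurable C.
  apply: borel_sub => //; first exact: borel_sub.
  by apply: borel_mixd => //; exact: borel_cst.
have eC : equivariant act C.
  move=> g x; rewrite /C eU2 etau (equivariant_mixd actD) // ?(actB actD) //.
  exact: equivariant0.
have nC : pnull (@P p.+2) [set V | mixd i.+1 (fun=> 0) C V <> 0].
  have n1 := pnull_big p2 (fun j : 'I_p.+2 => thom_null (thom_face G j) (hP p.+2) (hP p.+1) hZ).
  apply: pnullS (pnullU p2 n1 (pnullU p2 nU dtau)) => V /= h.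
  apply: contrapT => /not_orP[/forallNP h1 /not_orP[/contrapT h2 /contrapT h3]]; apply: h.
  have h4 := mixd_mixd i Z' Z (fun=> 0) V.
  (* The three terms vanish a.e. by the equation linking [U] and [U2], the cocycle condition on
     [tau], and [mixd_mixd]. *)
  have -> : mixd i.+1 (fun=> 0) C V =
     mixd i.+1 U U2 V - mixd i.+1 tau tau V - mixd i.+1 (mixd i Z' Z) (mixd i.+1 Z (fun=> 0)) V.
    rewrite !mixdB; apply: eq_mixd => // j ji.
    by apply/esym/eqP; rewrite subr_eq0; apply/eqP; exact: contrapT (h1 j).
  by rewrite h2 h4 -dcobE h3 !subr0.
pose N : set (G * tpow G p.+1) := [set kY | mixd i.+1 (fun=> 0) C (ins i.+1 kY.1 kY.2) <> 0].
have bN : borel_sets N.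
  have := continuous_borel (@ins_continuous G p.+1 i.+1) (B := [set V | mixd i.+1 (fun=> 0) C V <> 0]).
  apply; apply: borel_neq; last exact: borel_cst.
  by apply: borel_mixd => //; exact: borel_cst.
have [a ha] := twist_null hP1 (hP p.+1) bN (ins_null hP1 hP (ip : (i.+1 <= p.+1)%N) nC).
(* For i = p no face is left for [Z2], and 0 respects the clause for p = 0; for i < p the coordinate
   y_0 exists. *)
pose Z2 (y : Gpow G p) : A :=
  if (i < p)%N then C (ins i.+1 (tmul (coord y 0) a) y) *~ (-1) ^+ (p.+1 - i.+1).+1 else 0.
exists Z2; split.
- rewrite /Z2; case: (i < p)%N; last exact: borel_cst.
  apply: borel_sign => //; apply: (borel_comp bC); apply: continuous_borel.
  apply: (cont_comp2 (h := @ins G p i.+1) _ (@cont_id _) (@ins_continuous G p i.+1)).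
  exact: (cont_comp2 (h := @tmul G) (@coord_continuous_nat G p 0) (@cont_cst _ _ a) (@tmul_continuous G)).
- move=> g y; rewrite /Z2; have [ltip|_] := ltnP i p; last by rewrite (act0 actD).
  have p_gt0 : (0 < p)%N by lia.
  by rewrite (act_sign actD) -eC -ins_diag_mul // coord_diag_mul // tmulA.
- by move=> p0 y; rewrite /Z2 ifF // p0.
- apply: pnullS ha => Y /= h; apply: contra_not h => e.
  have -> : U2 Y - tau Y = mixd i.+1 Z (fun=> 0) Y + C Y by rewrite [RHS]addrC /C subrK.
  rewrite -(@lift_eq _ _ _ _ C _ Y (ip : (i.+1 <= p.+1)%N) e) mixdD; apply: eq_mixd => j ij; first by rewrite addr0.
  have jp := ltn_ord j; rewrite add0r /Z2 ifT; last by lia.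
  (* Only faces with j > i occur here; they keep the first variable, so all of them receive the same
     inserted element Y_0 a. *)
  have -> : coord (face j Y) 0 = Y ord0; last by [].
  rewrite coord_face; last by lia.
  by rewrite -[RHS]coord_ord; congr (coord Y _); rewrite /bump /=; lia.
Qed.

Lemma level_chain (mu : set (tpow G p.+1) -> \bar R) i : is_haar_measure (@tmul (tpow G p.+1)) mu ->
  (i <= p.+1)%N -> exists U' U S Z' Z, [/\ borel_measurable U', level d act P i U' U S,
    borel_measurable Z' /\ equivariant act Z', p = 0%N -> forall y, Z' y = 0 & homotopic i U Z' Z].
Proof.
move=> hmu; elim: i => [_|i ih ip].
  (* At level 0 nothing is frozen: the slice equation is the cocycle equation for [tau]. *)
  exists tau, tau, setT, (fun=> 0), (fun=> 0); split=> //.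
  - split=> //.
    + split=> //; last by rewrite setCT; apply: pnull_set0; have [] := hP p.+1.
      by exists (fun=> setT); split=> [_|]; [exact: openT|rewrite bigcap_const //; exists 0%N].
    + move=> x _ eps e0; apply: (filterS _ (@filterT _ (nbhs x) _)) => x' _; have [p1 _] := hP p.+1; apply: small_zero => // y.
      by rewrite (_ : merge 0 (coord x') y = merge 0 (coord x) y) ?subrr.
  - by split; [exact: borel_cst|exact: equivariant0].
  - split=> //; [exact: borel_cst|exact: equivariant0|].
    apply: pnullS (pnull_set0 (proj1 (hP p.+1))) => x /=; rewrite subrr; apply.
    by rewrite /mixd big1 // => j _; rewrite mul0rz.
have [U' [U [S [Z' [Z [bU' lev _ _ hZ]]]]]] := ih (ltnW ip).
have [U2 [S2 lev2]] := next_level hd bA hG lG actD act1 actM act_cont hP1 hP (ip : (i <= p)%N) lev hmu.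
have [bU _ _ _ _] := lev; have [bU2 eU2 _ _ _] := lev2.
have [Z2 hZ2] := next_homotopic (ip : (i <= p)%N) hZ bU2 eU2 (level_ae ip bU lev2).
exists U, U2, S2, Z, Z2; have [bZ eZ Z0 _] := hZ; split=> //.
Qed.

(** [eps <= 1] keeps the exceptional set from being everything. *)
Lemma small_cst (T : topologicalType) (Q : set T -> R) (eps : R) (a : A) : borel_prob Q -> eps <= 1 ->
  small d Q eps (fun=> a) -> d 0 a < eps.
Proof.
move=> hQ e1 [B [bB QB h]].
have [y nB] : exists y, ~ B y.
  apply/not_existsP => hB; move: QB; rewrite (_ : B = setT); first by rewrite (probT hQ) ltNge e1.
  by apply/seteqP; split=> // y _; apply: contrapT; exact: hB.
exact: h nB.
Qed.

Lemma level_continuous n (U' U : Gpow G n -> A) S x : level d act P n U' U S -> S x -> {for x, continuous U}.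
Proof.
move=> [_ _ _ hc _] Sx V nV; have [p1 _] := hP n.
have : nbhs (0 : A) ((fun a => a + U x) @^-1` V).
  apply: (cont_comp2 (h := +%R) (@cont_id A) (@cont_cst A A (U x)) (@add_continuous A)).
  by rewrite add0r.
move=> /(nbhs_dball hd)[e1 e10 eV].
have e20 : 0 < Num.min e1 1 by rewrite lt_min e10 ltr01.
have mE (z y : Gpow G n) : merge n (coord z) y = z.
  by apply/funext => l; rewrite /merge ltn_ord coord_ord.
apply: filterS (hc x Sx _ e20) => x' h.
have {h} : small d (@P n) (Num.min e1 1) (fun=> U x' - U x).
  by apply: small_ext h => y; rewrite !mE.
move/(small_cst p1); rewrite ge_min lexx orbT lt_min => /(_ isT)/andP[/eV + _].
by rewrite /= subrK.
Qed.

Lemma strict_cocycle (mu : set (tpow G p.+1) -> \bar R) : is_haar_measure (@tmul (tpow G p.+1)) mu ->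
  exists (sigma : Gpow G p.+1 -> A) (beta : Gpow G p -> A) (S : set (Gpow G p.+1)),
  [/\ borel_measurable sigma /\ equivariant act sigma,
      [/\ borel_measurable beta, equivariant act beta & p = 0%N -> forall y, beta y = 0],
      pnull (@P p.+1) [set x | sigma x - tau x <> dcob beta x],
      pnull (@P p.+2) [set X | dcob sigma X <> 0] &
      [/\ Gdelta_set S, pnull (@P p.+1) (~` S), S (tone (tpow G p.+1)) &
          forall x, S x -> {for x, continuous sigma}]].
Proof.
move=> hmu; have [U' [U [S [Z' [Z [_ lev [bZ eZ] Z0 [_ _ _ hZ]]]]]]] := level_chain hmu (leqnn p.+1).
have [bU eU [gS S1 nS _] _ _] := lev.
have hU : pnull (@P p.+1) [set x | U x - tau x <> dcob Z' x].
  by apply: pnullS hZ => x /=; rewrite mixd_dcobT.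
exists U, Z', S; split=> //; last by split=> // x; exact: level_continuous lev.
have [p2 _] := hP p.+2.
have n1 := pnull_big p2 (fun j : 'I_p.+2 => thom_null (thom_face G j) (hP p.+2) (hP p.+1) hU).
apply: pnullS (pnullU p2 n1 dtau) => X /= h; apply: contrapT => /not_orP[/forallNP h1 /contrapT h2]; apply: h.
(* With three equal functions this is d d = 0 for [Z'], so [U] and [tau] have the same coboundary
   a.e. *)
have := mixd_mixd 0 Z' Z' Z' X.
rewrite (@eq_mixd _ _ _ _ _ _ (fun y => U y - tau y) (fun y => U y - tau y) _ X).
- by rewrite -mixdB -!dcobE h2 subr0.
- by move=> j _; rewrite -dcobE; apply/esym; exact: contrapT (h1 j).
- by move=> j _; rewrite -dcobE; apply/esym; exact: contrapT (h1 j).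
Qed.

End homotopy.

(** * Conclusion *)

Section assembly.
Variables (G : tgroup) (A : topologicalZmodType) (d : A -> A -> R) (act : G -> A -> A).
Hypotheses (hd : complete_metric_for d) (bA : has_base A).
Hypotheses (hG : hausdorff_space G) (lG : locally_compact [set: G]).
Hypothesis actD : forall g a b, act g (a + b) = act g a + act g b.
Hypothesis act1 : forall a, act (tone G) a = a.
Hypothesis actM : forall g h a, act (tmul g h) a = act g (act h a).
Hypothesis act_cont : continuous (fun ga : G * A => act ga.1 ga.2).

(** [haar_null] may bring a different Haar measure each time; [qinv_haar] identifies all their null
    sets with those of [P]. *)
Lemma null_in_pnull m (P : set (tpow G m) -> R) N : qinv P -> null_in (@tmul G) N -> pnull P N.
Proof.
move=> hP [mu [hmu [B bB [NB B0]]]]; exists B; split=> //.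
by have [_] := qinv_haar (H := tpow G m) (hausdorff_pow hG) (locally_compact_pow hG lG) hmu hP bB; apply.
Qed.

Lemma pnull_null_in m (P : set (tpow G m) -> R) mu N : qinv P ->
  is_haar_measure (pow_mul (@tmul G) (k := m)) mu -> pnull P N -> null_in (@tmul G) N.
Proof.
move=> hP hmu [B [bB B0 NB]]; exists mu; split=> //; exists B => //; split=> //.
by have [+ _] := qinv_haar (H := tpow G m) (hausdorff_pow hG) (locally_compact_pow hG lG) hmu hP bB; apply.
Qed.

(** The function x |-> (x_0 a) tau((x_0 a)^-1 x) is strictly equivariant for every a, and by
    [twist_null] it agrees a.e. with [tau] for a suitable one. *)
Lemma strictify p (P1 : set G -> R) (P : set (tpow G p.+1) -> R) (tau : Gpow G p.+1 -> A) :
  qinv P1 -> qinv P -> borel_measurable tau ->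
  (forall g, pnull P [set x | cochain_act (@tmul G) (@tinv G) act g tau x <> tau x]) ->
  exists tau', [/\ borel_measurable tau', equivariant act tau' & pnull P [set x | tau' x <> tau x]].
Proof.
move=> hP1 hP bt ht.
pose h (gx : G * tpow G p.+1) : A := cochain_act (@tmul G) (@tinv G) act gx.1 tau gx.2.
have bh : borel_measurable h.
  apply: (borel_comp (f := fun gx : G * tpow G p.+1 => (gx.1, tau (fun l => tmul (tinv gx.1) (gx.2 l))))
    (g := fun ga : G * A => act ga.1 ga.2)); first exact: continuous_borel.
  apply: (borel_pair (tg_base G) bA); first exact: (continuous_borel (@cont_fst G (tpow G p.+1))).
  apply: (borel_comp bt); apply: continuous_borel; apply: pow_continuous => l.
  apply: (cont_comp2 (h := fun a b : G => tmul (tinv a) b) (@cont_fst G (tpow G p.+1)) _ (@tdivl_continuous G)).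
  exact: (cont_comp (@cont_snd G (tpow G p.+1)) (@coord_continuous G p.+1 l)).
have bN : borel_sets [set gx : G * tpow G p.+1 | h gx <> tau gx.2].
  apply: (borel_neq hd bA bh); apply: (borel_comp bt).
  exact: (continuous_borel (@cont_snd G (tpow G p.+1))).
have [p1 _] := hP1.
have [a ha] : exists a, pnull P [set x | h (tmul (x ord0) a, x) <> tau x].
  apply: (twist_null hP1 hP bN); apply: pnullS (pnull_set0 p1) => g /=; apply; exact: ht.
exists (fun x => h (tmul (x ord0) a, x)); split=> //.
  apply: (borel_comp bh); apply: continuous_borel; apply: cont_pair; last exact: cont_id.
  exact: (cont_comp2 (h := @tmul G) (@coord_continuous G p.+1 ord0) (@cont_cst _ _ a) (@tmul_continuous G)).
move=> g x; rewrite /h /cochain_act /= -tmulA actM; congr (act _ (act _ (tau _))).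
by apply/funext => l; rewrite /diag_mul !tinvM -!tmulA tmulKl.
Qed.

Lemma equivariant_class_of_strict m (U : Gpow G m -> A) mu :
  is_haar_measure (pow_mul (@tmul G) (k := m)) mu -> equivariant act U ->
  equivariant_class (@tmul G) (@tinv G) act U.
Proof.
move=> hmu eU g; exists mu; split=> //; exists set0; first exact: borel0.
split; last by have [[[]]] := hmu.
move=> x; apply; rewrite /cochain_act -/(diag_mul _ _) eU -actM tmulV; exact: act1.
Qed.

Lemma cocycle_representative p (tau : Gpow G p.+1 -> A) :
  borel_measurable tau -> equivariant_class (@tmul G) (@tinv G) act tau ->
  haar_ae_eq (@tmul G) (dcob tau) (fun=> 0) ->
  exists sigma : Gpow G p.+1 -> A,
    [/\ borel_measurable sigma,
        equivariant_class (@tmul G) (@tinv G) act sigma,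
        haar_ae_eq (@tmul G) (dcob sigma) (fun _ => 0),
        cohomologous (@tmul G) (@tinv G) act sigma tau &
        exists S : set (Gpow G p.+1),
          [/\ Gdelta_set S, dense S, null_in (@tmul G) (~` S), S (fun _ => tone G) &
              forall x, S x -> {for x, continuous sigma}]].
Proof.
move=> bt et dt; have [mu1 [hmu1 _]] := et (tone G); have [mu2 [hmu2 _]] := dt.
have [Q hQ _] := haar_prob (H := tpow G p.+1) (hausdorff_pow hG) (locally_compact_pow hG lG) hmu1.
(* The measure on [G] is the image of the one on G^(p+1); all powers then get measures from it. *)
pose P1 (B : set G) : R := Q ((fun x : Gpow G p.+1 => x ord0) @^-1` B).
have hP1 : qinv P1 by exact: qinv_push (thom_coord0 G p) hQ.
pose P m := sval (cid (qinv_pow hP1 m)).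
have hP m : qinv (@P m) by rewrite /P; case: cid.
have [t [bt' et' tt']] : exists tau', [/\ borel_measurable tau', equivariant act tau' &
    pnull (@P p.+1) [set x | tau' x <> tau x]].
  apply: (strictify hP1 (hP p.+1) bt) => g; exact: (null_in_pnull (hP p.+1) (et g)).
have [p1 _] := hP p.+1; have [p2 _] := hP p.+2.
have dt' : pnull (@P p.+2) [set X | dcob t X <> 0].
  have n1 := pnull_big p2 (fun j : 'I_p.+2 => thom_null (thom_face G j) (hP p.+2) (hP p.+1) tt').
  apply: pnullS (pnullU p2 n1 (null_in_pnull (hP p.+2) dt)) => X /= h.
  apply: contrapT => /not_orP[/forallNP h1 /contrapT h2]; apply: h.
  by rewrite -h2; apply: eq_bigr => j _; congr (_ *~ _); exact: contrapT (h1 j).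
have [s [b [S [[bs es] [bb eb b0] st ds [gS nS S1 cS]]]]] :=
  strict_cocycle hd bA hG lG actD act1 actM act_cont hP1 hP bt' et' dt' hmu1.
exists s; split=> //.
- exact: equivariant_class_of_strict hmu1 es.
- exact: (pnull_null_in (hP p.+2) hmu2 ds).
- case: p => [|p] in tau t bt et dt mu1 hmu1 mu2 hmu2 Q hQ P1 hP1 P hP bt' et' tt' p1 p2 dt' s b S bs es bb eb b0 st ds gS nS S1 cS *.
    (* Degree 0: the primitive is zero, so [s] and [tau] agree a.e. *)
    apply: (pnull_null_in (hP 1%N) hmu1); apply: pnullS (pnullU p1 st tt') => x /= h.
    apply: contrapT => /not_orP[/contrapT h1 /contrapT h2]; apply: h.
    rewrite -h2; apply/eqP; rewrite -subr_eq0 h1; apply/eqP.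
    by rewrite /dcob big1 // => j _; rewrite b0 // mul0rz.
  exists b; split=> //.
    (* The a.e. equivariance of [b] is stated on a power with one factor fewer than that of
       [tau]. *)
    have [mu3 hmu3] := haar_pow_pred hG lG hmu1.
    exact: equivariant_class_of_strict hmu3 eb.
  apply: (pnull_null_in (hP p.+2) hmu1); apply: pnullS (pnullU p1 st tt') => x /= h.
  by apply: contrapT => /not_orP[/contrapT h1 /contrapT h2]; apply: h; rewrite -h2.
- exists S; split=> //; first exact: (qinv_dense (hP p.+1) nS).
  exact: (pnull_null_in (hP p.+1) hmu1 nS).
Qed.

End assembly.

Theorem theoremB (G : topologicalType) (mul : G -> G -> G) (inv : G -> G) (e : G)
    (A : topologicalZmodType) (act : G -> A -> A) (p : nat) :
  is_lcsc_group mul inv e ->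
  is_polish_Gmodule mul e act ->
  (* every class of H^p_m(G,A), given by any measurable cocycle tau *)
  forall tau : Gpow G p.+1 -> A,
    borel_measurable tau ->
    equivariant_class mul inv act tau ->
    haar_ae_eq mul (dcob tau) (fun _ => 0) ->
  exists sigma : Gpow G p.+1 -> A,
    [/\ borel_measurable sigma,
        equivariant_class mul inv act sigma,
        haar_ae_eq mul (dcob sigma) (fun _ => 0),
        cohomologous mul inv act sigma tau &
        exists S : set (Gpow G p.+1),
          [/\ Gdelta_set S, dense S, null_in mul (~` S),
              S (fun _ => e) &
              forall x, S x -> {for x, continuous sigma}]].
Proof.
move=> [tgG hG lG scG] [[sepA [d hd]] actD act1 actM act_cont] tau.
exact: (@cocycle_representative (TGroup tgG (second_countable_has_base scG)) A d act hd
  (separable_has_base hd sepA) hG lG actD act1 actM act_cont p tau).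
Qed.
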